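(* Consider $n$ independent types of stations: for $i\in[n]$, initial positions form a homogeneous Poisson point process on $\mathbb R^2$ of intensity $\lambda_i$, each station moves at speed $v_i$ in an independent uniform direction, with $v_1>v_2>\dots>v_n$; let $\lambda=\sum_i\lambda_i$. Then: (i) $\Lambda_i=\frac{4v_i\sqrt\lambda}{\pi}\big(\frac{\lambda_i}{\lambda}\big)^2$ for $i\in[n]$; (ii) for every $i\neq j$, $\Lambda^{(1)}_{i,j}=\Lambda^{(2)}_{j,i}$ and $\Lambda^{(2)}_{i,j}=\Lambda^{(1)}_{j,i}$; (iii) for every $j<i$ and $k\in\{1,2\}$, $$\Lambda^{(k)}_{i,j}=4\lambda_i\lambda_jv_iv_j\int_0^\infty\Big[\int_0^{h_j}\int_{t^*}^\infty e^{-\lambda\pi\hat h_k^2(t,h_j,h_i)}dt\,dh_i+\int_{h_j}^\infty\int_0^\infty e^{-\lambda\pi\hat h_k^2(t,h_j,h_i)}dt\,dh_i\Big]dh_j,$$ where $\hat h_k^2(t,h_j,h_i)=v_j^2\big(\frac{v_i^2t+(-1)^k\sqrt{\Delta_{i,j}}}{v_j^2-v_i^2}\big)^2+h_j^2$, $\Delta_{i,j}=v_j^2v_i^2t^2-(h_j^2-h_i^2)(v_j^2-v_i^2)$, and $t^*=\frac1{v_jv_i}(h_j^2-h_i^2)^{1/2}(v_j^2-v_i^2)^{1/2}$.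
   Context: A user at the origin is served by the nearest station; a handover is a time at which two stations are simultaneously nearest. For a type-$i$ station, its head $(T,H)$ is the time and value of its minimal distance to the origin and its radial bird is $\{(t,(v_i^2(t-T)^2+H^2)^{1/2})\}$; handovers are intersections of two radial birds lying on the graph of the nearest-station distance. $\Lambda_i$ is the intensity of handovers produced by two type-$i$ birds. For $i\neq j$, $\Lambda^{(k)}_{i,j}$ is the intensity of handovers produced by the $k$-th (in time order) intersection of a type-$i$ bird and a type-$j$ bird whose type-$i$ head lies to the left (smaller time coordinate) of the type-$j$ head. *)

(* Defs.v *)
From HB Require Import structures.
From mathcomp Require Import all_boot all_order all_algebra.
From mathcomp Require Import all_classical all_reals all_analysis.
Set Implicit Arguments. Unset Strict Implicit. Unset Printing Implicit Defensive.
Import Order.TTheory GRing.Theory Num.Theory.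
Import numFieldNormedType.Exports.
Local Open Scope classical_set_scope.
Local Open Scope ring_scope.

Section Stations.
Variables (R : realType) (n : nat).

(* A station: (type i, ((x1, x2), theta)) = type, initial position in R^2,
   direction angle theta in [0, 2 pi). *)
Definition station := ('I_n * ((R * R) * R))%type.

Definition leb3 : set ((R * R) * R) -> \bar R :=
  ((@lebesgue_measure R \x @lebesgue_measure R) \x @lebesgue_measure R)%E.

(* Mean measure of the type-i marked process: lam_i * Leb2 (x) Unif[0,2pi). *)
Definition mean_meas (lam : 'I_n -> R) (i : 'I_n) (A : set ((R * R) * R))
  : \bar R :=
  ((lam i / (2 * pi))%:E *
   leb3 (A `&` [set x | (0 <= x.2)%R /\ (x.2 < 2 * pi)%R]))%E.

Definition has_card (T : eqType) (A : set T) (c : nat) : Prop :=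
  exists l : seq T, uniq l /\ [set x | x \in l] = A /\ size l = c.

Definition poisson_prob (mu : R) (c : nat) : R :=
  expR (- mu) * mu ^+ c / c`!%:R.

(* S is an independently marked Poisson process: for each type i, positions
   form a homogeneous PPP of intensity lam i on R^2, each station carries an
   independent uniform direction in [0, 2 pi), and the n types are
   independent. Stated through the joint law of counts on finitely many
   pairwise disjoint measurable sets of finite mean measure. *)
Definition marked_PPP d (Omega : measurableType d) (P : probability Omega R)
  (lam : 'I_n -> R) (S : Omega -> set station) : Prop :=
  forall (m : nat) (ty : 'I_m -> 'I_n) (A : 'I_m -> set ((R * R) * R))
         (c : 'I_m -> nat),
    (forall k, measurable (A k)) ->
    (forall k, (mean_meas lam (ty k) (A k) < +oo)%E) ->
    (forall k l, k != l -> ty k = ty l -> A k `&` A l = set0) ->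
    let E := \bigcap_(k in [set: 'I_m])
               [set w | has_card (S w `&` [set s | s.1 = ty k /\ A k s.2]) (c k)]
    in measurable E /\
       P E = (\prod_(k < m) poisson_prob (fine (mean_meas lam (ty k) (A k))) (c k))%:E.

Definition dist (v : 'I_n -> R) (s : station) (t : R) : R :=
  Num.sqrt ((s.2.1.1 + t * v s.1 * cos s.2.2) ^+ 2 +
            (s.2.1.2 + t * v s.1 * sin s.2.2) ^+ 2).

Definition is_head_time (v : 'I_n -> R) (s : station) (T : R) : Prop :=
  forall t, dist v s T <= dist v s t.

Definition head_left (v : 'I_n -> R) (s s' : station) : Prop :=
  exists T T', is_head_time v s T /\ is_head_time v s' T' /\ T < T'.

Definition nearest (v : 'I_n -> R) (X : set station) (s : station) (t : R) :=
  X s /\ forall s', X s' -> dist v s t <= dist v s' t.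

Definition handover (v : 'I_n -> R) (X : set station) (s s' : station) (t : R) :=
  s <> s' /\ nearest v X s t /\ nearest v X s' t.

Definition kth_intersection (v : 'I_n -> R) (s s' : station) (k : nat) (t : R) :=
  dist v s t = dist v s' t /\
  has_card [set u | u < t /\ dist v s u = dist v s' u] k.-1.

(* Expected number of points of the random set H w in the unit time window
   [0,1): the intensity of a stationary point process on the time line. *)
Definition intensity d (Omega : measurableType d) (P : probability Omega R)
  (H : Omega -> set R) : \bar R :=
  (\int[P]_w \esum_(t in H w `&` `[0%R, 1%R[%classic) 1)%E.

Definition Lambda_same d (Omega : measurableType d) (P : probability Omega R)
  (S : Omega -> set station) (v : 'I_n -> R) (i : 'I_n) : \bar R :=
  intensity P (fun w => [set t | exists s s', s.1 = i /\ s'.1 = i /\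
                                  handover v (S w) s s' t]).

Definition Lambda_mixed d (Omega : measurableType d) (P : probability Omega R)
  (S : Omega -> set station) (v : 'I_n -> R) (k : nat) (i j : 'I_n) : \bar R :=
  intensity P (fun w => [set t | exists s s', s.1 = i /\ s'.1 = j /\
                head_left v s s' /\ kth_intersection v s s' k t /\
                handover v (S w) s s' t]).

End Stations.

Section Formula.
Variable R : realType.
Local Open Scope ereal_scope.

Definition Delta (vi vj t hj hi : R) : R :=
  (vj ^+ 2 * vi ^+ 2 * t ^+ 2 - (hj ^+ 2 - hi ^+ 2) * (vj ^+ 2 - vi ^+ 2))%R.

Definition hhat2 (k : nat) (vi vj t hj hi : R) : R :=
  (vj ^+ 2 * ((vi ^+ 2 * t + (-1) ^+ k * Num.sqrt (Delta vi vj t hj hi))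
              / (vj ^+ 2 - vi ^+ 2)) ^+ 2 + hj ^+ 2)%R.

Definition tstar (vi vj hj hi : R) : R :=
  ((vj * vi)^-1 * Num.sqrt (hj ^+ 2 - hi ^+ 2) * Num.sqrt (vj ^+ 2 - vi ^+ 2))%R.

Definition Lambda_formula (lam lami lamj vi vj : R) (k : nat) : \bar R :=
  (4 * lami * lamj * vi * vj)%:E *
  \int[@lebesgue_measure R]_(hj in `[0%R, +oo[%classic)
    ( \int[@lebesgue_measure R]_(hi in `[0%R, hj]%classic)
        \int[@lebesgue_measure R]_(t in `[tstar vi vj hj hi, +oo[%classic)
           (expR (- (lam * pi * hhat2 k vi vj t hj hi)))%:E
    + \int[@lebesgue_measure R]_(hi in `[hj, +oo[%classic)
        \int[@lebesgue_measure R]_(t in `[0%R, +oo[%classic)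
           (expR (- (lam * pi * hhat2 k vi vj t hj hi)))%:E ).

End Formula.

(* Main.v *)
Require Import Defs.
From HB Require Import structures.
From mathcomp Require Import all_boot all_order all_algebra.
From mathcomp Require Import all_classical all_reals all_analysis.
From mathcomp Require Import measurable_realfun lebesgue_integral_fubini.
From mathcomp Require Import ring lra.
Import Order.TTheory GRing.Theory Num.Theory.
Import numFieldNormedType.Exports.
Set Implicit Arguments. Unset Strict Implicit. Unset Printing Implicit Defensive.
Local Open Scope classical_set_scope.
Local Open Scope ring_scope.

(* A station of type i at x with direction u has head (T, H), T = - x.u / v_i, H = |x cross u|,
   and its distance to the origin at time t is the bird sqrt (v_i^2 (t - T)^2 + H^2).  For a fixed
   direction, (T, H) is an affine image of x up to sign, so the heads of type i form a Poisson process
   of density 2 lam_i v_i on R x [0, oo[, and the disc of radius r has total mean measure lam pi r^2.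

   Cut the half-plane of heads into dyadic cells.  For two cells, the probability that each holds one
   station of its type and that a disc contains no other station is explicit; letting the mesh tend
   to 0 and bounding the number of handovers in [0, 1[ above (Fatou, almost surely at most one station
   per cell) and below (exactly one station in each of two cells) gives a Mecke formula: the intensity
   is 4 lam_i lam_j v_i v_j times the integral of exp (- lam pi r^2) over the pairs of heads whose birds
   meet in [0, 1[, r being the height of the meeting point.  Translation invariance removes one variable.
   What remains is to solve a quadratic for the meeting time when v_i <> v_j, a linear equation when
   v_i = v_j, where the t-integral is a Cauchy-Schlomilch transform of a Gaussian.  Time reversal
   swaps the two intersections. *)

(** * Planar Lebesgue measure *)

Section Planar.
Variable R : realType.
Local Notation leb := (@lebesgue_measure R).

(** The random set [S] is known only through joint laws of counts on finitely many disjoint sets,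
    and the number of handovers in a window is not known to be a measurable function of [w], so
    [intensity] is a lower integral, a supremum over simple functions. Both bounds respect this: the
    lower one compares a finite sum of indicators with the count for every [w], the upper one
    dominates the count almost surely by a measurable lower limit of such sums.

    [intensity] counts times, not pairs of stations. Two cells producing the same time would put
    both pairs at the same minimal distance; a slightly enlarged disc free of other stations forces
    the pairs to coincide, up to an exchange that the order of the head times forbids.

    The limit is carried out for an abstract relation [K], with an open set [D] of pairs of heads on
    which the meeting time is continuous and a null set [Z] holding the borderline pairs. Equal
    speeds, and either intersection at different speeds, are then instances. The constant 4 is the
    product of two factors 2, one from each head density. *)

Lemma measurable_affine (c b : R) : measurable_fun setT (fun x : R => c * x + b).
Proof. by apply: measurable_funD => //; exact: measurable_funM. Qed.

(** By uniqueness of Lebesgue measure it suffices to test the intervals []x, y]]. A negative [c]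
    reverses orientation, so the preimage is closed on the left instead; its length is the same. *)
Lemma lebesgue_measure_affine (c b : R) (A : set R) : c != 0 -> measurable A ->
  leb A = (`|c|%:E * leb ((fun x => (c * x + b)%R) @^-1` A))%E.
Proof.
move=> c0 mA.
pose phi := (fun x : R => c * x + b : measurableTypeR R).
have mphi : measurable_fun setT phi by exact: measurable_affine.
pose mphi_mixin := isMeasurableFun.Build _ _ _ _ phi mphi.
pose mphi_pack : {mfun _ >-> _} := HB.pack phi mphi_mixin.
have c1 : 0 <= `|c| by [].
rewrite (@lebesgue_measure_unique R (mscale (NngNum c1) (pushforward leb mphi_pack)))//.
move=> _ [[x y]/= _ <-].
rewrite /mscale/= /pushforward/=.
have [cp|cn|/eqP] := ltgtP c 0; last by rewrite (negbTE c0).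
- have -> : phi @^-1` `]x, y]%classic = `[(y - b) / c, (x - b) / c[%classic.
    apply/seteqP; split => z /=; rewrite !in_itv/= /phi ler_ndivrMr// ltr_ndivlMr//;
    rewrite lerBrDr ltrBlDr [z * c]mulrC => /andP[? ?]; exact/andP.
  rewrite !lebesgue_measure_itv/= !lte_fin.
  rewrite ltr_ndivrMr// divfK// ltrD2r.
  case: ifPn => _; last by rewrite mule0.
  by rewrite -EFinM ltr0_norm//; congr EFin; field.
- have -> : phi @^-1` `]x, y]%classic = `](x - b) / c, (y - b) / c]%classic.
    apply/seteqP; split => z /=; rewrite !in_itv/= /phi ler_pdivlMr// ltr_pdivrMr//;
    rewrite lerBrDr ltrBlDr [z * c]mulrC => /andP[? ?]; exact/andP.
  rewrite !lebesgue_measure_itv/= !lte_fin.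
  rewrite ltr_pdivrMr// divfK// ltrD2r.
  case: ifPn => _; last by rewrite mule0.
  by rewrite -EFinM gtr0_norm//; congr EFin; field.
Qed.

Lemma ge0_integral_affine (c b : R) (f : R -> \bar R) : c != 0 ->
  measurable_fun setT f -> (forall x, 0 <= f x)%E ->
  (\int[leb]_x f (c * x + b)%R = (`|c|^-1)%:E * \int[leb]_x f x)%E.
Proof.
move=> c0 mf f0.
pose phi := (fun x : R => c * x + b : measurableTypeR R).
have mphi : measurable_fun setT phi by exact: measurable_affine.
pose mphi_mixin := isMeasurableFun.Build _ _ _ _ phi mphi.
pose mphi_pack : {mfun _ >-> _} := HB.pack phi mphi_mixin.
have c1 : 0 <= `|c| by [].
rewrite [in RHS](@eq_measure_integral _ _ _ _ (mscale (NngNum c1) (pushforward leb mphi_pack))); last first.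
  by move=> A mA _; exact: (lebesgue_measure_affine b c0 mA).
rewrite ge0_integral_mscale//= ge0_integral_pushforward//.
by rewrite muleA -EFinM mulVf ?normr_eq0// mul1e.
Qed.

Definition leb2 := (leb \x leb)%E.
HB.instance Definition _ := Measure.on leb2.

(** Squares of an exhaustion of the line; the exhaustion is increasing, so that both coordinates
    fall into a common piece. Sigma-finiteness is what makes Tonelli available for [leb4]. *)
Lemma leb2_sigma_finite : sigma_finite setT leb2.
Proof.
have [F [TF ndF Foo]] := (sigma_finiteP _ _).1 (sigma_finiteT leb).
exists (fun n => F n `*` F n).
  rewrite -setXTT TF predeqE => -[x y]; split.
    move=> [/= [n _ Fnx] [k _ Fky]]; exists (maxn n k) => //; split.
    - by move: x Fnx; exact/subsetPset/ndF/leq_maxl.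
    - by move: y Fky; exact/subsetPset/ndF/leq_maxr.
  by move=> [n _ []/= ? ?]; split; exists n.
move=> k; have [mF Fk] := Foo k.
split; first exact: measurableX.
by rewrite /leb2 product_measure1E// lte_mul_pinfty// ge0_fin_numE.
Qed.

HB.instance Definition _ :=
  Measure_isSigmaFinite.Build _ _ _ leb2 leb2_sigma_finite.

Definition leb4 := (leb2 \x leb2)%E.
HB.instance Definition _ := Measure.on leb4.

Lemma leb4X (A B : set (R * R)) : measurable A -> measurable B ->
  leb4 (A `*` B) = (leb2 A * leb2 B)%E.
Proof. by move=> mA mB; exact: product_measure1E. Qed.

Lemma leb4_tonelli1 (f : (R * R) * (R * R) -> \bar R) : measurable_fun setT f ->
  (forall x, 0 <= f x)%E ->
  (\int[leb4]_x f x = \int[leb2]_x \int[leb2]_y f (x, y))%E.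
Proof. by move=> mf f0; exact: (@fubini_tonelli1 _ _ _ _ R leb2 leb2 f mf f0). Qed.

Lemma leb4_tonelli2 (f : (R * R) * (R * R) -> \bar R) : measurable_fun setT f ->
  (forall x, 0 <= f x)%E ->
  (\int[leb4]_x f x = \int[leb2]_y \int[leb2]_x f (x, y))%E.
Proof. by move=> mf f0; exact: (@fubini_tonelli2 _ _ _ _ R leb2 leb2 f mf f0). Qed.

Implicit Type f : R * R -> \bar R.

Lemma leb2_tonelli1 f : measurable_fun setT f -> (forall x, 0 <= f x)%E ->
  (\int[leb2]_x f x = \int[leb]_x \int[leb]_y f (x, y))%E.
Proof. by move=> mf f0; rewrite /leb2 fubini_tonelli1. Qed.

Lemma leb2_tonelli2 f : measurable_fun setT f -> (forall x, 0 <= f x)%E ->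
  (\int[leb2]_x f x = \int[leb]_y \int[leb]_x f (x, y))%E.
Proof. by move=> mf f0; rewrite /leb2 fubini_tonelli2. Qed.

Lemma leb_swap f : measurable_fun setT f -> (forall x, 0 <= f x)%E ->
  (\int[leb]_x \int[leb]_y f (x, y) = \int[leb]_y \int[leb]_x f (x, y))%E.
Proof. by move=> mf f0; rewrite fubini_tonelli. Qed.

Lemma measurable_lincomb (c s : R) :
  measurable_fun setT (fun x : R * R => c * x.1 + s * x.2).
Proof. by apply: measurable_funD; apply: measurable_funM. Qed.

(* A rotation factors, for c != 0, into one-dimensional affine maps, so Tonelli suffices. *)
Lemma ge0_integral_rotation (c s : R) f : c ^+ 2 + s ^+ 2 = 1 ->
  measurable_fun setT f -> (forall x, 0 <= f x)%E ->
  (\int[leb2]_x f (c * x.1 + s * x.2, c * x.2 - s * x.1)%R = \int[leb2]_x f x)%E.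
Proof.
move=> cs1 mf f0.
have mlin (c1 s1 c2 s2 : R) : measurable_fun setT
    (fun x : R * R => f (c1 * x.1 + s1 * x.2, c2 * x.1 + s2 * x.2)).
  apply: (measurableT_comp mf).
  by apply/measurable_fun_pairP; split; exact: measurable_lincomb.
have mlin0 : measurable_fun setT
    (fun x : R * R => f (c * x.1 + s * x.2, c * x.2 - s * x.1)).
  apply: eq_measurable_fun (mlin c s (- s) c) => x _ /=.
  by rewrite mulNr [c * x.2 - _]addrC.
have mR1 (b : R) : measurable_fun setT (fun a : R => f (a, b)).
  by apply: measurableT_comp => //; exact: pair2_measurable.
have mR2 (a : R) : measurable_fun setT (fun b : R => f (a, b)).
  by apply: measurableT_comp => //; exact: pair1_measurable.
have [c0|c0] := eqVneq c 0.
  have s2 : s ^+ 2 = 1 by rewrite -cs1 c0 expr0n add0r.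
  have s0 : s != 0 by apply/eqP => s0; move: s2; rewrite s0 expr0n/= => /esym/eqP; rewrite oner_eq0.
  have ns : `|s|^-1 = 1.
    by move/eqP: s2; rewrite sqrf_eq1 => /orP[] /eqP ->; rewrite ?normrN normr1 invr1.
  rewrite leb2_tonelli1//= [RHS]leb2_tonelli2//.
  transitivity (\int[leb]_x \int[leb]_y f (y, (- s * x)%R))%E.
    apply: eq_integral => x _ /=; rewrite -[RHS](mul1e) -ns -(ge0_integral_affine 0 s0)//.
    by apply: eq_integral => y _; rewrite c0 !mul0r !add0r addr0 mulNr.
  have /= := @ge0_integral_affine (- s) 0 (fun x => \int[leb]_y f (y, x))%E.
  rewrite oppr_eq0 => /(_ s0); rewrite normrN ns mul1e => <-.
  - by apply: eq_integral => x _; apply: eq_integral => y _; rewrite addr0.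
  - exact: (@measurable_fun_fubini_tonelli_G _ _ _ _ _ leb f).
  - by move=> x; exact: integral_ge0.
rewrite leb2_tonelli2//=.
(* With [u = c x + s y], the second rotated coordinate is [- (s / c) u + y / c], because
   [1 - s^2 = c^2]. Integrating over [x] at fixed [y], then over [y] at fixed [u], produces the
   factors [|c|^-1] and [|c|], which cancel. *)
pose g (x : R * R) := f (x.1, (- (s / c)) * x.1 + c^-1 * x.2).
have mg : measurable_fun setT g.
  apply: eq_measurable_fun (mlin 1 0 (- (s / c)) c^-1) => x _ /=.
  by rewrite mul1r mul0r addr0.
have g0 x : (0 <= g x)%E by exact: f0.
have mg1 (b : R) : measurable_fun setT (fun a : R => g (a, b)).
  by apply: measurableT_comp => //; exact: pair2_measurable.
transitivity (\int[leb]_y ((`|c|^-1)%:E * \int[leb]_x g (x, y)))%E.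
  apply: eq_integral => y _; rewrite -(ge0_integral_affine (s * y) c0)//.
  apply: eq_integral => x _; rewrite /g /=; congr (f (_, _)).
  have -> : s * x = s / c * (c * x) by field.
  have {1}-> : c * y = (1 - s ^+ 2) / c * y by rewrite -cs1; field.
  by field.
rewrite ge0_integralZl//; last 2 first.
- exact: (@measurable_fun_fubini_tonelli_G _ _ _ _ _ leb g).
- by move=> y _; apply: integral_ge0 => x _; exact: f0.
rewrite -leb_swap//.
rewrite -ge0_integralZl//; last 2 first.
- exact: (@measurable_fun_fubini_tonelli_F _ _ _ _ _ leb g).
- by move=> y _; apply: integral_ge0 => x _; exact: f0.
rewrite [RHS]leb2_tonelli1//; apply: eq_integral => x _.
have ci : c^-1 != 0 by rewrite invr_eq0.
rewrite -[RHS]mul1e.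
have -> : 1%E = ((`|c|^-1)%:E * (`|c^-1|^-1)%:E)%E :> \bar R.
  by rewrite normfV invrK -EFinM mulVf ?normr_eq0.
rewrite -muleA -(ge0_integral_affine ((- (s / c)) * x) ci)//.
by congr (_ * _)%E; apply: eq_integral => y _; rewrite /g/= addrC.
Qed.

End Planar.

(** * Heads and radial birds *)

Section Heads.
Variable R : realType.
Local Notation leb := (@lebesgue_measure R).
Local Notation leb2 := (@leb2 R).

Lemma measurable_set_le d (T : measurableType d) (f g : T -> R) :
  measurable_fun setT f -> measurable_fun setT g -> measurable [set x | f x <= g x].
Proof.
move=> mf mg; rewrite -[X in measurable X]setTI.
exact: (measurable_fun_ler mf mg measurableT (Y := [set true])).
Qed.

Lemma measurable_set_lt d (T : measurableType d) (f g : T -> R) :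
  measurable_fun setT f -> measurable_fun setT g -> measurable [set x | f x < g x].
Proof.
move=> mf mg; rewrite -[X in measurable X]setTI.
exact: (measurable_fun_ltr mf mg measurableT (Y := [set true])).
Qed.

Lemma measurable_half : measurable [set z : R * R | 0 <= z.2].
Proof. by apply: measurable_set_le. Qed.

Lemma ge0_integral_even (f : R -> \bar R) : measurable_fun setT f ->
  (forall x, 0 <= f x)%E -> (forall x, f (- x) = f x) ->
  (\int[leb]_x f x = 2%:E * \int[leb]_(x in `[0%R, +oo[) f x)%E.
Proof.
move=> mf f0 fN.
rewrite -{1}setC0 -(set_itvoc0 0%R) setCitv/= ge0_integral_setU//=; first last.
- rewrite disj_set2E; apply/eqP; rewrite -subset0 => x []/= /[!in_itv]/=.
  by rewrite leNgt andbT => /negP.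
- by apply: measurable_funTS.
rewrite integral_itv_obnd_cbnd; last exact: measurable_funTS.
rewrite [X in (X + _)%E](_ : _ = \int[leb]_(x in `[0%R, +oo[) f x)%E.
  by rewrite mule_natl mule2n.
rewrite ge0_integration_by_substitution0//; apply: eq_integral => x _.
by rewrite fN.
Qed.

Definition head_of (w : R) (x : R * R * R) : R * R :=
  (- (cos x.2 * x.1.1 + sin x.2 * x.1.2) / w,
   `|cos x.2 * x.1.2 - sin x.2 * x.1.1|).

Definition bird (w : R) (z : R * R) (t : R) : R :=
  Num.sqrt (w ^+ 2 * (t - z.1) ^+ 2 + z.2 ^+ 2).

Lemma bird_sq w z t : bird w z t ^+ 2 = w ^+ 2 * (t - z.1) ^+ 2 + z.2 ^+ 2.
Proof. by rewrite sqr_sqrtr// addr_ge0 ?sqr_ge0// -exprMn sqr_ge0. Qed.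

Lemma bird_ge0 w z t : 0 <= bird w z t.
Proof. exact: sqrtr_ge0. Qed.

Lemma bird_le w z w' z' t t' : (bird w z t <= bird w' z' t') =
  (w ^+ 2 * (t - z.1) ^+ 2 + z.2 ^+ 2 <= w' ^+ 2 * (t' - z'.1) ^+ 2 + z'.2 ^+ 2).
Proof. by rewrite -!bird_sq ler_sqr// nnegrE bird_ge0. Qed.

Lemma bird_eq w z w' z' t t' : bird w z t = bird w' z' t' <->
  w ^+ 2 * (t - z.1) ^+ 2 + z.2 ^+ 2 = w' ^+ 2 * (t' - z'.1) ^+ 2 + z'.2 ^+ 2.
Proof.
rewrite -!bird_sq; split=> [->//|/eqP].
by rewrite eqrXn2 ?bird_ge0// => /eqP.
Qed.

Lemma head_ge0 w x : 0 <= (head_of w x).2.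
Proof. exact: normr_ge0. Qed.

Lemma measurable_head w : measurable_fun setT (head_of w).
Proof.
have mc : measurable_fun setT (fun x : R * R * R => cos x.2).
  apply: measurableT_comp => //.
  by apply: continuous_measurable_fun; exact: continuous_cos.
have ms : measurable_fun setT (fun x : R * R * R => sin x.2).
  apply: measurableT_comp => //.
  by apply: continuous_measurable_fun; exact: continuous_sin.
have m1 : measurable_fun setT (fun x : R * R * R => x.1.1) by exact: measurableT_comp.
have m2 : measurable_fun setT (fun x : R * R * R => x.1.2) by exact: measurableT_comp.
apply: measurable_fun_pair.
  apply: measurable_funM => //; apply: measurable_funN => //.
  by apply: measurable_funD; apply: measurable_funM.
apply: measurableT_comp => //.
by apply: measurable_funB; apply: measurable_funM.
Qed.

(* The factor 2 comes from the absolute value in the head, the factor w from the time scale. *)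
Lemma integral_head (w th : R) (A : set (R * R)) : 0 < w -> measurable A ->
  (\int[leb2]_x (\1_A (head_of w (x, th)))%:E =
   (2 * w)%:E * leb2 (A `&` [set z | 0 <= z.2]%R))%E.
Proof.
move=> w0 mA.
have mA1 : measurable_fun setT (EFin \o \1_A : R * R -> \bar R).
  by apply/measurable_EFinP; exact: measurable_indic.
pose f (y : R * R) : \bar R := (\1_A (- y.1 / w, `|y.2|))%:E.
have f0 y : (0 <= f y)%E by rewrite lee_fin.
have mf : measurable_fun setT f.
  apply: (measurableT_comp mA1); apply: measurable_fun_pair.
    by apply: measurable_funM => //; exact: measurableT_comp.
  by apply: measurableT_comp.
have := ge0_integral_rotation (cos2Dsin2 th) mf f0.
rewrite /f/= => ->.
rewrite leb2_tonelli1//=.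
pose g (x : R * R) : \bar R := (\1_A (x.1, `|x.2|))%:E.
have g0 y : (0 <= g y)%E by rewrite lee_fin.
have mg : measurable_fun setT g.
  by apply: (measurableT_comp mA1); apply: measurable_fun_pair => //; exact: measurableT_comp.
have w1 : - w^-1 != 0 by rewrite oppr_eq0 invr_eq0 gt_eqF.
have /= := @ge0_integral_affine _ (- w^-1) 0 (fun x => \int[leb]_y g (x, y))%E w1.
rewrite normrN normfV invrK gtr0_norm// => /(_ _ _) H.
transitivity (\int[leb]_x \int[leb]_y g ((- w^-1 * x + 0)%R, y))%E.
  apply: eq_integral => x _; apply: eq_integral => y _; rewrite /g/=.
  by rewrite addr0 mulNr mulrC mulNr.
rewrite H.
- rewrite [(2 * w)%R]mulrC EFinM -muleA; congr (_ * _)%E.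
  pose h (x : R * R) : \bar R := (\1_(A `&` [set z | 0 <= z.2]%R) x)%:E.
  have mA0 : measurable (A `&` [set z | 0 <= z.2]%R).
    exact: measurableI (measurable_half).
  have -> : leb2 (A `&` [set z | 0 <= z.2]%R) = (\int[leb2]_x h x)%E.
    by rewrite integral_indic// setIT.
  have mh : measurable_fun setT h by apply/measurable_EFinP; exact: measurable_indic.
  have h0 y : (0 <= h y)%E by rewrite lee_fin.
  rewrite leb2_tonelli1// -ge0_integralZl//.
  + apply: eq_integral => x _.
    rewrite [LHS]ge0_integral_even//; last by move=> y; rewrite /g/= normrN.
      congr (_ * _)%E; rewrite integral_mkcond; apply: eq_integral => y _.
      rewrite /patch /h /g /= !indicE.
      case: ifPn; rewrite ?notin_setE ?inE/= in_itv/= andbT => y0.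
        rewrite ger0_norm//; congr (_%:R%:E); congr nat_of_bool.
        by apply/idP/idP; rewrite !inE/=; [split|case].
      by rewrite [_ \in _](_ : _ = false)//; apply/negP; rewrite inE => -[].
    by apply: measurableT_comp => //; exact: pair1_measurable.
  + exact: (@measurable_fun_fubini_tonelli_F _ _ _ _ _ leb h).
  + by move=> x _; exact: integral_ge0.
- exact: (@measurable_fun_fubini_tonelli_F _ _ _ _ _ leb g).
- by move=> x; exact: integral_ge0.
Qed.

(** The planar integral at a fixed direction is the same constant for every direction, so the angle
    contributes only the length of its range. The normalization in [mean_meas] later cancels it. *)
Lemma leb3_head (w : R) (A : set (R * R)) : 0 < w -> measurable A ->
  (leb3 ((head_of w @^-1` A) `&` [set x | (0 <= x.2)%R /\ (x.2 < 2 * pi)%R]) =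
   (2 * pi)%:E * ((2 * w)%:E * leb2 (A `&` [set z | 0 <= z.2]%R)))%E.
Proof.
move=> w0 mA; set B := _ `&` _.
have mH : measurable (head_of w @^-1` A).
  by rewrite -[X in measurable X]setTI; exact: measurable_head.
have mI : measurable [set x : R * R * R | 0 <= x.2 /\ x.2 < 2 * pi].
  apply: (measurableI [set x : R * R * R | 0 <= x.2] [set x | x.2 < 2 * pi]).
    exact: measurable_set_le.
  exact: measurable_set_lt.
have mB : measurable B by exact: measurableI.
have m1B : measurable_fun setT (EFin \o \1_B : R * R * R -> \bar R).
  by apply/measurable_EFinP; exact: measurable_indic.
transitivity (\int[(leb2 \x leb)]_x (\1_B x)%:E)%E.
  by rewrite integral_indic// setIT.
have H := @fubini_tonelli2 _ _ _ _ R leb2 leb _ m1B (fun x => _).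
rewrite {}H//=.
rewrite /fubini_G/=.
set K := ((2 * w)%:E * _)%E.
transitivity (\int[leb]_(th in `[0%R, (2 * pi)%R[) K)%E.
  rewrite [RHS]integral_mkcond; apply: eq_integral => th _.
  rewrite /patch; case: ifPn; rewrite ?notin_setE ?inE/= in_itv/=.
    move=> th0; rewrite /K -(integral_head th w0 mA); apply: eq_integral => x _.
    congr (_%:E); rewrite !indicE; congr (_%:R); congr nat_of_bool.
    by apply/idP/idP; rewrite !inE/=; [case|split => //=; exact/andP].
  move=> th0; apply: integral0_eq => x _; congr (_%:E); rewrite indicE.
  by rewrite [_ \in _](_ : _ = false)//; apply/negP; rewrite inE => -[/= _ /andP].
rewrite integral_cst//= lebesgue_measure_itv/= lte_fin mulr_gt0 ?pi_gt0//.
by rewrite sube0 muleC.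
Qed.

Variable n : nat.
Variables (lam v : 'I_n -> R).
Hypothesis v0 : forall i, 0 < v i.

Definition shead (s : station R n) : R * R := head_of (v s.1) s.2.

(** For a unit vector [u], splitting [|x|^2] into [(x.u)^2] and the squared cross product completes
    the square in [t]. *)
Lemma dist_bird s t : dist v s t = bird (v s.1) (shead s) t.
Proof.
congr Num.sqrt; rewrite /shead /head_of/= real_normK ?num_real//.
case: s => i [[x y] th]/=; move: (cos2Dsin2 th) (v0 i).
set c := cos th; set s := sin th; set w := v i => cs w0.
have -> : w ^+ 2 * (t - - (c * x + s * y) / w) ^+ 2 = (w * t + (c * x + s * y)) ^+ 2.
  by rewrite -exprMn; congr (_ ^+ 2); field; rewrite gt_eqF.
transitivity (x ^+ 2 + y ^+ 2 + 2 * t * w * (c * x + s * y) + t ^+ 2 * w ^+ 2 * (c ^+ 2 + s ^+ 2)).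
  by ring.
transitivity ((c ^+ 2 + s ^+ 2) * (x ^+ 2 + y ^+ 2) + 2 * t * w * (c * x + s * y) + t ^+ 2 * w ^+ 2).
  by rewrite cs; ring.
by ring.
Qed.

Lemma is_head_timeP s T : is_head_time v s T <-> T = (shead s).1.
Proof.
have w0 := v0 s.1; split=> [/(_ (shead s).1)|-> t].
  rewrite !dist_bird bird_le subrr expr0n/= mulr0 lerD2r => H.
  have : (T - (shead s).1) ^+ 2 <= 0 by rewrite -(pmulr_rle0 _ (exprn_gt0 2 w0)).
  by rewrite real_exprn_even_le0 ?num_real//= subr_eq0 => /eqP.
by rewrite !dist_bird bird_le subrr expr0n/= mulr0 lerD2r -exprMn sqr_ge0.
Qed.

Lemma head_leftP s s' : head_left v s s' <-> (shead s).1 < (shead s').1.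
Proof.
split=> [[T [T' [/is_head_timeP -> [/is_head_timeP ->]]]]//|lt].
by exists (shead s).1, (shead s').1; split; [|split => //]; exact/is_head_timeP.
Qed.

Lemma mean_head i A : measurable A -> mean_meas lam i (head_of (v i) @^-1` A) =
  ((2 * lam i * v i)%:E * leb2 (A `&` [set z | 0 <= z.2]%R))%E.
Proof.
move=> mA; rewrite /mean_meas (leb3_head (v0 i))// !muleA -!EFinM.
by congr (_%:E * _)%E; move: (pi_gt0 R); move: pi => p p0; field; rewrite gt_eqF.
Qed.

End Heads.

(** * Area of a disc in head coordinates *)

Section Ball.
Variable R : realType.
Local Notation leb := (@lebesgue_measure R).
Local Notation leb2 := (@leb2 R).

Lemma is_derive_continuous (F F' : R -> R) :
  (forall x : R, is_derive x 1 F (F' x)) -> continuous F.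
Proof.
move=> dF x; apply/differentiable_continuous/derivable1_diffP.
by have := dF x.
Qed.

Lemma is_derive_LRcontinuous (F F' : R -> R) a b :
  (forall x : R, is_derive x 1 F (F' x)) -> derivable_oo_LRcontinuous F a b.
Proof.
move=> dF; have cF := is_derive_continuous dF; split.
- by move=> x _; have := dF x.
- by apply: cvg_at_right_filter; exact: cF.
- by apply: cvg_at_left_filter; exact: cF.
Qed.

Lemma is_derive_derive1 (F F' : R -> R) :
  (forall x : R, is_derive x 1 F (F' x)) -> derive1 F = F'.
Proof. by move=> dF; apply/funext => x; rewrite derive1E; exact: (@derive_val _ _ _ _ _ _ _ (dF x)). Qed.

(** The substitution [x = r sin th] turns the integrand into [r^2 cos^2 th], with primitive
    [(r^2 / 2) (th + sin th cos th)]. *)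
Lemma integral_halfdisk (r : R) : 0 < r ->
  (\int[leb]_x (Num.sqrt (r ^+ 2 - x ^+ 2))%:E = (pi * r ^+ 2 / 2)%:E)%E.
Proof.
move=> r0.
have csq : continuous (fun x : R => Num.sqrt (r ^+ 2 - x ^+ 2)).
  move=> x; apply: continuous_comp; last exact: sqrt_continuous.
  apply: cvgB; first exact: cvg_cst.
  exact: exprn_continuous.
transitivity (\int[leb]_(x in `[(- r)%R, r]) (Num.sqrt (r ^+ 2 - x ^+ 2))%:E)%E.
  rewrite [RHS]integral_mkcond; apply: eq_integral => x _.
  rewrite /patch; case: ifPn => //; rewrite notin_setE/= in_itv/= => /negP.
  rewrite -ler_norml -ltNge => rx; congr (_%:E); apply/eqP.
  rewrite sqrtr_eq0 subr_le0 -[x ^+ 2]real_normK ?num_real//.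
  by rewrite ler_sqr ?nnegrE ?(ltW r0)// ltW.
pose F := fun th : R => r * sin th.
have dF (x : R) : is_derive x 1 F (r * cos x).
  by apply: is_deriveZ.
have F'E := is_derive_derive1 dF.
have pi2 : - (pi / 2) <= pi / 2 :> R.
  by have := pi_gt0 R; move: pi => p p0; lra.
have FN : F (- (pi / 2)) = - r by rewrite /F sinN sin_pihalf mulrN1.
have FP : F (pi / 2) = r by rewrite /F sin_pihalf mulr1.
have crc : continuous (fun x : R => r * cos x).
  by move=> x; apply: cvgM; [exact: cvg_cst|exact: continuous_cos].
transitivity (\int[leb]_(x in `[F (- (pi / 2))%R, F (pi / 2)%R]) (Num.sqrt (r ^+ 2 - x ^+ 2))%:E)%E.
  by rewrite FN FP.
rewrite (@integration_by_substitution_increasing R F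
  (fun x => Num.sqrt (r ^+ 2 - x ^+ 2)) _ _ pi2); first last.
- exact: continuous_subspaceT.
- exact: is_derive_LRcontinuous dF.
- rewrite F'E; apply/cvg_ex; exists (r * cos (pi / 2)).
  by apply: cvg_at_left_filter; exact: crc.
- rewrite F'E; apply/cvg_ex; exists (r * cos (- (pi / 2))).
  by apply: cvg_at_right_filter; exact: crc.
- by rewrite F'E => x _; exact: crc.
- move=> x y xI yI xy; rewrite /F ltr_pM2l//.
  by rewrite ltr_sin.
rewrite F'E.
pose G := fun x : R => (r ^+ 2 / 2) * (x + sin x * cos x).
have dG (x : R) : is_derive x 1 G (r ^+ 2 * cos x ^+ 2).
  have : is_derive x 1 G ((r ^+ 2 / 2) *: (1 + (sin x *: (- sin x) + cos x *: cos x))).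
    by apply: is_deriveZ.
  move=> dG; apply: (is_derive_eq dG); rewrite /GRing.scale/=.
  have := cos2Dsin2 x; move: (cos x) (sin x) => c s cs; rewrite -[X in _ * (X + _)]cs. 
  by field.
have GE := is_derive_derive1 dG.
transitivity (\int[leb]_(x in `[(- (pi / 2))%R, (pi / 2)%R]) (r ^+ 2 * cos x ^+ 2)%:E)%E.
  apply: eq_integral => x; rewrite inE/= => xI; congr (_%:E).
  rewrite /F /= fctE/=.
  have -> : r ^+ 2 - (r * sin x) ^+ 2 = (r * cos x) ^+ 2.
    by rewrite !exprMn -{1}[r ^+ 2]mulr1 -(cos2Dsin2 x); ring.
  rewrite sqrtr_sqr ger0_norm ?mulr_ge0 ?(ltW r0)//; first by ring.
  by apply: cos_ge0_pihalf; move: xI; rewrite in_itv.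
have cg : continuous (fun x : R => r ^+ 2 * cos x ^+ 2).
  move=> x; apply: cvgM; first exact: cvg_cst.
  apply: (@continuous_comp _ _ _ cos (fun y => y ^+ 2)); first exact: continuous_cos.
  exact: exprn_continuous.
rewrite (continuous_FTC2 (F := G)).
- rewrite /G -EFinB; congr (_%:E).
  rewrite cosN cos_pihalf !mulr0 !addr0; by move: (pi : R) => q; field.
- by have := pi_gt0 R; move: pi => p p0; lra.
- exact: continuous_subspaceT.
- exact: is_derive_LRcontinuous dG.
- by move=> x _; rewrite GE.
Qed.

(** For [s <= 0] the square root is 0 and both sides are false, so no sign condition on [s]
    appears. *)
Lemma lt_sqrtr (h s : R) : 0 <= h -> (h < Num.sqrt s) = (h ^+ 2 < s).
Proof.
move=> h0; rewrite -{1}(ger0_norm h0) -sqrtr_sqr.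
have [s0|s0] := ltP 0 s; first by rewrite ltr_sqrt.
rewrite (ler0_sqrtr s0) ltNge sqrtr_ge0; apply/esym/negbTE; rewrite -leNgt.
by apply: (le_trans s0); exact: sqr_ge0.
Qed.

Lemma bird_ltE w (z : R * R) t r : 0 <= r ->
  (bird w z t < r) = (w ^+ 2 * (t - z.1) ^+ 2 + z.2 ^+ 2 < r ^+ 2).
Proof. by move=> r0; rewrite -bird_sq ltr_sqr ?nnegrE ?bird_ge0. Qed.

Lemma measurable_sqrt : measurable_fun setT (@Num.sqrt R).
Proof. by apply: continuous_measurable_fun; exact: sqrt_continuous. Qed.

Lemma measurable_bird w t : measurable_fun setT (fun z : R * R => bird w z t).
Proof.
apply: (measurableT_comp measurable_sqrt).
apply: measurable_funD; last exact: measurable_funX.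
apply: measurable_funM => //; apply: measurable_funX.
exact: measurable_funB.
Qed.

Definition ball_head (w t r : R) : set (R * R) := [set z | bird w z t < r].

Lemma measurable_ball_head w t r : measurable (ball_head w t r).
Proof. by apply: measurable_set_lt => //; exact: measurable_bird. Qed.

(** The region is half an ellipse with semi-axes [r / w] and [r]. Multiplied by the head density
    [2 lam w], its area gives [lam pi r^2], in which the speed has disappeared. *)
Lemma leb2_ball_head (w t r : R) : 0 < w -> 0 <= r ->
  (leb2 (ball_head w t r `&` [set z | 0 <= z.2]%R) = (pi * r ^+ 2 / (2 * w))%:E)%E.
Proof.
move=> w0; rewrite le_eqVlt => /predU1P[<-|r0].
  rewrite expr0n/= mulr0 mul0r [X in leb2 X](_ : _ = set0) ?measure0//.
  by rewrite -subset0 => z [/=]; rewrite /ball_head/= ltNge bird_ge0.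
set B := _ `&` _.
have mB : measurable B by apply: measurableI; [exact: measurable_ball_head|exact: measurable_half].
have m1B : measurable_fun setT (EFin \o \1_B : R * R -> \bar R).
  by apply/measurable_EFinP; exact: measurable_indic.
have -> : leb2 B = (\int[leb2]_x (\1_B x)%:E)%E by rewrite integral_indic// setIT.
rewrite (leb2_tonelli1 m1B)//=.
pose g (x : R) := (Num.sqrt (r ^+ 2 - x ^+ 2))%:E.
transitivity (\int[leb]_x g (w * x + - (w * t))%R)%E.
  apply: eq_integral => x _.
  set q := (w * x + - (w * t))%R.
  transitivity (leb `[0%R, Num.sqrt (r ^+ 2 - q ^+ 2)[%classic).
    rewrite -[X in leb X]setIT -integral_indic//; apply: eq_integral => y _.
    congr (_%:E); rewrite !indicE; congr (_%:R); congr nat_of_bool.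
    have qE : q ^+ 2 = w ^+ 2 * (t - x) ^+ 2 by rewrite /q; ring.
    apply/idP/idP; rewrite !inE/= in_itv/=.
      move=> [/=]; rewrite /ball_head/= bird_ltE ?(ltW r0)//= => H y0; rewrite y0/= lt_sqrtr// qE.
      by rewrite ltrBrDl.
    move=> /andP[y0]; rewrite lt_sqrtr// qE ltrBrDl => H; split => //=.
    by rewrite /ball_head/= bird_ltE ?(ltW r0).
  rewrite lebesgue_measure_itv/= lte_fin; case: ltgtP (sqrtr_ge0 (r ^+ 2 - q ^+ 2)) => //.
    by rewrite sube0.
  by rewrite /g => <-.
rewrite ge0_integral_affine.
- rewrite integral_halfdisk// gtr0_norm// -EFinM; congr (_%:E).
  by move: (pi : R) => q; field; rewrite gt_eqF.
- by rewrite gt_eqF.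
- apply/measurable_EFinP; apply: continuous_measurable_fun => x.
  apply: continuous_comp; last exact: sqrt_continuous.
  apply: cvgB; first exact: cvg_cst.
  exact: exprn_continuous.
- by move=> x; rewrite lee_fin sqrtr_ge0.
Qed.

End Ball.

(** * Void probabilities *)

Section Events.
Variables (R : realType) (n : nat) (lam v : 'I_n -> R).
Variables (d : measure_display) (Omega : measurableType d) (P : probability Omega R).
Variable S : Omega -> set (station R n).
Hypothesis lam0 : forall i, 0 < lam i.
Hypothesis v0 : forall i, 0 < v i.
Hypothesis PPP : marked_PPP P lam S.
Local Notation leb2 := (@leb2 R).
Local Notation half := [set z : R * R | 0 <= z.2].

Definition stations_in (i : 'I_n) (A : set (R * R)) (w : Omega) : set (station R n) :=
  S w `&` [set s | s.1 = i /\ (head_of (v i) @^-1` A) s.2].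

Definition count_event (i : 'I_n) (A : set (R * R)) (c : nat) : set Omega :=
  [set w | has_card (stations_in i A w) c].

Lemma measurable_preimage_head (i : 'I_n) (A : set (R * R)) : measurable A ->
  measurable (head_of (v i) @^-1` A).
Proof. by move=> mA; rewrite -[X in measurable X]setTI; exact: measurable_head. Qed.

(** Intensity of the heads of type [i] per unit area of the half-plane. *)
Definition mass (i : 'I_n) : R := 2 * lam i * v i.

Lemma mass_gt0 i : 0 < mass i.
Proof. by rewrite !mulr_gt0. Qed.

Lemma mean_headE i A (x : R) : measurable A -> leb2 (A `&` half) = x%:E ->
  mean_meas lam i (head_of (v i) @^-1` A) = (mass i * x)%:E.
Proof. by move=> mA Ax; rewrite mean_head// Ax. Qed.

Lemma count_prob i A (x : R) (c : nat) : measurable A -> leb2 (A `&` half) = x%:E ->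
  measurable (count_event i A c) /\
  P (count_event i A c) = (Defs.poisson_prob (mass i * x) c)%:E.
Proof.
move=> mA Ax; have mE := mean_headE i mA Ax.
have [] := @PPP 1 (fun=> i) (fun=> head_of (v i) @^-1` A) (fun=> c).
- by move=> k; exact: measurable_preimage_head.
- by move=> k; rewrite mE ltry.
- by move=> k l; rewrite !ord1 eqxx.
have -> : \bigcap_(k in [set: 'I_1]) [set w | has_card (S w `&`
    [set s | s.1 = i /\ (head_of (v i) @^-1` A) s.2]) c] = count_event i A c.
  by apply/seteqP; split => w /=; [move=> /(_ ord0 Logic.I)|move=> h k _].
by rewrite big_ord_recl big_ord0 mulr1 mE.
Qed.

(** A Poisson variable of mean [a] is at most 1 with probability [expR (- a) (1 + a)], which is at
    least [(1 - a) (1 + a) = 1 - a^2]. *)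
Lemma count_le1_prob i A (x : R) : measurable A -> leb2 (A `&` half) = x%:E ->
  0 <= x ->
  exists2 E : set Omega, measurable E &
    (forall w, ~ E w -> has_card (stations_in i A w) 0 \/ has_card (stations_in i A w) 1)
    /\ (P E <= ((mass i * x) ^+ 2)%:E)%E.
Proof.
move=> mA Ax x0.
have [m0 P0] := count_prob i 0 mA Ax; have [m1 P1] := count_prob i 1 mA Ax.
exists (~` (count_event i A 0 `|` count_event i A 1)).
  by apply: measurableC; exact: measurableU.
split; first by move=> w /contrapT.
rewrite probability_setC; last exact: measurableU.
have -> : P (count_event i A 0 `|` count_event i A 1) =
    (P (count_event i A 0) + P (count_event i A 1))%E.
  apply: measureU => //.
  rewrite -subset0 => w [/= [l0 [_ [l0E /size0nil l00]]] [l1 [_ [l1E l11]]]].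
  move: l1E; rewrite -l0E l00; case: l1 l11 => // a l _ /seteqP[+ _].
  by move=> /(_ a); rewrite /= inE eqxx => /(_ isT).
rewrite P0 P1 lee_fin /Defs.poisson_prob expr0 expr1 !divr1 mulr1.
set a := mass i * x.
have a0 : 0 <= a by rewrite mulr_ge0// ltW// mass_gt0.
have : 1 - a <= expR (- a) by exact: expR_ge1Dx.
move: (expR _) => e; nra.
Qed.

(** Heads of type [l] whose stations are inside the disc of radius [r] at time [t], minus the two
    cells, each of which is allowed its own station. Removing the cells makes all the regions
    disjoint, as independence requires. *)
Definition outside (i j : 'I_n) (C C' : set (R * R)) (t r : R) (l : 'I_n) : set (R * R) :=
  ball_head (v l) t r `\` ([set z | l = i /\ C z] `|` [set z | l = j /\ C' z]).

Definition pair_event i j C C' t r : set Omega :=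
  [set w | count_event i C 1 w /\ count_event j C' 1 w /\
           forall l, count_event l (outside i j C C' t r l) 0 w].

Lemma measurable_outside i j C C' t r l : measurable C -> measurable C' ->
  measurable (outside i j C C' t r l).
Proof.
move=> mC mC'; apply: measurableD; first exact: measurable_ball_head.
have mcond (k : 'I_n) B : measurable B -> measurable [set z : R * R | l = k /\ B z].
  move=> mB; have [->|lk] := eqVneq l k.
    by rewrite (_ : [set _ | _] = B)//; apply/seteqP; split => z //= [].
  rewrite (_ : [set _ | _] = set0)//; apply/seteqP; split => z //= [/eqP].
  by rewrite (negbTE lk).
by apply: measurableU; exact: mcond.
Qed.

(** The event prescribes [n + 2] independent Poisson counts: one in each cell, zero in the remainder
    of the disc for each type. The exponent [q] is the total mass of these regions. They cover the
    disc, which bounds [q] below; the remainders lie in the disc, which bounds [q] above by the disc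
    plus the two cells. *)
Lemma pair_event_prob i j C C' t r (x y : R) :
  measurable C -> measurable C' -> C `<=` half -> C' `<=` half ->
  leb2 C = x%:E -> leb2 C' = y%:E -> 0 <= r ->
  (i = j -> C `&` C' = set0) ->
  measurable (pair_event i j C C' t r) /\
  exists2 q : R, P (pair_event i j C C' t r) = (mass i * x * (mass j * y) * expR (- q))%:E &
    (\sum_l lam l) * pi * r ^+ 2 <= q <= (\sum_l lam l) * pi * r ^+ 2 + mass i * x + mass j * y.
Proof.
move=> mC mC' Ch C'h Cx C'y r0 disj.
have Chalf : leb2 (C `&` half) = x%:E by rewrite (setIidl Ch).
have C'half : leb2 (C' `&` half) = y%:E by rewrite (setIidl C'h).
have x0 : 0 <= x by rewrite -lee_fin -Cx.
have y0 : 0 <= y by rewrite -lee_fin -C'y.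
have mO l := measurable_outside i j t r l mC mC'.
pose ballx l : R := pi * r ^+ 2 / (2 * v l).
have ballE l : leb2 (ball_head (v l) t r `&` half) = (ballx l)%:E by exact: leb2_ball_head.
have mhalf : measurable half by exact: measurable_half.
have mbh l : measurable (ball_head (v l) t r) by exact: measurable_ball_head.
have Ole l : (leb2 (outside i j C C' t r l `&` half) <= (ballx l)%:E)%E.
  rewrite -ballE; apply: le_measure; rewrite ?inE; [exact: (measurableI _ _ (mO l))|exact: (measurableI _ _ (mbh l))|].
  by move=> z [[]].
pose o l := fine (leb2 (outside i j C C' t r l `&` half)).
have oE l : leb2 (outside i j C C' t r l `&` half) = (o l)%:E.
  by rewrite fineK// ge0_fin_numE// (le_lt_trans (Ole l))// ltry.
have ole l : o l <= ballx l by rewrite -lee_fin -oE.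
have oge l : ballx l <= o l + (l == i)%:R * x + (l == j)%:R * y.
  rewrite -lee_fin -ballE.
  have mk (k : 'I_n) B b : measurable B -> leb2 B = b%:E -> B `<=` half ->
      exists2 D : set (R * R), measurable D &
        ([set z | l = k /\ B z] `<=` D /\ leb2 D = ((l == k)%:R * b)%:E).
    move=> mB Bb Bh; have [->|lk] := eqVneq l k.
      by exists B => //; split; [move=> z []|rewrite mul1r].
    exists set0 => //; split; last by rewrite mul0r measure0.
    by move=> z /= [/eqP]; rewrite (negbTE lk).
  have [D1 mD1 [D1s D1e]] := mk i C x mC Cx Ch.
  have [D2 mD2 [D2s D2e]] := mk j C' y mC' C'y C'h.
  apply: (@le_trans _ _ (leb2 ((outside i j C C' t r l `&` half) `|` D1 `|` D2))).
    apply: le_measure; rewrite ?inE; first exact: (measurableI _ _ (mbh l)).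
      by apply: measurableU => //; apply: measurableU => //; exact: (measurableI _ _ (mO l)).
    move=> z [zb zh].
    have [z1|nz1] := pselect ([set z | l = i /\ C z] z); first by left; right; exact: D1s.
    have [z2|nz2] := pselect ([set z | l = j /\ C' z] z); first by right; exact: D2s.
    by left; left; split => //; split => // -[].
  rewrite !EFinD -oE -D1e -D2e.
  have mOh : measurable (outside i j C C' t r l `&` half) by exact: (measurableI _ _ (mO l)).
  apply: (@le_trans _ _ (leb2 ((outside i j C C' t r l `&` half) `|` D1) + leb2 D2)%E).
    by apply: measureU2 => //; exact: measurableU.
  by rewrite leeD2r//; exact: measureU2.
(* The first two indices stand for the cells, the other [n] for the remainders of the disc, type by
   type. *)
pose ty (k : 'I_(2 + n)) : 'I_n :=
  match fintype.split k with inl a => if a == ord0 then i else j | inr l => l end.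
pose A (k : 'I_(2 + n)) : set (R * R) :=
  match fintype.split k with inl a => if a == ord0 then C else C'
  | inr l => outside i j C C' t r l end.
pose c (k : 'I_(2 + n)) : nat := match fintype.split k with inl a => 1 | inr l => 0 end.
pose xs (k : 'I_(2 + n)) : R :=
  match fintype.split k with inl a => if a == ord0 then x else y | inr l => o l end.
have mA k : measurable (A k).
  by rewrite /A; case: (fintype.split k) => // a; case: ifP.
have Ax k : mean_meas lam (ty k) (head_of (v (ty k)) @^-1` A k) = (mass (ty k) * xs k)%:E.
  rewrite (@mean_headE _ _ (xs k))// /A /xs; case: (fintype.split k) => // a.
  by case: ifP.
have [] := @PPP _ ty (fun k => head_of (v (ty k)) @^-1` A k) c.
- by move=> k; exact: measurable_preimage_head.
- by move=> k; rewrite Ax ltry.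
- move=> k l kl tykl; rewrite tykl -preimage_setI.
  rewrite [X in _ @^-1` X](_ : _ = set0) ?preimage_set0//.
  move: kl tykl; rewrite -(inj_eq (can_inj (@splitK 2 n))) /A /ty.
  case: (fintype.split k) => a; case: (fintype.split l) => b /= ab.
  + have {}ab : a != b by [].
    have [a0|a0] := eqVneq a ord0; have [b0|b0] := eqVneq b ord0.
    * by rewrite a0 b0 eqxx in ab.
    * by move/disj.
    * by move=> /esym/disj; rewrite setIC.
    * case: a a0 ab => -[//|[|//]] ? a0; case: b b0 => -[//|[|//]] ? b0.
      by rewrite -val_eqE.
  + have [a0 <-|a0 <-] := eqVneq a ord0; rewrite -subset0 => z /=.
      by move=> [Cz [_]]; apply; left.
    by move=> [Cz [_]]; apply; right.
  + have [b0 ->|b0 ->] := eqVneq b ord0; rewrite -subset0 => z /=.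
      by move=> [[_ +] Cz]; apply; left.
    by move=> [[_ +] Cz]; apply; right.
  + by move=> abE; rewrite abE eqxx in ab.
set E := \bigcap_(k in _) _.
have EE : E = pair_event i j C C' t r.
  apply/seteqP; split => w.
    move=> Ew; split.
      by have := Ew (lshift n ord0) Logic.I; rewrite /= /ty /A /c -[lshift _ _]/(unsplit (inl _)) unsplitK.
    split.
      by have := Ew (lshift n (lift ord0 ord0)) Logic.I; rewrite /= /ty /A /c -[lshift _ _]/(unsplit (inl _)) unsplitK.
    by move=> l; have := Ew (rshift 2 l) Logic.I; rewrite /= /ty /A /c -[rshift _ _]/(unsplit (inr _)) unsplitK.
  move=> [w1 [w2 w3]] k _ /=; rewrite /ty /A /c.
  case: (fintype.split k) => // a; by case: ifP.
rewrite EE => mE PE; split=> //.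
exists (mass i * x + mass j * y + \sum_l mass l * o l).
  rewrite PE; congr (_%:E); rewrite big_split_ord/= !big_ord_recl big_ord0 mulr1.
  under [X in _ * X]eq_bigr => l _.
    rewrite Ax /= /c /ty /xs -[rshift _ _]/(unsplit (inr _)) unsplitK /Defs.poisson_prob expr0 mulr1 divr1.
    over.
  rewrite !Ax /= /c /ty /xs -![lshift _ _]/(unsplit (inl _)) !unsplitK/= /Defs.poisson_prob !expr1 !divr1.
  rewrite -expR_sum sumrN !opprD !expRD; ring.
have -> : (\sum_l lam l) * pi * r ^+ 2 = \sum_l mass l * ballx l.
  rewrite !mulr_suml; apply: eq_bigr => l _; rewrite /mass /ballx.
  by move: (pi : R) => p; field; rewrite gt_eqF.
apply/andP; split; last first.
  rewrite [leLHS]addrC -[leRHS]addrA lerD2r; apply: ler_sum => l _.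
  by rewrite ler_pM2l ?mass_gt0.
have -> : mass i * x = \sum_l mass l * ((l == i)%:R * x).
  rewrite (bigD1 i)//= eqxx mul1r big1 ?addr0// => l /negbTE ->.
  by rewrite mul0r mulr0.
have -> : mass j * y = \sum_l mass l * ((l == j)%:R * y).
  rewrite (bigD1 j)//= eqxx mul1r big1 ?addr0// => l /negbTE ->.
  by rewrite mul0r mulr0.
rewrite -!big_split/=; apply: ler_sum => l _.
rewrite -!mulrDr ler_pM2l ?mass_gt0//.
by rewrite addrC addrA; exact: oge.
Qed.

End Events.

(** * Dyadic cells *)

Section Cells.
Variable R : realType.
Local Notation leb := (@lebesgue_measure R).
Local Notation leb2 := (@leb2 R).
Local Notation half := [set z : R * R | 0 <= z.2].

Definition cell_index (M m : nat) : finType := ('I_(2 * M * 2 ^ m) * 'I_(M * 2 ^ m))%type.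

Definition grid (m : nat) (y : R) (a : nat) : Prop := a%:R <= 2 ^+ m * y < a.+1%:R.

(** Half-open squares of side [2^-m], so that the cells partition [box M]. The shift by [M] makes
    the horizontal index a natural number. *)
Definition cell (M m : nat) (c : cell_index M m) : set (R * R) :=
  [set z | grid m (z.1 + M%:R) c.1 /\ grid m z.2 c.2].

Definition box (M : nat) : set (R * R) :=
  [set z | (- M%:R <= z.1 < M%:R) /\ (0 <= z.2 < M%:R)].

Lemma pow2_gt0 m : 0 < 2 ^+ m :> R.
Proof. by rewrite exprn_gt0. Qed.

Lemma grid_inj m y a b : grid m y a -> grid m y b -> a = b.
Proof.
move=> /andP[a1 a2] /andP[b1 b2]; apply/eqP; rewrite eqn_leq.
have := le_lt_trans a1 b2; have := le_lt_trans b1 a2.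
by rewrite !ltr_nat !ltnS => -> ->.
Qed.

Lemma grid_ex m y K : 0 <= y < K%:R -> exists a : 'I_(K * 2 ^ m), grid m y a.
Proof.
move=> /andP[y0 yK].
have Y0 : 0 <= 2 ^+ m * y by rewrite mulr_ge0// ltW// pow2_gt0.
have /andP[t1 t2] := truncn_itv Y0.
have lt : (Num.truncn (2 ^+ m * y) < K * 2 ^ m)%N.
  rewrite -(ltr_nat R) (le_lt_trans t1)// natrM natrX mulrC.
  by rewrite ltr_pM2r ?pow2_gt0.
by exists (Ordinal lt); apply/andP.
Qed.

(** The coarse bounds are integer multiples of [2^(m' - m)] at the fine scale. By integrality the
    fine index satisfies [2^(m' - m) a <= a' < 2^(m' - m) (a + 1)], and the whole fine interval
    stays inside the coarse one. *)
Lemma grid_nested m m' y y' a a' : (m <= m')%N ->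
  grid m y a -> grid m' y a' -> grid m' y' a' -> grid m y' a.
Proof.
move=> mm' /andP[a1 a2] /andP[b1 b2] /andP[c1 c2].
have E z : 2 ^+ m' * z = (2 ^ (m' - m))%:R * (2 ^+ m * z) :> R.
  by rewrite natrX mulrA -exprD subnK.
have k0 : 0 < (2 ^ (m' - m))%:R :> R by rewrite natrX pow2_gt0.
move: b1 b2 c1 c2; rewrite !E => b1 b2 c1 c2.
have h1 : (2 ^ (m' - m) * a <= a')%N.
  rewrite -ltnS -(ltr_nat R) natrM (le_lt_trans _ b2)//.
  by rewrite ler_pM2l.
have h2 : (a' < 2 ^ (m' - m) * a.+1)%N.
  rewrite -(ltr_nat R) (le_lt_trans b1)// natrM.
  by rewrite ltr_pM2l.
apply/andP; split.
  rewrite -(ler_pM2l k0) (le_trans _ c1)//.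
  by rewrite -natrM ler_nat.
rewrite -(ltr_pM2l k0) (lt_le_trans c2)//.
by rewrite -natrM ler_nat.
Qed.

Lemma grid_diam m y y' a : grid m y a -> grid m y' a -> `|y - y'| < (2 ^+ m)^-1.
Proof.
move=> /andP[a1 a2] /andP[b1 b2].
rewrite -(ltr_pM2l (pow2_gt0 m)) mulfV ?gt_eqF ?pow2_gt0//.
rewrite -[X in X * _](gtr0_norm (pow2_gt0 m)) -normrM mulrBr.
rewrite ltr_norml; move: (_ * y) (_ * y') a1 a2 b1 b2 => u u'; rewrite -!natr1.
by move: (a%:R) => b *; lra.
Qed.

Lemma cell_inj M m (c c' : cell_index M m) z : cell c z -> cell c' z -> c = c'.
Proof.
case: c c' => [a b] [a' b'] [/= h1 h2] [/= h1' h2'].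
by congr pair; apply/val_inj; [exact: grid_inj h1 h1'|exact: grid_inj h2 h2'].
Qed.

Lemma cell_ex M m z : box M z -> exists c : cell_index M m, cell c z.
Proof.
move=> [/andP[z1 z2] zM].
have [a ha] : exists a : 'I_(2 * M * 2 ^ m), grid m (z.1 + M%:R) a.
  by apply: grid_ex; rewrite natrM; lra.
have [b hb] := grid_ex m zM.
by exists (a, b).
Qed.

Lemma grid_bound m y K (a : 'I_(K * 2 ^ m)) : grid m y a -> 0 <= y < K%:R.
Proof.
move=> /andP[a1 a2]; apply/andP; split.
  by rewrite -(pmulr_rge0 _ (pow2_gt0 m)) (le_trans _ a1).
rewrite -(ltr_pM2l (pow2_gt0 m)) (lt_le_trans a2)//.
by rewrite mulrC -natrX -natrM ler_nat.
Qed.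

Lemma cell_box M m (c : cell_index M m) : cell c `<=` box M.
Proof.
move=> z [/grid_bound]; rewrite natrM => h1 /grid_bound h2; split => //.
by move: h1; lra.
Qed.

Lemma box_half M : box M `<=` half.
Proof. by move=> z [_ /andP[]]. Qed.

Lemma cell_half M m (c : cell_index M m) : cell c `<=` half.
Proof. by move=> z /cell_box; exact: box_half. Qed.

Lemma cell_nested M m m' (c : cell_index M m) (c' : cell_index M m') z z' :
  (m <= m')%N -> cell c z -> cell c' z -> cell c' z' -> cell c z'.
Proof.
move=> mm' [a1 a2] [b1 b2] [d1 d2]; split.
  exact: grid_nested mm' a1 b1 d1.
exact: grid_nested mm' a2 b2 d2.
Qed.

Lemma cell_diam M m (c : cell_index M m) z z' : cell c z -> cell c z' ->
  `|z.1 - z'.1| < (2 ^+ m)^-1 /\ `|z.2 - z'.2| < (2 ^+ m)^-1.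
Proof.
move=> [a1 a2] [b1 b2]; split; last exact: grid_diam a2 b2.
by have := grid_diam a1 b1; rewrite opprD addrACA subrr addr0.
Qed.

Lemma cellE M m (c : cell_index M m) : cell c =
  `[c.1%:R / 2 ^+ m - M%:R, c.1.+1%:R / 2 ^+ m - M%:R[%classic `*`
  `[c.2%:R / 2 ^+ m, c.2.+1%:R / 2 ^+ m[%classic.
Proof.
have p0 := pow2_gt0 m.
apply/seteqP; split => z; rewrite /cell /grid /=.
  move=> [/andP[h1 h2] /andP[h3 h4]]; split; rewrite /= in_itv/=.
    by rewrite lerBlDr ltrBrDr ler_pdivrMr// ltr_pdivlMr// [_ * 2 ^+ m]mulrC h1 h2.
  by rewrite ler_pdivrMr// ltr_pdivlMr// [_ * 2 ^+ m]mulrC h3 h4.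
move=> []; rewrite /= !in_itv/= lerBlDr ltrBrDr !ler_pdivrMr// !ltr_pdivlMr//.
by rewrite [z.2 * _]mulrC [(_ + _) * _]mulrC => -> ->.
Qed.

Lemma measurable_cell M m (c : cell_index M m) : measurable (cell c).
Proof. by rewrite cellE; apply: measurableX. Qed.

Definition cell_area (m : nat) : R := ((2 ^+ m)^-1) ^+ 2.

Lemma leb2_cell M m (c : cell_index M m) : (leb2 (cell c) = (cell_area m)%:E)%E.
Proof.
have p0 := pow2_gt0 m.
rewrite cellE; set I1 := [set` _]; set I2 := [set` _].
have -> : leb2 (I1 `*` I2) = (leb I1 * leb I2)%E by apply: product_measure1E; exact: measurable_itv.
rewrite !lebesgue_measure_itv/= !lte_fin.
rewrite ltrD2r !ltr_pM2r ?invr_gt0// !ltr_nat !ltnSn -!EFinM; congr (_%:E).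
by rewrite /cell_area -!natr1; field; rewrite gt_eqF.
Qed.

Lemma cell_area_gt0 m : 0 < cell_area m.
Proof. by rewrite exprn_gt0// invr_gt0 pow2_gt0. Qed.

Lemma cvg_pow2V : (fun m : nat => (2 ^+ m)^-1 : R) @ \oo --> (0 : R).
Proof.
rewrite (_ : (fun m : nat => (2 ^+ m)^-1 : R) = (fun m => (2^-1) ^+ m)).
  by apply: cvg_expr; rewrite gtr0_norm ?invr_gt0// invf_lt1// ltr1n.
by apply/funext => m; rewrite exprVn.
Qed.

Lemma card_cell_index M m : (#|cell_index M m|%:R * cell_area m = 2 * M%:R ^+ 2 :> R).
Proof.
rewrite card_prod !card_ord /cell_area !natrM !natrX.
by field; rewrite gt_eqF// pow2_gt0.
Qed.

End Cells.

(** * Comparison of lower integrals *)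

Section LowerIntegral.
Local Open Scope ereal_scope.
Variables (R : realType) (d : measure_display) (T : measurableType d).
Variable mu : {measure set T -> \bar R}.
Import HBNNSimple.

(* No measurability: the integral is a supremum over simple functions below. *)
Lemma le_lower_integral (f g : T -> \bar R) : (forall x, 0 <= f x) ->
  (forall x, f x <= g x) -> \int[mu]_x f x <= \int[mu]_x g x.
Proof.
move=> f0 fg; have g0 x : 0 <= g x by apply: le_trans (fg x).
rewrite !ge0_integralTE//; apply: le_ereal_sup => _ [h hf <-].
by exists h => // x; apply: le_trans (fg x).
Qed.

(** Only the majorant [g] is measurable. Each simple function below [f] is almost everywhere below
    [g], and the integral of [f] is the supremum over these simple functions. *)
Lemma lower_integral_le (f g : T -> \bar R) (A : set T) : (forall x, 0 <= f x) ->
  (forall x, 0 <= g x) -> measurable_fun setT g ->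
  measurable A -> mu (~` A) = 0 -> (forall x, A x -> f x <= g x) ->
  \int[mu]_x f x <= \int[mu]_x g x.
Proof.
move=> f0 g0 mg mA A0 fg.
rewrite ge0_integralTE//; apply: ge_ereal_sup => _ [h hf <-].
rewrite -integralT_nnsfun; apply: ae_ge0_le_integral => //.
- by move=> x _; rewrite lee_fin.
- exact/measurable_EFinP.
- exists (~` A); split => //; first exact: measurableC.
  move=> x /= H Ax; apply: H => _; exact: le_trans (hf x) (fg x Ax).
Qed.

End LowerIntegral.

(** * Cardinalities as sums over sets *)

Section CountingSum.
Local Open Scope ereal_scope.
Variable (R : realType) (U : choiceType).

Lemma sum1_seq (s : seq U) : \sum_(i <- s) (1 : \bar R) = ((size s)%:R)%:E.
Proof. by rewrite sumEFin big_const_seq count_predT iter_addr addr0. Qed.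

Lemma esum1_ge (A : set U) (s : seq U) : uniq s -> (forall t, t \in s -> A t) ->
  ((size s)%:R)%:E <= \esum_(t in A) (1 : \bar R).
Proof.
move=> us sA; apply: esum_ge; exists [set` s].
  by split; [exact: finite_seq|move=> t /= /sA].
by rewrite -fsbig_seq// sum1_seq.
Qed.

Lemma esum1_ge_card (I : finType) (A : set U) (E : {set I}) (f : I -> U) :
  (forall i, i \in E -> A (f i)) -> {in E &, injective f} ->
  (#|E|%:R)%:E <= \esum_(t in A) (1 : \bar R).
Proof.
move=> EA fi; rewrite cardE -(size_map f); apply: esum1_ge.
  by rewrite map_inj_in_uniq ?enum_uniq// => x y; rewrite !mem_enum; exact: fi.
by move=> t /mapP[i]; rewrite mem_enum => iE ->; exact: EA.
Qed.

Lemma esum1_le (A : set U) (x : \bar R) :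
  (forall s : seq U, uniq s -> (forall t, t \in s -> A t) -> ((size s)%:R)%:E <= x) ->
  \esum_(t in A) (1 : \bar R) <= x.
Proof.
move=> H; apply: ge_ereal_sup => _ [B [fB BA] <-].
rewrite fsbig_finite//= sum1_seq; apply: H; first exact: finmap.fset_uniq.
by move=> t; rewrite in_fset_set// inE => /BA.
Qed.

End CountingSum.

(** * Lower limits of extended real sequences *)

Section LimInf.
Local Open Scope ereal_scope.
Variable R : realType.
Implicit Types u w : (\bar R)^nat.

Lemma limn_einf_sup u : limn_einf u = ereal_sup (range (einfs u)).
Proof. by rewrite limn_einf_lim; apply/cvg_lim => //; exact: cvg_einfs_sup. Qed.

Lemma limn_einf_ge u (x : \bar R) m0 : (forall m, (m0 <= m)%N -> x <= u m) ->
  x <= limn_einf u.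
Proof.
move=> xu; rewrite limn_einf_sup; apply: (@le_trans _ _ (einfs u m0)).
  by apply: le_ereal_inf_tmp => _ [k /= km <-]; exact: xu.
by apply: ereal_sup_ubound; exists m0.
Qed.

Lemma limn_einf_le u w (l : \bar R) : (forall m, u m <= w m) -> w @ \oo --> l ->
  limn_einf u <= l.
Proof.
move=> uw wl; rewrite limn_einf_sup; apply: ge_ereal_sup => _ [k _ <-].
have <- : lim (w @ \oo) = l by exact/cvg_lim.
apply: lime_ge; first by apply/cvg_ex; exists l.
near=> m; apply: le_trans (uw m).
by apply: ereal_inf_lbound; exists m => //=; near: m; exact: nbhs_infty_ge.
Unshelve. all: by end_near. Qed.

Lemma measurable_fun_limn_einf d (T : measurableType d) (f : (T -> \bar R)^nat) :
  (forall n, measurable_fun setT (f n)) ->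
  measurable_fun setT (fun x => limn_einf (f ^~ x)).
Proof.
move=> mf; rewrite (_ : (fun _ => _) = (fun x => - limn_esup (fun n => - f n x))).
  apply: measurableT_comp => //; apply: measurable_fun_limn_esup => k.
  exact: measurableT_comp.
by apply/funext => x; rewrite -[LHS]oppeK -limn_esupN.
Qed.

End LimInf.

(** * Cells of pairs of heads *)

Section Geometry.
Variable R : realType.
Local Notation Q := ((R * R) * (R * R))%type.

Lemma continuous_coord11 : continuous (fun q : Q => q.1.1).
Proof.
by move=> q; apply: (@cvg_comp _ _ _ fst fst (nbhs q) (nbhs q.1) (nbhs q.1.1)); exact: cvg_fst.
Qed.

Lemma continuous_coord12 : continuous (fun q : Q => q.1.2).
Proof.
by move=> q; apply: (@cvg_comp _ _ _ fst snd (nbhs q) (nbhs q.1) (nbhs q.1.2)); [exact: cvg_fst|exact: cvg_snd].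
Qed.

Lemma continuous_coord21 : continuous (fun q : Q => q.2.1).
Proof.
by move=> q; apply: (@cvg_comp _ _ _ snd fst (nbhs q) (nbhs q.2) (nbhs q.2.1)); [exact: cvg_snd|exact: cvg_fst].
Qed.

Lemma continuous_coord22 : continuous (fun q : Q => q.2.2).
Proof.
by move=> q; apply: (@cvg_comp _ _ _ snd snd (nbhs q) (nbhs q.2) (nbhs q.2.2)); exact: cvg_snd.
Qed.

(** A station of speed [w] changes its distance to the origin by at most [w |t - t'|]. After
    squaring, the cross term is controlled by [w |t' - T| <= bird w z t'], where [T] is the head
    time. *)
Lemma bird_lip w (z : R * R) t t' : 0 <= w ->
  bird w z t <= bird w z t' + w * `|t - t'|.
Proof.
move=> w0; have a0 : 0 <= w * `|t - t'| by rewrite mulr_ge0.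
rewrite -ler_sqr ?nnegrE ?bird_ge0//; last by rewrite addr_ge0// bird_ge0.
rewrite sqrrD !bird_sq.
have h : w * `|t' - z.1| <= bird w z t'.
  rewrite -ler_sqr ?nnegrE ?bird_ge0// ?mulr_ge0//.
  by rewrite bird_sq exprMn real_normK ?num_real// lerDl sqr_ge0.
have : w ^+ 2 * ((t - t') * (t' - z.1)) <= bird w z t' * (w * `|t - t'|).
  apply: (@le_trans _ _ (w * `|t' - z.1| * (w * `|t - t'|))); last exact: ler_wpM2r.
  have -> : w * `|t' - z.1| * (w * `|t - t'|) = w ^+ 2 * `|(t - t') * (t' - z.1)|.
    by rewrite normrM; ring.
  by rewrite ler_wpM2l ?sqr_ge0// ler_norm.
rewrite [(w * `|_|) ^+ 2]exprMn real_normK ?num_real//.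
move: (bird _ _ _ * _) => b; nra.
Qed.

Definition pair_index (M m : nat) : finType := (cell_index M m * cell_index M m)%type.

Definition cell2 (M m : nat) (c : pair_index M m) : set Q := cell c.1 `*` cell c.2.

Definition box2 (M : nat) : set Q := box M `*` box M.

Lemma measurable_cell2 M m (c : pair_index M m) : measurable (cell2 c).
Proof. by apply: measurableX; exact: measurable_cell. Qed.

Lemma leb2_cell2 M m (c : pair_index M m) :
  @leb4 R (cell2 c) = (cell_area R m ^+ 2)%:E.
Proof.
by rewrite leb4X ?leb2_cell//; exact: measurable_cell.
Qed.

Lemma cell2_inj M m (c c' : pair_index M m) q : cell2 c q -> cell2 c' q -> c = c'.
Proof.
case: c c' => [a b] [a' b'] [/= h1 h2] [/= h1' h2'].
by rewrite (cell_inj h1 h1') (cell_inj h2 h2').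
Qed.

Lemma cell2_ex M m q : box2 M q -> exists c : pair_index M m, cell2 c q.
Proof.
by move=> [/(@cell_ex _ M m)[a ha] /(@cell_ex _ M m)[b hb]]; exists (a, b).
Qed.

Lemma cell2_box M m (c : pair_index M m) : cell2 c `<=` box2 M.
Proof. by move=> q [/cell_box h1 /cell_box h2]. Qed.

Lemma cell2_nested M m m' (c : pair_index M m) (c' : pair_index M m') q :
  (m <= m')%N -> cell2 c q -> cell2 c' q -> cell2 c' `<=` cell2 c.
Proof.
move=> mm' [h1 h2] [h1' h2'] q' [k1 k2].
by split; [exact: cell_nested h1 h1' k1|exact: cell_nested h2 h2' k2].
Qed.

(** Cells have side [2^-m] whatever the size [M] of the box, so the threshold [m0] is uniform in
    [M]. *)
Lemma near_cell2 (q : Q) (A : set Q) : (\forall q' \near q, A q') ->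
  exists m0, forall m M (c : pair_index M m), (m0 <= m)%N -> cell2 c q -> cell2 c `<=` A.
Proof.
move=> /nbhs_ballP[e /= e0 eA].
have /cvgrPdist_lt /(_ e e0)[m0 _ m0e] := @cvg_pow2V R.
exists m0 => m M c mm0 [h1 h2] q' [k1 k2]; apply: eA.
have lte : (2 ^+ m)^-1 < e.
  have := m0e m mm0; rewrite sub0r normrN gtr0_norm ?invr_gt0 ?pow2_gt0//.
have [a1 a2] := cell_diam h1 k1; have [b1 b2] := cell_diam h2 k2.
by split; split; rewrite /ball/=; apply: lt_trans lte.
Qed.

(** Cells of a given mesh are disjoint, so a step function reduces at [q] to the single term of the
    cell of [q]. *)
Lemma sum_cell2 M m (p : pred (pair_index M m)) (F : pair_index M m -> \bar R) q c :
  cell2 c q ->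
  (\sum_(c | p c) (F c * (\1_(cell2 c) q)%:E) = if p c then F c else 0)%E.
Proof.
move=> cq; have z c' : c' != c -> (F c' * (\1_(cell2 c') q)%:E = 0)%E.
  move=> c'c; rewrite indicE memNset ?mule0// => c'q.
  by rewrite (cell2_inj cq c'q) eqxx in c'c.
case: ifP => pc.
  rewrite (bigD1 c)//= big1 ?adde0 => [|c' /andP[_ /z//]].
  by rewrite indicE mem_set// mule1.
by rewrite big1// => c' pc'; apply: z; apply: contraFneq pc => <-.
Qed.

Lemma sum_cell2_out M m (p : pred (pair_index M m)) (F : pair_index M m -> \bar R) q :
  ~ box2 M q -> (\sum_(c | p c) (F c * (\1_(cell2 c) q)%:E) = 0)%E.
Proof.
move=> nq; rewrite big1// => c _; rewrite indicE memNset ?mule0// => cq.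
by apply: nq; exact: cell2_box cq.
Qed.

End Geometry.

Lemma ge0_integral_sum_pred d (T : measurableType d) (R : realType)
    (mu : {measure set T -> \bar R}) (I : finType) (p : pred I) (f : I -> T -> \bar R) :
  (forall c, measurable_fun setT (f c)) -> (forall c x, 0 <= f c x)%E ->
  (\int[mu]_x \sum_(c | p c) f c x = \sum_(c | p c) \int[mu]_x f c x)%E.
Proof.
move=> mf f0; rewrite -[RHS]big_filter -ge0_integral_sum//.
by apply: eq_integral => x _; rewrite big_filter.
Qed.

Lemma emeasurable_sum_pred d (T : measurableType d) (R : realType)
    (I : finType) (p : pred I) (f : I -> T -> \bar R) :
  (forall c, measurable_fun setT (f c)) ->
  measurable_fun setT (fun x => \sum_(c | p c) f c x)%E.
Proof.
move=> mf; under eq_fun do rewrite -big_filter.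
exact: emeasurable_sum.
Qed.

Lemma integral_indicT d (T : measurableType d) (R : realType)
    (mu : {measure set T -> \bar R}) (A : set T) : measurable A ->
  (\int[mu]_x (\1_A x)%:E = mu A)%E.
Proof. by move=> mA; rewrite integral_indic// setIT. Qed.

(** * The Mecke formula *)

Section MeckeCells.
Variables (R : realType) (n : nat) (lam v : 'I_n -> R).
Hypothesis lam0 : forall i, 0 < lam i.
Hypothesis v0 : forall i, 0 < v i.
Local Notation leb2 := (@leb2 R).
Local Notation Q := ((R * R) * (R * R))%type.
Local Notation leb4 := (@leb4 R).

(** [K q t] stands for: the pair of heads [q] may produce a handover at time [t]. On the open set
    [D] this happens at [tau q], which is continuous there. [Z] is a null set of borderline pairs,
    and near any pair outside [D] and [Z] no time is possible at all. *)
Variables (j : 'I_n) (K : Q -> R -> Prop) (D Z : set Q) (tau : Q -> R).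
Hypothesis D_K : forall q, D q -> K q (tau q).
Hypothesis D_open : forall q, D q -> \forall q' \near q, D q'.
Hypothesis D_cont : forall q, D q -> {for q, continuous tau}.
Hypothesis D_ext : forall q, ~ D q -> ~ Z q -> \forall q' \near q, forall t, ~ K q' t.
Hypothesis mD : measurable D.
Hypothesis mtau : measurable_fun D tau.
Hypothesis mZ : measurable Z.
Hypothesis Z0 : leb4 Z = 0%E.

Definition total_rate : R := (\sum_l lam l) * pi.
Definition void_prob (r : R) : R := expR (- (total_rate * r ^+ 2)).
Definition handover_radius (q : Q) : R := bird (v j) q.2 (tau q).

Lemma total_rate_ge0 : 0 <= total_rate.
Proof. by rewrite mulr_ge0 ?pi_ge0// sumr_ge0// => l _; rewrite ltW. Qed.

Lemma void_prob_ge0 r : 0 <= void_prob r.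
Proof. exact: expR_ge0. Qed.

Lemma void_prob_le1 r : void_prob r <= 1.
Proof.
rewrite -expR0 ler_expR oppr_le0 mulr_ge0 ?sqr_ge0//; exact: total_rate_ge0.
Qed.

Lemma continuous_void_prob : continuous void_prob.
Proof.
move=> r; apply: continuous_comp; last exact: continuous_expR.
apply: cvgN; apply: cvgM; first exact: cvg_cst.
exact: exprn_continuous.
Qed.

Lemma continuous_radius q : D q -> {for q, continuous handover_radius}.
Proof.
move=> Dq; rewrite /handover_radius /bird.
apply: continuous_comp; last exact: sqrt_continuous.
have c22 : (fun q' : Q => q'.2.2) x @[x --> q] --> q.2.2 by exact: continuous_coord22.
have c21 : (fun q' : Q => q'.2.1) x @[x --> q] --> q.2.1 by exact: continuous_coord21.
apply: cvgD; last first.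
  by apply: (@continuous_comp _ _ _ (fun q' : Q => q'.2.2) (fun y => y ^+ 2)) => //; exact: exprn_continuous.
apply: cvgM; first exact: cvg_cst.
apply: (@continuous_comp _ _ _ (fun q' : Q => tau q' - q'.2.1) (fun y => y ^+ 2)).
  by apply: cvgB => //; exact: D_cont.
exact: exprn_continuous.
Qed.

Lemma measurable_radius : measurable_fun D handover_radius.
Proof.
apply: (measurableT_comp (@measurable_sqrt R)).
have m22 : measurable_fun D (fun q : Q => q.2.2).
  by apply: measurable_funTS; exact: measurableT_comp.
have m21 : measurable_fun D (fun q : Q => q.2.1).
  by apply: measurable_funTS; exact: measurableT_comp.
apply: measurable_funD; last exact: measurable_funX.
apply: measurable_funM => //; apply: measurable_funX.
exact: measurable_funB.
Qed.

Lemma measurable_void_radius : measurable_fun D (fun q => void_prob (handover_radius q)).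
Proof.
apply: measurableT_comp measurable_radius.
apply: continuous_measurable_fun; exact: continuous_void_prob.
Qed.

(* p = (t0, r-, r+): the ball of radius r- (resp. r+) at time t0 lies inside (resp. contains)
   the empty ball of every pair of heads in A, with void_cell probabilities within eta. *)
Definition sandwich (eta : R) (A : set Q) (p : R * R * R) : Prop :=
  0 <= p.1.2 /\ 0 <= p.2 /\ forall q, A q ->
  [/\ D q,
      forall l z, bird (v l) z p.1.1 < p.1.2 -> bird (v l) z (tau q) < handover_radius q,
      forall l z, bird (v l) z (tau q) <= handover_radius q -> bird (v l) z p.1.1 < p.2,
      void_prob p.1.2 <= void_prob (handover_radius q) + eta &
      void_prob (handover_radius q) <= void_prob p.2 + eta].

(** The meeting time and the radius vary by less than [del] near [q]. Moving from time [tau q'] to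
    [tau q] changes any distance by at most [V del], so shrinking and enlarging the radius at [q] by
    suitable multiples of [del] gives both inclusions at once for all types. *)
Lemma near_sandwich eta q : 0 < eta -> D q ->
  exists p, \forall q' \near q, sandwich eta [set q'] p.
Proof.
move=> eta0 Dq.
have eta2 : 0 < eta / 2 by rewrite divr_gt0.
have /cvgrPdist_le /(_ _ eta2) /nbhs_ballP[e /= e0 eE] := @continuous_void_prob (handover_radius q).
pose V := \sum_l v l.
have vV l : v l <= V.
  by rewrite /V (bigD1 l)//= lerDl sumr_ge0// => k _; rewrite ltW.
have V0 : 0 <= V by rewrite sumr_ge0// => k _; rewrite ltW.
(* Small enough that radii changed by [(V + 2) del] remain within [e], where [void_prob] varies by
   at most [eta / 2]; two such estimates give [eta]. *)
pose del := e / (2 * (V + 3)).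
have V3 : 0 < 2 * (V + 3) by lra.
have del0 : 0 < del by rewrite divr_gt0.
have delE : del * (2 * (V + 3)) = e by rewrite divfK// gt_eqF.
have rq0 : 0 <= handover_radius q := bird_ge0 _ _ _.
have nearE x : `|handover_radius q - x| < e -> `|void_prob (handover_radius q) - void_prob x| <= eta / 2.
  by move=> xe; apply: eE.
(* The truncation at 0 keeps the radius nonnegative; the open disc of radius 0 is empty, so the
   inner inclusion still holds. *)
pose rm := Num.max 0 (handover_radius q - (V + 1) * del).
pose rp := handover_radius q + (V + 2) * del.
exists (tau q, rm, rp).
have /cvgrPdist_lt /(_ _ del0) ntau := D_cont Dq.
have /cvgrPdist_lt /(_ _ del0) nrad := continuous_radius Dq.
near=> q'.
have Dq' : D q' by near: q'; exact: D_open.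
have tq' : `|tau q - tau q'| < del by near: q'; exact: ntau.
have rq' : `|handover_radius q - handover_radius q'| < del by near: q'; exact: nrad.
have rm0 : 0 <= rm by rewrite le_max lexx.
have Vd : 0 <= V * del by rewrite mulr_ge0// ltW.
have rp0 : 0 <= rp by rewrite addr_ge0// mulr_ge0 ?(ltW del0)//; lra.
have rmE : `|handover_radius q - rm| < e.
  rewrite /rm; case: (leP 0 (handover_radius q - (V + 1) * del)) => h.
    by rewrite ger0_norm; nra.
  by rewrite subr0 ger0_norm//; nra.
have rpE : `|handover_radius q - rp| < e.
  by rewrite /rp opprD addrA subrr sub0r normrN ger0_norm; nra.
have rq'E : `|handover_radius q - handover_radius q'| < e by apply: (lt_trans rq'); nra.
have lipV l z t t' : bird (v l) z t <= bird (v l) z t' + V * `|t - t'|.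
  apply: (le_trans (bird_lip z t t' (ltW (v0 l)))).
  by rewrite lerD2l ler_wpM2r.
have tV : V * `|tau q - tau q'| <= V * del by rewrite ler_wpM2l// ltW.
have := nearE _ rmE; have := nearE _ rpE; have := nearE _ rq'E.
rewrite !ler_distl => /andP[a1 a2] /andP[b1 b2] /andP[c1 c2].
split => //=; split => //= _ ->; split => //=.
- move=> l z zm; have := lipV l z (tau q') (tau q); rewrite distrC => lip.
  apply: (le_lt_trans lip); move: zm; rewrite /rm lt_max.
  case/orP => [|zm]; first by rewrite ltNge bird_ge0.
  have := ltr_distlDr rq'; move: tV zm; rewrite /handover_radius; nra.
- move=> l z zr; have := lipV l z (tau q) (tau q') => lip.
  apply: (le_lt_trans lip); rewrite /rp.
  move: rq'; rewrite ltr_distl => /andP[h1 h2]; move: tV zr h1 h2 del0.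
  move: (V * _) => u; nra.
- by lra.
- by lra.
Unshelve. all: by end_near. Qed.


Definition good_cell (eta : R) M m (c : pair_index M m) : Prop :=
  exists p, sandwich eta (cell2 c) p.

Definition void_cell M m (c : pair_index M m) : Prop :=
  forall q, cell2 c q -> forall t, ~ K q t.

(** The part of the box on which neither estimate is available: the cell is not good, and yet some
    pair in it may produce a handover. *)
Definition bad_set eta M m : set Q :=
  [set q | exists c : pair_index M m, [/\ cell2 c q, ~ good_cell eta c & ~ void_cell c]].

Lemma near_good eta q : 0 < eta -> D q ->
  exists m0, forall m M (c : pair_index M m), (m0 <= m)%N -> cell2 c q -> good_cell eta c.
Proof.
move=> eta0 Dq; have [p np] := near_sandwich eta0 Dq.
have [m0 m0P] := near_cell2 np; exists m0 => m M c mm0 cq; exists p.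
have cs := m0P m M c mm0 cq.
have [p1 [p2 _]] := cs _ cq; split => //; split => // q' cq'.
by have [_ [_]] := cs _ cq'; apply.
Qed.

Lemma near_void q : ~ D q -> ~ Z q ->
  exists m0, forall m M (c : pair_index M m), (m0 <= m)%N -> cell2 c q -> void_cell c.
Proof.
move=> Dq Zq; have [m0 m0P] := near_cell2 (D_ext Dq Zq).
by exists m0 => m M c mm0 cq q' cq'; exact: (m0P m M c mm0 cq).
Qed.

Lemma measurable_bad eta M m : measurable (bad_set eta M m).
Proof.
rewrite (_ : bad_set _ _ _ = \bigcup_(c in [set c : pair_index M m | ~ good_cell eta c /\ ~ void_cell c]) cell2 c).
  by apply: fin_bigcup_measurable => [|c _]; [exact: finite_finset|exact: measurable_cell2].
apply/seteqP; split => q /=.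
  by move=> [c [h1 h2 h3]]; exists c.
by move=> [c [h1 h2] h3]; exists c.
Qed.

Lemma bad_box eta M m : bad_set eta M m `<=` box2 M.
Proof. by move=> q [c [/cell2_box]]. Qed.

(** Being good and being void both pass to subcells, and dyadic cells are nested. *)
Lemma bad_nonincreasing eta M m m' : (m <= m')%N -> bad_set eta M m' `<=` bad_set eta M m.
Proof.
move=> mm' q bq; have [c cq] := cell2_ex m (bad_box bq).
case: bq => c' [cq' ng nv]; exists c; split => //.
  move=> [p [p1 [p2 pP]]]; apply: ng; exists p; split => //; split => // q' /=.
  by move/(cell2_nested mm' cq cq'); exact: pP.
move=> vc; apply: nv => q' /(cell2_nested mm' cq cq'); exact: vc.
Qed.

Lemma bad_limit eta M : 0 < eta -> \bigcap_m bad_set eta M m `<=` Z.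
Proof.
move=> eta0 q bq; apply: contrapT => nZ.
have bx : box2 M q by apply: (@bad_box eta M 0); exact: bq.
have [Dq|Dq] := pselect (D q).
  have [m0 m0P] := near_good eta0 Dq.
  by have [c [cq + _]] := bq m0 Logic.I; apply; exact: m0P cq.
have [m0 m0P] := near_void Dq nZ.
by have [c [cq _]] := bq m0 Logic.I; apply; exact: m0P cq.
Qed.

Definition vol2 (M : nat) : R := (2 * M%:R ^+ 2) ^+ 2.

Lemma measurable_box M : measurable (@box R M).
Proof.
rewrite (_ : box M = `[- M%:R, M%:R[%classic `*` `[0, M%:R[%classic).
  by apply: measurableX.
by apply/seteqP; split => z /=; rewrite !in_itv.
Qed.

Lemma leb2_box M : leb2 (box M) = (2 * M%:R ^+ 2)%:E.
Proof.
rewrite (_ : box M = `[- M%:R, M%:R[%classic `*` `[0, M%:R[%classic); last first.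
  by apply/seteqP; split => z /=; rewrite !in_itv.
set I1 := [set` _]; set I2 := [set` _].
have -> : leb2 (I1 `*` I2) = (@lebesgue_measure R I1 * @lebesgue_measure R I2)%E.
  by apply: product_measure1E; exact: measurable_itv.
rewrite !lebesgue_measure_itv/= !lte_fin.
case: M I1 I2 => [|M] _ _; first by rewrite oppr0 ltxx mul0e expr0n mulr0.
have M0 : 0 < M.+1%:R :> R by rewrite ltr0n.
rewrite M0 gtrN// -!EFinD -EFinM; congr (_%:E).
by rewrite opprK oppr0; ring.
Qed.

Lemma measurable_box2 M : measurable (box2 M : set Q).
Proof. by apply: measurableX; exact: measurable_box. Qed.

Lemma leb4_box2 M : leb4 (box2 M) = (vol2 M)%:E.
Proof.
by rewrite leb4X ?leb2_box -?EFinM//; exact: measurable_box.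
Qed.

Lemma bad_fin eta M m : leb4 (bad_set eta M m) = (fine (leb4 (bad_set eta M m)))%:E.
Proof.
rewrite fineK// ge0_fin_numE//; apply: (@le_lt_trans _ _ (leb4 (box2 M))).
  apply: le_measure; rewrite ?inE; [exact: measurable_bad|exact: measurable_box2|].
  exact: bad_box.
by rewrite leb4_box2 ltry.
Qed.

(** Continuity from above inside a box of finite measure: every pair off [Z] eventually lies in a
    good or a void cell, so the decreasing bad sets intersect in a part of [Z]. *)
Lemma cvg_bad eta M : 0 < eta -> (fun m => leb4 (bad_set eta M m)) @ \oo --> (0 : \bar R).
Proof.
move=> eta0.
have mcap : measurable (\bigcap_m bad_set eta M m).
  by apply: bigcap_measurable => [|m _]; [exists 0%N|exact: measurable_bad].
have <- : leb4 (\bigcap_m bad_set eta M m) = 0%E.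
  apply/eqP; rewrite -measure_le0 -Z0; apply: le_measure; rewrite ?inE//.
  exact: bad_limit.
apply: nonincreasing_cvg_mu => //.
- by have : (leb4 (bad_set eta M 0) < +oo)%E by rewrite bad_fin ltry.
- by move=> m; exact: measurable_bad.
- by move=> m m' mm'; apply/subsetPset; exact: bad_nonincreasing.
Qed.

Definition handover_density (q : Q) : \bar R := (void_prob (handover_radius q))%:E.

Definition box_integral (M : nat) : \bar R :=
  (\int[leb4]_(q in D `&` box2 M) handover_density q)%E.

Lemma measurable_density_box M : measurable_fun (D `&` box2 M) handover_density.
Proof.
apply/measurable_EFinP; apply: measurable_funS measurable_void_radius => //.
Qed.

Lemma measurable_indicE (A : set Q) : measurable A ->
  measurable_fun setT (fun q => (\1_A q)%:E : \bar R).
Proof. by move=> mA; apply/measurable_EFinP; exact: measurable_indic. Qed.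

Let integral_indic4 (A : set Q) : measurable A ->
  (\int[leb4]_q (\1_A q)%:E = leb4 A)%E.
Proof. by move=> mA; exact: integral_indicT. Qed.

Let integral3 (f g h : Q -> \bar R) :
  measurable_fun setT f -> measurable_fun setT g -> measurable_fun setT h ->
  (forall q, 0 <= f q)%E -> (forall q, 0 <= g q)%E -> (forall q, 0 <= h q)%E ->
  (\int[leb4]_q f q + \int[leb4]_q g q + \int[leb4]_q h q =
   \int[leb4]_q (f q + g q + h q))%E.
Proof.
move=> mf mg mh f0 g0 h0; apply/esym; rewrite ge0_integralD//.
- by congr (_ + _)%E; exact: ge0_integralD.
- by move=> q _; exact: adde_ge0.
- exact: emeasurable_funD.
Qed.

Let le_integral4 (f g : Q -> \bar R) :
  measurable_fun setT f -> measurable_fun setT g ->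
  (forall q, 0 <= f q)%E -> (forall q, f q <= g q)%E ->
  (\int[leb4]_q f q <= \int[leb4]_q g q)%E.
Proof. by move=> mf mg f0 fg; apply: ge0_le_integral => // q _; exact: le_trans (fg q). Qed.

Let dens M q := ((handover_density \_ (D `&` box2 M)) q)%E.

Let mdens M : measurable_fun setT (dens M).
Proof.
apply/(measurable_restrictT _ _).1; last exact: measurable_density_box.
by apply: measurableI => //; exact: measurable_box2.
Qed.

Let dens0 M q : (0 <= dens M q)%E.
Proof. by rewrite /dens /patch; case: ifP => // _; rewrite lee_fin expR_ge0. Qed.

Let dens_int M : (\int[leb4]_q dens M q = box_integral M)%E.
Proof. by rewrite /box_integral [RHS]integral_mkcond. Qed.

Let dens_in M q : D q -> box2 M q -> dens M q = handover_density q.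
Proof. by move=> Dq bq; rewrite /dens /patch mem_set. Qed.

Let dens_le1 M q : (dens M q <= 1)%E.
Proof.
rewrite /dens /patch; case: ifP => _ /=; rewrite lee_fin ?ler01//; exact: void_prob_le1.
Qed.

Lemma integral_cell_sum M m (p : pred (pair_index M m)) (r : pair_index M m -> R) :
  (forall c, 0 <= r c) ->
  (\int[leb4]_q \sum_(c | p c) ((r c)%:E * (\1_(cell2 c) q)%:E) =
   \sum_(c | p c) (r c * cell_area R m ^+ 2)%:E)%E.
Proof.
move=> r0; rewrite ge0_integral_sum_pred.
- apply: eq_bigr => c _; rewrite ge0_integralZl//.
  + by rewrite integral_indic4 ?leb2_cell2//; exact: measurable_cell2.
  + by apply: measurable_indicE; exact: measurable_cell2.
  + by rewrite lee_fin.
- move=> c; apply: emeasurable_funM => //.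
  by apply: measurable_indicE; exact: measurable_cell2.
- by move=> c q; apply: mule_ge0; rewrite lee_fin.
Qed.

Let msum M m (p : pred (pair_index M m)) (r : pair_index M m -> R) :
  measurable_fun setT (fun q : Q => \sum_(c | p c) ((r c)%:E * (\1_(cell2 c) q)%:E))%E.
Proof.
apply: emeasurable_sum_pred => c; apply: emeasurable_funM => //.
by apply: measurable_indicE; exact: measurable_cell2.
Qed.

(** Compared point by point under the integral. The cells summed are not void, so each is good,
    where [r] exceeds the integrand by at most [eta], or bad, where [r <= 1] is paid for by the
    measure of the bad set. *)
Lemma cell_sum_le eta M m (p : pred (pair_index M m)) (r : pair_index M m -> R) : 0 < eta ->
  (forall c, 0 <= r c <= 1) ->
  (forall c, p c -> ~ void_cell c) ->
  (forall c, p c -> good_cell eta c -> forall q, cell2 c q -> r c <= void_prob (handover_radius q) + eta) ->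
  (\sum_(c | p c) (r c * cell_area R m ^+ 2)%:E <=
   box_integral M + (eta * vol2 M)%:E + leb4 (bad_set eta M m))%E.
Proof.
move=> eta0 r01 pv pg.
have r0 c : 0 <= r c by case/andP: (r01 c).
rewrite -integral_cell_sum// -dens_int.
have -> : (eta * vol2 M)%:E = (\int[leb4]_q (eta%:E * (\1_(box2 M) q)%:E))%E.
  rewrite ge0_integralZl// ?lee_fin ?ltW//.
  + by rewrite integral_indic4 ?leb4_box2//; exact: measurable_box2.
  + by apply: measurable_indicE; exact: measurable_box2.
have -> : leb4 (bad_set eta M m) = (\int[leb4]_q (\1_(bad_set eta M m) q)%:E)%E.
  by rewrite integral_indic4//; exact: measurable_bad.
have mb1 : measurable_fun setT (fun q : Q => eta%:E * (\1_(box2 M) q)%:E)%E.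
  apply: emeasurable_funM => //.
  by apply: measurable_indicE; exact: measurable_box2.
have mb2 : measurable_fun setT (fun q : Q => (\1_(bad_set eta M m) q)%:E : \bar R).
  by apply: measurable_indicE; exact: measurable_bad.
have b1 (q : Q) : (0 <= eta%:E * (\1_(box2 M) q)%:E)%E by apply: mule_ge0; rewrite lee_fin// ltW.
rewrite integral3//.
apply: le_integral4.
- exact: msum.
- by apply: emeasurable_funD => //; exact: emeasurable_funD.
- by move=> q; apply: sume_ge0 => c _; apply: mule_ge0; rewrite lee_fin.
move=> q; have [bq|nbq] := pselect (box2 M q); last first.
  by rewrite sum_cell2_out// adde_ge0// adde_ge0.
have [c cq] := cell2_ex m bq.
rewrite (sum_cell2 _ _ cq); case: ifP => pc; last by rewrite adde_ge0// adde_ge0.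
have -> : (\1_(box2 M) q)%:E = 1%E :> \bar R by rewrite indicE mem_set.
rewrite mule1.
have [gc|ngc] := pselect (good_cell eta c).
  have Dq : D q by case: gc => p' [_ [_ /(_ q cq)[]]].
  rewrite dens_in//; apply: (@le_trans _ _ (handover_density q + eta%:E)%E).
    by rewrite lee_fin; exact: pg cq.
  by rewrite leeDl.
have -> : (\1_(bad_set eta M m) q)%:E = 1%E :> \bar R.
  by rewrite indicE mem_set//; exists c; split => //; exact: pv.
apply: (@le_trans _ _ 1%E); first by rewrite lee_fin; case/andP: (r01 c).
by rewrite leeDr// adde_ge0// lee_fin ltW.
Qed.

(** The integrand lives on [D], whose points lie in good or bad cells. On the bad ones it is bounded
    by 1, hence the error term [leb4 (bad_set eta M m)]. *)
Lemma cell_sum_ge eta M m (r : pair_index M m -> R) : 0 < eta ->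
  (forall c, 0 <= r c) ->
  (forall c, good_cell eta c -> forall q, cell2 c q -> void_prob (handover_radius q) <= r c + eta) ->
  (box_integral M <= \sum_(c | `[< good_cell eta c >]) (r c * cell_area R m ^+ 2)%:E +
    (eta * vol2 M)%:E + leb4 (bad_set eta M m))%E.
Proof.
move=> eta0 r0 rg.
rewrite -integral_cell_sum// -dens_int.
have -> : (eta * vol2 M)%:E = (\int[leb4]_q (eta%:E * (\1_(box2 M) q)%:E))%E.
  rewrite ge0_integralZl// ?lee_fin ?ltW//.
  + by rewrite integral_indic4 ?leb4_box2//; exact: measurable_box2.
  + by apply: measurable_indicE; exact: measurable_box2.
have -> : leb4 (bad_set eta M m) = (\int[leb4]_q (\1_(bad_set eta M m) q)%:E)%E.
  by rewrite integral_indic4//; exact: measurable_bad.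
have mb1 : measurable_fun setT (fun q : Q => eta%:E * (\1_(box2 M) q)%:E)%E.
  apply: emeasurable_funM => //.
  by apply: measurable_indicE; exact: measurable_box2.
have mb2 : measurable_fun setT (fun q : Q => (\1_(bad_set eta M m) q)%:E : \bar R).
  by apply: measurable_indicE; exact: measurable_bad.
have b1 (q : Q) : (0 <= eta%:E * (\1_(box2 M) q)%:E)%E by apply: mule_ge0; rewrite lee_fin// ltW.
have s0 (q : Q) : (0 <= \sum_(c : pair_index M m | `[< good_cell eta c >]) ((r c)%:E * (\1_(cell2 c) q)%:E))%E.
  by apply: sume_ge0 => c _; apply: mule_ge0; rewrite lee_fin.
rewrite integral3//.
apply: le_integral4 => //.
- by apply: emeasurable_funD => //; exact: emeasurable_funD.
move=> q; have [bq|nbq] := pselect (D q /\ box2 M q); last first.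
  rewrite [dens M q](_ : _ = 0%E) ?adde_ge0// ?adde_ge0//.
  by rewrite /dens /patch memNset.
case: bq => Dq bq; have [c cq] := cell2_ex m bq.
rewrite (sum_cell2 _ _ cq).
have -> : (\1_(box2 M) q)%:E = 1%E :> \bar R by rewrite indicE mem_set.
rewrite mule1.
have [gc|ngc] := asboolP (good_cell eta c).
  rewrite dens_in//; apply: (@le_trans _ _ ((r c)%:E + eta%:E)%E).
    by rewrite lee_fin; exact: rg cq.
  by rewrite leeDl.
have -> : (\1_(bad_set eta M m) q)%:E = 1%E :> \bar R.
  (* A cell that meets [D] is not void, since [K] holds at [q] and [tau q]; not being good, it is
     bad. *)
  rewrite indicE mem_set//; exists c; split => // vc.
  by apply: (vc q cq (tau q)); exact: D_K.
rewrite add0e; apply: (le_trans (dens_le1 M q)).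
by rewrite leeDr// lee_fin ltW.
Qed.

End MeckeCells.

(** * Almost sure separation of stations by cells *)

Section Separation.
Variables (R : realType) (n : nat) (lam v : 'I_n -> R).
Variables (d : measure_display) (Omega : measurableType d) (P : probability Omega R).
Variable S : Omega -> set (station R n).
Hypothesis lam0 : forall i, 0 < lam i.
Hypothesis v0 : forall i, 0 < v i.
Hypothesis PPP : marked_PPP P lam S.
Local Notation leb2 := (@leb2 R).
Local Notation half := [set z : R * R | 0 <= z.2].

Lemma has_card_le1 (T : eqType) (A : set T) : has_card A 0 \/ has_card A 1 ->
  forall x y, A x -> A y -> x = y.
Proof.
case=> -[l [_ [lA sl]]] x y; rewrite -lA /= .
  by rewrite (size0nil sl).
by case: l sl {lA} => // a [|//] _; rewrite !inE => /eqP -> /eqP ->.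
Qed.

Definition cells_separated (w : Omega) (l : 'I_n) (M m : nat) : Prop :=
  forall (c : cell_index M m) s s', stations_in v S l (cell c) w s ->
    stations_in v S l (cell c) w s' -> s = s'.

Lemma measure_big_setU (I : finType) (E : I -> set Omega) (x : I -> \bar R) :
  (forall c, measurable (E c)) -> (forall c, P (E c) <= x c)%E ->
  (P (\big[setU/set0]_(c : I) E c) <= \sum_(c : I) x c)%E.
Proof.
move=> mE Ex; suff [] : measurable (\big[setU/set0]_(c : I) E c) /\
  (P (\big[setU/set0]_(c : I) E c) <= \sum_(c : I) x c)%E by [].
elim/big_rec2: _ => [|c s F _ [mF Fs]]; first by rewrite measure0.
split; first exact: measurableU.
apply: (@le_trans _ _ (P (E c) + P F)%E); first exact: measureU2.
exact: leeD.
Qed.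

(** A union bound over about [2 M^2 / area] cells, each holding two stations of type [l] with
    probability at most the square of its mass. The bound is therefore of the order of a single cell
    area. *)
Lemma separation_failure_prob l M m : exists2 G : set Omega, measurable G &
  (forall w, ~ G w -> cells_separated w l M m) /\
  (P G <= (mass lam v l ^+ 2 * (2 * M%:R ^+ 2) * cell_area R m)%:E)%E.
Proof.
have key (c : cell_index M m) : {E : set Omega | measurable E /\
    (forall w, ~ E w -> forall s s', stations_in v S l (cell c) w s ->
      stations_in v S l (cell c) w s' -> s = s') /\
    (P E <= ((mass lam v l * cell_area R m) ^+ 2)%:E)%E}.
  apply: cid.
  have ch : leb2 (cell c `&` half) = (cell_area R m)%:E.
    by rewrite (setIidl (@cell_half _ _ _ c)) leb2_cell.
  have [E mE [EP PE]] := count_le1_prob lam0 v0 PPP (l) (measurable_cell c) ch (ltW (cell_area_gt0 R m)).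
  exists E; split=> //; split=> // w nE s s'.
  exact: has_card_le1 (EP w nE) s s'.
exists (\big[setU/set0]_(c : cell_index M m) sval (key c)).
  by apply: bigsetU_measurable => c _; have [] := svalP (key c).
split.
  move=> w nG c; have [_ [+ _]] := svalP (key c); apply.
  by apply: contra_not nG => Ec; rewrite -bigcup_seq; exists c => //=; rewrite mem_index_enum.
apply: (@le_trans _ _ (\sum_(c : cell_index M m) ((mass lam v l * cell_area R m) ^+ 2)%:E)%E).
  by apply: measure_big_setU => c; have [? [_ ?]] := svalP (key c).
rewrite sumEFin lee_fin sumr_const -[leLHS]mulr_natl.
by rewrite -(card_cell_index R M m); rewrite le_eqVlt; apply/orP; left; apply/eqP; ring.
Qed.

(** For fixed [l] and [M] the failure probability tends to 0 with the mesh, so failing at every mesh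
    is a null event. Only countably many such events occur, which yields one measurable set of full
    probability. *)
Lemma separated_ae : exists2 A : set Omega, measurable A &
  P (~` A) = 0%E /\ forall w, A w -> forall l M, exists m, cells_separated w l M m.
Proof.
have key (l : 'I_n) M m : {G : set Omega | measurable G /\
  (forall w, ~ G w -> cells_separated w l M m) /\
  (P G <= (mass lam v l ^+ 2 * (2 * M%:R ^+ 2) * cell_area R m)%:E)%E}.
  by apply: cid; have [G mG [h1 h2]] := separation_failure_prob l M m; exists G.
pose N l M := \bigcap_m sval (key l M m).
have mN l M : measurable (N l M).
  by apply: bigcap_measurable => [|m _]; [exists 0%N|have [] := svalP (key l M m)].
have N0 l M : P (N l M) = 0%E.
  apply/eqP; rewrite -measure_le0; apply/lee_addgt0Pr => e e0; rewrite add0e.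
  set C := mass lam v l ^+ 2 * (2 * M%:R ^+ 2).
  have C0 : 0 <= C by rewrite mulr_ge0 ?sqr_ge0// mulr_ge0 ?sqr_ge0.
  have : (fun m => C * cell_area R m) @ \oo --> (0 : R).
    rewrite -[X in _ --> X](mulr0 C); apply: cvgM; first exact: cvg_cst.
    rewrite /cell_area -[X in _ --> X](expr0n R 2).
    apply: (@cvg_comp _ _ _ _ (fun y : R => y ^+ 2)) (@cvg_pow2V R) _.
    exact: exprn_continuous.
  move=> /cvgrPdist_le /(_ _ e0)[m0 _ m0P].
  have := m0P m0 (leqnn _); rewrite sub0r normrN => h.
  apply: (@le_trans _ _ (P (sval (key l M m0)))).
    apply: le_measure; rewrite ?inE//; first by have [] := svalP (key l M m0).
    by move=> w; apply.
  have [_ [_ h2]] := svalP (key l M m0); apply: (le_trans h2).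
  by rewrite lee_fin (le_trans _ h)// ler_norm.
pose B := \bigcup_M \big[setU/set0]_(l < n) N l M.
have mB : measurable B by apply: bigcup_measurable => M _; exact: bigsetU_measurable.
exists (~` B); first exact: measurableC.
rewrite setCK; split; last first.
  move=> w nB l M; apply: contrapT => nm; apply: nB; exists M => //.
  rewrite -bigcup_seq; exists l; first by rewrite /= mem_index_enum.
  move=> m _; apply: contrapT => nG; apply: nm; exists m.
  by have [_ [+ _]] := svalP (key l M m); apply.
have : P.-negligible B.
  apply: negligible_bigcup => M.
  elim/big_ind: _ => [|X Y|l _]; first exact: negligible_set0.
    exact: negligibleU.
  by exists (N l M); split => //; exact: N0.
by move=> h; apply/(negligibleP _ mB).
Qed.

Lemma box_ex (z : R * R) : 0 <= z.2 -> exists M0, forall M, (M0 <= M)%N -> box M z.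
Proof.
move=> z2.
have [M0 h] : exists M0 : nat, `|z.1| + z.2 < M0%:R.
  exists (Num.truncn (`|z.1| + z.2)).+1.
  by have /andP[] := truncn_itv (addr_ge0 (normr_ge0 z.1) z2).
exists M0 => M MM0.
have : `|z.1| + z.2 < M%:R by rewrite (lt_le_trans h)// ler_nat.
move=> h'; have n1 := normr_ge0 z.1; have n2 := ler_norm z.1; have n3 := ler_norm (- z.1).
rewrite normrN in n3.
by split; lra.
Qed.

Lemma separated_cell w l M m m' (c : cell_index M m') s s' : cells_separated w l M m ->
  (m <= m')%N -> stations_in v S l (cell c) w s -> stations_in v S l (cell c) w s' -> s = s'.
Proof.
move=> sep mm' [Ss [sl cs]] [Ss' [sl' cs']].
have [c0 hc0] := cell_ex m (cell_box cs).
apply: (sep c0); split => //; split => //.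
exact: (cell_nested mm' hc0 cs cs').
Qed.

(** Stations of one type with a common head share every cell, so a separating mesh identifies them.
    This excludes pairs of distinct stations with the same bird. *)
Lemma separated_head w : (forall l M, exists m, cells_separated w l M m) ->
  forall s s', S w s -> S w s' -> s.1 = s'.1 -> shead v s = shead v s' -> s = s'.
Proof.
move=> sep s s' Ss Ss' s1 hh.
have [M /(_ M (leqnn _)) bM] := @box_ex (shead v s) (head_ge0 _ _).
have [m sepm] := sep s.1 M.
have [c cs] := cell_ex m bM.
apply: (sepm c); split => //; split => //=.
by rewrite s1; move: cs; rewrite hh.
Qed.

End Separation.

(** * Upper and lower counts of handovers *)

Section Mecke.
Variables (R : realType) (n : nat) (lam v : 'I_n -> R).
Variables (d : measure_display) (Omega : measurableType d) (P : probability Omega R).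
Variable S : Omega -> set (station R n).
Hypothesis lam0 : forall i, 0 < lam i.
Hypothesis v0 : forall i, 0 < v i.
Hypothesis PPP : marked_PPP P lam S.
Local Notation Q := ((R * R) * (R * R))%type.
Local Notation leb4 := (@leb4 R).
Local Notation half := [set z : R * R | 0 <= z.2].

Variables (i j : 'I_n) (K : Q -> R -> Prop) (D Z : set Q) (tau : Q -> R).
Hypothesis K_uniq : forall q t t', K q t -> K q t' -> t = t'.
Hypothesis K_bird : forall q t, K q t -> bird (v i) q.1 t = bird (v j) q.2 t.
Hypothesis K_left : forall q t, K q t -> q.1.1 < q.2.1.
Hypothesis D_K : forall q, D q -> K q (tau q).
Hypothesis D_open : forall q, D q -> \forall q' \near q, D q'.
Hypothesis D_cont : forall q, D q -> {for q, continuous tau}.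
Hypothesis D_ext : forall q, ~ D q -> ~ Z q -> \forall q' \near q, forall t, ~ K q' t.
Hypothesis mD : measurable D.
Hypothesis mtau : measurable_fun D tau.
Hypothesis mZ : measurable Z.
Hypothesis Z0 : leb4 Z = 0%E.

Definition handover_times (w : Omega) : set R :=
  [set t | exists s s', [/\ s.1 = i, s'.1 = j, K (shead v s, shead v s') t &
                          handover v (S w) s s' t]].

Local Notation void_prob := (void_prob lam).
Local Notation handover_radius := (handover_radius v j tau).
Local Notation good_cell := (good_cell lam v j D tau).
Local Notation void_cell := (void_cell K).
Local Notation bad_set := (bad_set lam v j K D tau).
Local Notation sandwich := (sandwich lam v j D tau).
Local Notation box_integral := (box_integral lam v j D tau).
Local Notation handover_density := (handover_density lam v j tau).
Local Notation kappa := (mass lam v i * mass lam v j).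

Lemma kappa_gt0 : 0 < kappa.
Proof. by rewrite mulr_gt0// mass_gt0. Qed.

Definition sel (eta : R) M m (c : pair_index M m) : R * R * R :=
  xget (0, 0, 0) [set p | sandwich eta (cell2 c) p].

Lemma selP eta M m (c : pair_index M m) : good_cell eta c -> sandwich eta (cell2 c) (sel eta c).
Proof. by move=> [p pP]; exact: (@xgetI _ (0, 0, 0) _ p). Qed.

(** Radius 0 off the good cells makes the disc empty and the void condition vacuous, so that an
    upper count can still use such cells. *)
Definition inner (eta : R) M m (c : pair_index M m) : R :=
  if `[< good_cell eta c >] then (sel eta c).1.2 else 0.

Lemma inner_ge0 eta M m (c : pair_index M m) : 0 <= inner eta c.
Proof. by rewrite /inner; case: asboolP => // /selP[]. Qed.

(** Cells that can contain the heads of a handover pair. When [i = j], two equal components are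
    excluded because a separating mesh never puts two stations of one type in the same cell. *)
Definition active M m (c : pair_index M m) : bool :=
  ~~ `[< void_cell c >] && ((i == j) ==> (c.1 != c.2)).

Definition cell_event (M m : nat) (c : pair_index M m) (t r : R) : set Omega :=
  pair_event v S i j (cell c.1) (cell c.2) t r.

(** The two bounds differ only by the mass of the cells in the exponent, a factor that tends to 1
    with the mesh. *)
Lemma cell_event_prob M m (c : pair_index M m) t r : 0 <= r ->
  (i = j -> c.1 != c.2) ->
  [/\ measurable (cell_event c t r),
   (P (cell_event c t r) <= (kappa * (void_prob r * cell_area R m ^+ 2))%:E)%E &
   ((expR (- ((mass lam v i + mass lam v j) * cell_area R m)) *
     (kappa * (void_prob r * cell_area R m ^+ 2)))%:E <= P (cell_event c t r))%E].
Proof.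
move=> r0 ij; set a := cell_area R m.
have a0 : 0 < a := cell_area_gt0 R m.
have disj : i = j -> @cell R M m c.1 `&` cell c.2 = set0.
  move=> /ij c12; rewrite -subset0 => z [z1 z2].
  by rewrite (cell_inj z1 z2) eqxx in c12.
have [mE [q PE /andP[q1 q2]]] := pair_event_prob lam0 v0 PPP t
  (measurable_cell c.1) (measurable_cell c.2) (@cell_half _ _ _ c.1) (@cell_half _ _ _ c.2)
  (leb2_cell R c.1) (leb2_cell R c.2) r0 disj.
split=> //; rewrite PE lee_fin -/a.
  have -> : mass lam v i * a * (mass lam v j * a) * expR (- q) =
            kappa * (expR (- q) * a ^+ 2) by ring.
  rewrite ler_pM2l ?kappa_gt0// ler_pM2r ?exprn_gt0//.
  by rewrite ler_expR lerN2 /total_rate.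
have -> : mass lam v i * a * (mass lam v j * a) * expR (- q) =
          kappa * (expR (- q) * a ^+ 2) by ring.
set x := _ + _; have -> : expR (- (x * a)) * (kappa * (void_prob r * a ^+ 2)) =
  kappa * ((expR (- (x * a)) * void_prob r) * a ^+ 2) by ring.
rewrite ler_pM2l ?kappa_gt0// ler_pM2r ?exprn_gt0//.
rewrite -expRD ler_expR -opprD lerN2 (le_trans q2)// /total_rate /x.
by rewrite le_eqVlt; apply/orP; left; apply/eqP; rewrite -/a; ring.
Qed.

Definition upper_event eta M m (c : pair_index M m) : set Omega :=
  if active c then cell_event c (sel eta c).1.1 (inner eta c) else set0.

Definition upper_count eta M m (w : Omega) : \bar R :=
  (\sum_(c : pair_index M m | active c) (\1_(upper_event eta c) w)%:E)%E.

Lemma measurable_upper_event eta M m (c : pair_index M m) : measurable (upper_event eta c).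
Proof.
rewrite /upper_event; case: ifP => // /andP[_ /implyP ij].
have ij' : i = j -> c.1 != c.2 by move=> /eqP.
by have [] := cell_event_prob (sel eta c).1.1 (inner_ge0 eta c) ij'.
Qed.

Lemma measurable_upper_count eta M m : measurable_fun setT (upper_count eta M m).
Proof.
apply: emeasurable_sum_pred => c; apply/measurable_EFinP.
by apply: measurable_indic; exact: measurable_upper_event.
Qed.

Lemma upper_count_ge0 eta M m w : (0 <= upper_count eta M m w)%E.
Proof. by apply: sume_ge0 => c _; rewrite lee_fin. Qed.

Lemma integral_upper_count eta M m : 0 < eta ->
  (\int[P]_w upper_count eta M m w <=
   kappa%:E * (box_integral M + (eta * vol2 R M)%:E + leb4 (bad_set eta M m)))%E.
Proof.
move=> eta0; rewrite ge0_integral_sum_pred; last 2 first.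
- move=> c; apply/measurable_EFinP; apply: measurable_indic.
  exact: measurable_upper_event.
- by move=> c w; rewrite lee_fin.
have up1 (c : pair_index M m) : active c ->
  (\int[P]_w (\1_(upper_event eta c) w)%:E <=
   kappa%:E * (void_prob (inner eta c) * cell_area R m ^+ 2)%:E)%E.
  move=> ac; rewrite integral_indic//; last exact: measurable_upper_event.
  rewrite setIT /upper_event ac -EFinM.
  move: ac => /andP[_ /implyP ij].
  have ij' : i = j -> c.1 != c.2 by move=> /eqP.
  by have [] := cell_event_prob (sel eta c).1.1 (inner_ge0 eta c) ij'.
apply: (le_trans (lee_sum _ up1)).
rewrite -ge0_sume_distrr; last first.
  by move=> c _; rewrite lee_fin mulr_ge0 ?sqr_ge0// void_prob_ge0.
rewrite lee_pmul2l//; last by rewrite lte_fin kappa_gt0.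
apply: cell_sum_le => //.
- by move=> c; rewrite void_prob_ge0 void_prob_le1.
- by move=> c /andP[/asboolPn].
- move=> c ac gc q cq; rewrite /inner; case: asboolP => // _.
  by have [_ [_ /(_ q cq)[]]] := selP gc.
Qed.

Lemma upper_count_card eta M m w : upper_count eta M m w =
  (#|[set c : pair_index M m | active c && (w \in upper_event eta c)]%SET|%:R)%:E.
Proof.
rewrite /upper_count sumEFin -sum1_card natr_sum; congr (_%:E).
rewrite [RHS](eq_bigl (fun c => active c && (w \in upper_event eta c))); last first.
  by move=> c; rewrite inE.
rewrite [RHS]big_mkcondr/=; apply: eq_bigr => c _.
by rewrite indicE; case: (w \in _).
Qed.

Lemma finite_choice_box (A : R -> nat -> Prop) (s : seq R) :
  (forall t, t \in s -> exists M0, forall M, (M0 <= M)%N -> A t M) ->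
  exists M0, forall M, (M0 <= M)%N -> forall t, t \in s -> A t M.
Proof.
elim: s => [|a s IH] H; first by exists 0%N.
have [M1 h1] : exists M0, forall M, (M0 <= M)%N -> forall t, t \in s -> A t M.
  by apply: IH => t ts; apply: H; rewrite inE ts orbT.
have [M2 h2] := H a (mem_head a s).
exists (maxn M1 M2) => M; rewrite geq_max => /andP[k1 k2] t.
by rewrite inE => /orP[/eqP ->|]; [exact: h2|exact: h1].
Qed.

(** Once the mesh separates the stations of types [i] and [j] in a box containing all the heads
    concerned, each handover time selects the cell of its pair. Distinct times select distinct
    cells: equal cells would give equal stations, and [K_uniq] equal times. The void condition holds
    because the pair is nearest. *)
Lemma upper_point w (s : seq R) : (forall l M, exists m, cells_separated v S w l M m) ->
  uniq s -> (forall t, t \in s -> handover_times w t) ->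
  exists M0, forall M, (M0 <= M)%N -> exists m0, forall m eta, (m0 <= m)%N ->
    (((size s)%:R)%:E <= upper_count eta M m w)%E.
Proof.
move=> sep us sH.
pose st t : station R n * station R n := xget (i, ((0, 0), 0), (j, ((0, 0), 0)))
  [set p | [/\ p.1.1 = i, p.2.1 = j, K (shead v p.1, shead v p.2) t &
               handover v (S w) p.1 p.2 t]].
have stP t : t \in s -> [/\ (st t).1.1 = i, (st t).2.1 = j,
    K (shead v (st t).1, shead v (st t).2) t & handover v (S w) (st t).1 (st t).2 t].
  move=> /sH[s1 [s2 h]].
  exact: (@xgetI _ _ [set p : station R n * station R n | [/\ p.1.1 = i, p.2.1 = j, K (shead v p.1, shead v p.2) t &
               handover v (S w) p.1 p.2 t]] (s1, s2)).
have [M0 M0P] : exists M0, forall M, (M0 <= M)%N -> forall t, t \in s ->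
    box2 M (shead v (st t).1, shead v (st t).2).
  apply: finite_choice_box => t ts.
  have [M1 h1] := @box_ex R (shead v (st t).1) (head_ge0 _ _).
  have [M2 h2] := @box_ex R (shead v (st t).2) (head_ge0 _ _).
  exists (maxn M1 M2) => M; rewrite geq_max => /andP[k1 k2].
  by split; [exact: h1|exact: h2].
exists M0 => M MM0; have {MM0} bM := M0P M MM0.
have [mi sepi] := sep i M; have [mj sepj] := sep j M.
exists (maxn mi mj) => m eta; rewrite geq_max => /andP[mim mjm].
case: s us sH stP bM {M0P} => [|t0 s0]; first by move=> *; exact: upper_count_ge0.
set s := t0 :: s0 => us sH stP bM.
have [c0 _] := cell2_ex m (bM t0 (mem_head _ _)).
pose cof t : pair_index M m := xget c0 [set c | cell2 c (shead v (st t).1, shead v (st t).2)].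
have cofP t : t \in s -> cell2 (cof t) (shead v (st t).1, shead v (st t).2).
  by move=> /bM/(cell2_ex m)[c hc]; exact: (@xgetI _ c0 [set c | cell2 c (shead v (st t).1, shead v (st t).2)] c).
have in1 t : t \in s -> stations_in v S i (cell (cof t).1) w (st t).1.
  move=> ts; have [e1 e2 _ [_ [[S1 _] _]]] := stP t ts; have [h1 h2] := cofP t ts.
  by split => //; split => //; move: h1; rewrite /shead e1.
have in2 t : t \in s -> stations_in v S j (cell (cof t).2) w (st t).2.
  move=> ts; have [e1 e2 _ [_ [_ [S1 _]]]] := stP t ts; have [h1 h2] := cofP t ts.
  by split => //; split => //; move: h2; rewrite /shead /= e2.
have u1 := separated_cell sepi mim; have u2 := separated_cell sepj mjm.
rewrite upper_count_card lee_fin ler_nat -(size_map cof) cardE.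
apply: uniq_leq_size.
  rewrite map_inj_in_uniq// => t t' ts t's tt'.
  have E1 : (st t).1 = (st t').1 by apply: (u1 (cof t).1); [exact: in1|rewrite tt'; exact: in1].
  have E2 : (st t).2 = (st t').2 by apply: (u2 (cof t).2); [exact: in2|rewrite tt'; exact: in2].
  have [_ _ k1 _] := stP t ts; have [_ _ k2 _] := stP t' t's.
  by apply: (K_uniq k1); rewrite E1 E2.
move=> c /mapP[t ts ->]; rewrite mem_enum inE.
have [e1 e2 kt [st12 [[S1 near1] [S2 near2]]]] := stP t ts.
have cq := cofP t ts.
have act : active (cof t).
  apply/andP; split; first by apply/asboolPn => vc; exact: (vc _ cq t kt).
  apply/implyP => /eqP ij; apply/negP => /eqP c12; apply: st12.
  by apply: (u1 (cof t).1); [exact: in1|rewrite c12 {1}ij; exact: in2].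
rewrite act/= inE /upper_event act.
have single l (c1 : cell_index M m) s1 :
    (forall x y, stations_in v S l (cell c1) w x -> stations_in v S l (cell c1) w y -> x = y) ->
    stations_in v S l (cell c1) w s1 -> has_card (stations_in v S l (cell c1) w) 1.
  move=> uq h; exists [:: s1]; split => //; split => //.
  apply/seteqP; split => x /=; first by rewrite inE => /eqP ->.
  by move=> /(uq s1 x h) ->; rewrite inE.
split; first by apply: single (in1 t ts) => x y; exact: u1.
split; first by apply: single (in2 t ts) => x y; exact: u2.
move=> l; exists [::]; split => //; split => //.
apply/seteqP; split => // x [Sx [xl [xb _]]]; exfalso.
(* A station in the inner disc would, at the handover time, be strictly nearer than the pair; off
   the good cells the disc is empty. *)
move: xb; rewrite /ball_head/= /inner; case: asboolP => [gc|_]; last by rewrite ltNge bird_ge0.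
have [_ [_ /(_ _ cq)[Dq inn _ _ _]]] := selP gc.
have tq : tau (shead v (st t).1, shead v (st t).2) = t by apply: K_uniq (D_K Dq) kt.
move=> /inn; rewrite tq /handover_radius /= tq => lt.
have := near2 x Sx; rewrite !dist_bird// e2 leNgt => /negP; apply.
by rewrite /shead xl.
Qed.

Definition outer (eta : R) M m (c : pair_index M m) : R := (sel eta c).2.

Definition lower_count eta M m (w : Omega) : \bar R :=
  (#|[set c : pair_index M m | `[< good_cell eta c >] &&
      (w \in cell_event c (sel eta c).1.1 (outer eta c))]%SET|%:R)%:E.

(** On the event of a good cell, the closed disc reaching the meeting point contains no station
    other than the two in the cell, so these two hand over at [tau]. The map from cells to times is
    injective: at a common time both pairs are nearest, hence at the same radius, and the second
    pair is found among the two stations of the first. *)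
Lemma lower_point eta M m w (H : set R) : handover_times w `<=` H ->
  (lower_count eta M m w <=
   \esum_(t in H) (1 : \bar R))%E.
Proof.
move=> wH; rewrite /lower_count; set E := [set c | _]%SET.
pose stw (c : pair_index M m) (p : station R n * station R n) :=
  [/\ S w p.1, S w p.2, p.1.1 = i /\ p.2.1 = j, cell2 c (shead v p.1, shead v p.2) &
   forall x, S w x -> dist v x (tau (shead v p.1, shead v p.2)) <=
                       handover_radius (shead v p.1, shead v p.2) -> x = p.1 \/ x = p.2].
have Est c : c \in E -> exists p, stw c p.
  rewrite inE => /andP[/asboolP gc]; rewrite inE => -[[l1 [_ [L1 s1]]] [[l2 [_ [L2 s2]]] out]].
  case: l1 s1 L1 => // a [|//] _ L1; case: l2 s2 L2 => // b [|//] _ L2.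
  have [Sa [ai ca]] : stations_in v S i (cell c.1) w a by rewrite -L1 /= inE.
  have [Sb [bj cb]] : stations_in v S j (cell c.2) w b by rewrite -L2 /= inE.
  have cq : cell2 c (shead v a, shead v b) by split; rewrite /= /shead ?ai ?bj.
  exists (a, b); split => //= x Sx.
  have [_ [_ /(_ _ cq)[Dq _ outr _ _]]] := selP gc.
  rewrite dist_bird// => /outr xo.
  have [l0 [_ [L0 /size0nil l00]]] := out x.1.
  have nout : ~ stations_in v S x.1 (outside v i j (cell c.1) (cell c.2) (sel eta c).1.1 (outer eta c) x.1) w x.
    by rewrite -L0 l00.
  (* A station of the enlarged disc is in one of the two cells, which hold one station each, or in
     the remainder of the disc, which holds none. *)
  have [|nin] := pselect ([set z | x.1 = i /\ cell c.1 z] (shead v x) \/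
                          [set z | x.1 = j /\ cell c.2 z] (shead v x)).
    case=> -[xi cx]; [left|right].
      have : stations_in v S i (cell c.1) w x by split => //; split => //; move: cx; rewrite /shead xi.
      by rewrite -L1 /= inE => /eqP.
    have : stations_in v S j (cell c.2) w x by split => //; split => //; move: cx; rewrite /shead xi.
    by rewrite -L2 /= inE => /eqP.
  by exfalso; apply: nout; split => //; split.
pose p0 : station R n * station R n := (i, ((0, 0), 0), (j, ((0, 0), 0))).
pose st c := xget p0 (stw c).
have stP c : c \in E -> stw c (st c) by move=> /Est[p hp]; exact: (@xgetI _ _ _ p).
have EK c : c \in E -> K (shead v (st c).1, shead v (st c).2) (tau (shead v (st c).1, shead v (st c).2)).
  move=> cE; have [_ _ _ cq _] := stP c cE.
  move: cE; rewrite inE => /andP[/asboolP gc _]; apply: D_K.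
  by have [_ [_ /(_ _ cq)[]]] := selP gc.
have rad c : c \in E -> let t := tau (shead v (st c).1, shead v (st c).2) in
   dist v (st c).1 t = handover_radius (shead v (st c).1, shead v (st c).2) /\
   dist v (st c).2 t = handover_radius (shead v (st c).1, shead v (st c).2).
  move=> cE t; have [_ _ [e1 e2] _ _] := stP c cE.
  by rewrite !dist_bird// e1 e2 /handover_radius; split => //; exact: (K_bird (EK c cE)).
have ho c : c \in E -> handover v (S w) (st c).1 (st c).2 (tau (shead v (st c).1, shead v (st c).2)).
  move=> cE; have [S1 S2 [e1 e2] cq others] := stP c cE.
  have [r1 r2] := rad c cE.
  have far x : S w x -> handover_radius (shead v (st c).1, shead v (st c).2) <=
     dist v x (tau (shead v (st c).1, shead v (st c).2)).
    move=> Sx; rewrite leNgt; apply/negP => lt.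
    by case: (others x Sx (ltW lt)) => xE; move: lt; rewrite xE ?r1 ?r2 ltxx.
  split; first by move=> E12; have := K_left (EK c cE); rewrite /= E12 ltxx.
  by split; split => // x Sx; rewrite ?r1 ?r2; exact: far.
apply: (@esum1_ge_card R _ _ _ _ (fun c => tau (shead v (st c).1, shead v (st c).2))).
  move=> c cE; apply: wH; exists (st c).1, (st c).2.
  by have [_ _ [e1 e2] _ _] := stP c cE; split => //; [exact: EK|exact: ho].
move=> c c' cE c'E tt'.
have [S1 S2 [e1 e2] cq others] := stP c cE.
have [S1' S2' [e1' e2'] cq' others'] := stP c' c'E.
have [r1 r2] := rad c cE; have [r1' r2'] := rad c' c'E.
have [_ [[_ n1] _]] := ho c cE; have [_ [[_ n1'] _]] := ho c' c'E.
have rr : handover_radius (shead v (st c).1, shead v (st c).2) = handover_radius (shead v (st c').1, shead v (st c').2).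
  apply/le_anti/andP; split.
    by rewrite -r1 -r1' -tt'; exact: n1.
  by rewrite -r1 -r1' tt'; exact: n1'.
have o1 : (st c').1 = (st c).1 \/ (st c').1 = (st c).2.
  by apply: others => //; rewrite tt' r1' rr.
have o2 : (st c').2 = (st c).1 \/ (st c').2 = (st c).2.
  by apply: others => //; rewrite tt' r2' rr.
have k := K_left (EK c cE); have k' := K_left (EK c' c'E).
(* Any other matching of the two pairs contradicts [K_left]: it either reverses the order of the
   head times or makes one station precede itself. *)
have E1 : (st c').1 = (st c).1.
  case: o1 => // o1; case: o2 => o2; move: k k'; rewrite /= o1 o2; last by rewrite ltxx.
  by move=> k k'; have := lt_trans k k'; rewrite ltxx.
have E2 : (st c').2 = (st c).2.
  by case: o2 => // o2; move: k'; rewrite /= E1 o2 ltxx.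
by apply: (@cell2_inj _ _ _ c c' (shead v (st c).1, shead v (st c).2)) => //; rewrite -E1 -E2.
Qed.


Definition half2 : set Q := [set q | 0 <= q.1.2 /\ 0 <= q.2.2].

Lemma measurable_half2 : measurable half2.
Proof.
have -> : half2 = half `*` half by apply/seteqP; split => q [].
by apply: measurableX; exact: measurable_half.
Qed.

Definition handover_integral : \bar R :=
  (\int[leb4]_(q in D `&` half2) handover_density q)%E.

Lemma measurable_density_half2 : measurable_fun (D `&` half2) handover_density.
Proof.
have mvr : measurable_fun D (fun q => void_prob (handover_radius q)).
  exact: measurable_void_radius.
by apply/measurable_EFinP; apply: measurable_funS mvr.
Qed.

Lemma box2_half2 M : box2 M `<=` half2.
Proof. by move=> q [/box_half h1 /box_half h2]. Qed.

Lemma box_integral_le M : (box_integral M <= handover_integral)%E.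
Proof.
apply: ge0_subset_integral.
- by apply: measurableI => //; exact: measurable_box2.
- by apply: measurableI => //; exact: measurable_half2.
- exact: measurable_density_half2.
- by move=> q _; rewrite lee_fin void_prob_ge0.
- by move=> q [Dq /box2_half2 hq].
Qed.

Lemma cvg_box_integral : (fun M => box_integral M) @ \oo --> handover_integral.
Proof.
have DE : D `&` half2 = \bigcup_M (D `&` box2 M).
  apply/seteqP; split => q.
    move=> [Dq [h1 h2]]; have [M1 k1] := box_ex h1; have [M2 k2] := box_ex h2.
    exists (maxn M1 M2) => //; split => //; split.
      by apply: k1; exact: leq_maxl.
    by apply: k2; exact: leq_maxr.
  by move=> [M _ [Dq /box2_half2]].
have mDb M : measurable (D `&` box2 M : set Q).
  by apply: measurableI => //; exact: measurable_box2.
rewrite /handover_integral DE; apply: ge0_nondecreasing_set_cvg_integral => //.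
- move=> M M' MM'; apply/subsetPset => q [Dq [[h1 h2] [h3 h4]]].
  have : M%:R <= M'%:R :> R by rewrite ler_nat.
  by move=> le; split => //; split; split; lra.
- by move=> M; exact: measurable_density_box.
- by move=> M q _; rewrite lee_fin void_prob_ge0.
Qed.

Lemma box_integral_fin M : box_integral M = (fine (box_integral M))%:E.
Proof.
rewrite fineK// ge0_fin_numE; last first.
  by apply: integral_ge0 => q _; rewrite lee_fin void_prob_ge0.
have mDb : measurable (D `&` box2 M : set Q).
  by apply: measurableI => //; exact: measurable_box2.
apply: (@le_lt_trans _ _ (\int[leb4]_(q in D `&` box2 M) (cst 1%E q))%E).
  apply: ge0_le_integral => //.
  - by move=> q _; rewrite lee_fin void_prob_ge0.
  - exact: measurable_density_box.
  - by move=> q _; rewrite lee_fin void_prob_le1.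
rewrite integral_cst// mul1e; apply: (@le_lt_trans _ _ (leb4 (box2 M))).
  by apply: le_measure; rewrite ?inE//; exact: measurable_box2.
by rewrite leb4_box2 ltry.
Qed.

(** The integral of the lower count is a sum of explicit probabilities over good cells, which
    [cell_sum_ge] compares with the box integral. The exponential factor is the loss due to the mass
    of the cells. *)
Lemma lower_bound eta M m (N : \bar R) : 0 < eta ->
  (\int[P]_w lower_count eta M m w <= N)%E ->
  ((expR (- ((mass lam v i + mass lam v j) * cell_area R m)) * kappa)%:E *
    box_integral M <=
   N + (kappa * (eta * vol2 R M))%:E + kappa%:E * leb4 (bad_set eta M m))%E.
Proof.
move=> eta0 GN.
set x := expR _.
have x1 : x <= 1.
  rewrite -expR0 ler_expR oppr_le0; apply: mulr_ge0; last exact: ltW (cell_area_gt0 R m).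
  by apply: ltW; rewrite addr_gt0// mass_gt0.
have x0 : 0 <= x := expR_ge0 _.
have k0 := kappa_gt0.
pose E (c : pair_index M m) := if `[< good_cell eta c >] then
  cell_event c (sel eta c).1.1 (outer eta c) else set0.
(* The two components of a good cell differ: a diagonal pair [(z, z)] would have its head strictly
   to the left of itself. *)
have gd (c : pair_index M m) : good_cell eta c -> 0 <= outer eta c /\ (i = j -> c.1 != c.2).
  move=> gc; have [_ [r0 sw]] := selP gc; split=> // ij; apply/negP => /eqP c12.
  have [z zc] : exists z, @cell R M m c.1 z.
    exists (c.1.1%:R / 2 ^+ m - M%:R, c.1.2%:R / 2 ^+ m).
    by split; rewrite /grid /= ?subrK mulrCA divff ?gt_eqF ?pow2_gt0// mulr1 lexx ltr_nat ltnSn.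
  have [Dq _ _ _ _] : _ := sw (z, z) (conj zc (eq_ind _ (fun c' => cell c' z) zc _ c12)).
  by have := K_left (D_K Dq); rewrite /= ltxx.
have mE c : measurable (E c).
  rewrite /E; case: asboolP => // gc; have [r0 ij] := gd c gc.
  by have [] := cell_event_prob (sel eta c).1.1 r0 ij.
have GE : (\int[P]_w lower_count eta M m w =
   \sum_(c : pair_index M m | `[< good_cell eta c >]) P (E c))%E.
  transitivity (\int[P]_w \sum_(c : pair_index M m | `[< good_cell eta c >]) (\1_(E c) w)%:E)%E.
    apply: eq_integral => w _; rewrite /lower_count sumEFin -sum1_card natr_sum; congr (_%:E).
    rewrite [LHS](eq_bigl (fun c => `[< good_cell eta c >] &&
       (w \in cell_event c (sel eta c).1.1 (outer eta c)))); last first.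
      by move=> c; rewrite inE.
    rewrite [LHS]big_mkcondr/=; apply: eq_bigr => c gc.
    by rewrite indicE /E gc; case: (w \in _).
  rewrite ge0_integral_sum_pred.
  - by apply: eq_bigr => c _; exact: integral_indicT.
  - by move=> c; apply/measurable_EFinP; exact: measurable_indic.
  - by move=> c w; rewrite lee_fin.
have js := @cell_sum_ge R n lam v lam0 j K D tau D_K mD mtau eta M m (fun c => void_prob (outer eta c)) eta0
  (fun c => void_prob_ge0 lam _).
have hr (c : pair_index M m) : good_cell eta c -> forall q, cell2 c q ->
    void_prob (handover_radius q) <= void_prob (outer eta c) + eta.
  by move=> gc q cq; have [_ [_ /(_ q cq)[_ _ _ _ h]]] := selP gc.
move: js => /(_ hr); set s := (\sum_(c | _) _)%E => js.
have sN : ((x * kappa)%:E * s <= N)%E.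
  apply: le_trans GN; rewrite GE /s ge0_sume_distrr; last first.
    by move=> c _; rewrite lee_fin mulr_ge0 ?sqr_ge0// void_prob_ge0.
  apply: lee_sum => c /asboolP gc; have [r0 ij] := gd c gc.
  have [_ _ +] := cell_event_prob (sel eta c).1.1 r0 ij.
  by rewrite /E asboolT// -EFinM -/x mulrA.
apply: (@le_trans _ _ ((x * kappa)%:E * (s + (eta * vol2 R M)%:E + leb4 (bad_set eta M m)))%E).
  by rewrite lee_pmul2l// lte_fin mulr_gt0// expR_gt0.
have vol0 : 0 <= vol2 R M by rewrite sqr_ge0.
rewrite bad_fin; have b0 : 0 <= fine (leb4 (bad_set eta M m)) by exact: fine_ge0.
rewrite -addeA -EFinD muleDr//; last by rewrite fin_num_adde_defl.
rewrite -addeA -EFinM -EFinM -EFinD; apply: leeD => //.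
rewrite lee_fin -mulrDr ler_wpM2r//; first by rewrite addr_ge0// mulr_ge0// ltW.
by rewrite ler_piMl// ltW.
Qed.

End Mecke.

(** * Passage to the limit in the mesh and the box *)

Section MeckeTheorem.
Variables (R : realType) (n : nat) (lam v : 'I_n -> R).
Variables (d : measure_display) (Omega : measurableType d) (P : probability Omega R).
Variable S : Omega -> set (station R n).
Hypothesis lam0 : forall i, 0 < lam i.
Hypothesis v0 : forall i, 0 < v i.
Hypothesis PPP : marked_PPP P lam S.
Local Notation Q := ((R * R) * (R * R))%type.
Local Notation leb4 := (@leb4 R).

Variables (i j : 'I_n) (K : Q -> R -> Prop) (D Z : set Q) (tau : Q -> R).
Hypothesis K_uniq : forall q t t', K q t -> K q t' -> t = t'.
Hypothesis K_bird : forall q t, K q t -> bird (v i) q.1 t = bird (v j) q.2 t.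
Hypothesis K_left : forall q t, K q t -> q.1.1 < q.2.1.
Hypothesis D_K : forall q, D q -> K q (tau q).
Hypothesis D_open : forall q, D q -> \forall q' \near q, D q'.
Hypothesis D_cont : forall q, D q -> {for q, continuous tau}.
Hypothesis D_ext : forall q, ~ D q -> ~ Z q -> \forall q' \near q, forall t, ~ K q' t.
Hypothesis mD : measurable D.
Hypothesis mtau : measurable_fun D tau.
Hypothesis mZ : measurable Z.
Hypothesis Z0 : leb4 Z = 0%E.


Local Notation handover_times := (handover_times v S i j K).
Local Notation handover_integral := (handover_integral lam v j D tau).
Local Notation bad_set := (bad_set lam v j K D tau).
Local Notation box_integral := (box_integral lam v j D tau).
Local Notation kappa := (mass lam v i * mass lam v j).


(** [H] is sandwiched by [handover_times] so that the set of the definition can be used as it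
    stands. The first inclusion is for every [w]; the second may assume that a type and a head
    determine the station, which is almost sure. *)
Theorem mecke (H : Omega -> set R) :
  (forall w, handover_times w `<=` H w `&` `[0%R, 1%R[%classic) ->
  (forall w, (forall s s', S w s -> S w s' -> s.1 = s'.1 -> shead v s = shead v s' -> s = s') ->
     H w `&` `[0%R, 1%R[%classic `<=` handover_times w) ->
  (intensity P H = kappa%:E * handover_integral)%E.
Proof.
move=> lowH upH; have k0 := kappa_gt0 lam0 v0 i j.
pose N w : \bar R := (\esum_(t in H w `&` `[0%R, 1%R[%classic) 1)%E.
have N0 w : (0 <= N w)%E by apply: esum_ge0.
have J0 : (0 <= handover_integral)%E.
  by apply: integral_ge0 => q _; rewrite lee_fin void_prob_ge0.
have vol0 M : 0 <= vol2 R M by rewrite sqr_ge0.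
apply/le_anti/andP; split; last first.
  have : (0 <= intensity P H)%E by apply: integral_ge0 => w _; exact: N0.
  case EN: (intensity P H) => [y| |]// _; last by rewrite leey.
  have bound M : (kappa%:E * box_integral M <= y%:E)%E.
    rewrite box_integral_fin//; set b := fine _.
    rewrite -EFinM lee_fin; apply/ler_addgt0Pr => e e0.
    (* Chosen so that the error [kappa eta vol2] is at most [e]; the added 1 covers [M = 0], where
       the volume vanishes. *)
    pose eta := e / (kappa * (vol2 R M + 1)).
    have den0 : 0 < kappa * (vol2 R M + 1) by rewrite mulr_gt0// ltr_wpDl.
    have eta0 : 0 < eta by rewrite divr_gt0.
    have etae : kappa * (eta * vol2 R M) <= e.
      rewrite /eta; have -> : kappa * (e / (kappa * (vol2 R M + 1)) * vol2 R M) =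
          e * (vol2 R M / (vol2 R M + 1)).
        by field; rewrite !gt_eqF// ?mass_gt0// ltr_wpDl.
      have vp : 0 < vol2 R M + 1 by rewrite ltr_wpDl.
      by rewrite ler_piMr ?(ltW e0)// ler_pdivrMr// mul1r lerDl.
    apply: (@le_trans _ _ (y + kappa * (eta * vol2 R M) + kappa * 0)); last first.
      by rewrite mulr0 addr0 lerD2l.
    have -> : kappa * b = expR (- ((mass lam v i + mass lam v j) * 0)) * (kappa * b).
      by rewrite mulr0 oppr0 expR0 mul1r.
    pose B m := fine (leb4 (bad_set eta M m)).
    have cB : B @ \oo --> (0 : R).
      have cb : (fun m => leb4 (bad_set eta M m)) @ \oo --> (0 : \bar R).
        exact: (cvg_bad lam v0 j D_open D_cont D_ext mZ Z0 M eta0).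
      exact: (fine_cvg cb).
    have carea : (fun m => cell_area R m) @ \oo --> (0 : R).
      rewrite /cell_area -[X in _ --> X](expr0n R 2).
      apply: (@cvg_comp _ _ _ _ (fun y : R => y ^+ 2)) (@cvg_pow2V R) _.
      exact: exprn_continuous.
    have cf : (fun m => expR (- ((mass lam v i + mass lam v j) * cell_area R m)) * (kappa * b)) @ \oo -->
        expR (- ((mass lam v i + mass lam v j) * 0)) * (kappa * b).
      apply: cvgM; last exact: cvg_cst.
      apply: (@cvg_comp _ _ _ _ expR); last exact: continuous_expR.
      by apply: cvgN; apply: cvgM; first exact: cvg_cst.
    have cg : (fun m => y + kappa * (eta * vol2 R M) + kappa * B m) @ \oo -->
        y + kappa * (eta * vol2 R M) + kappa * 0.
      by apply: cvgD; [exact: cvg_cst|apply: cvgM => //; exact: cvg_cst].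
    apply: (ler_cvg_to cf cg); near=> m.
    have low : (\int[P]_w lower_count lam v S i j D tau eta M m w <= y%:E)%E.
      rewrite -EN; apply: le_lower_integral => w; first by rewrite lee_fin.
      exact: (lower_point lam v0 K_bird K_left D_K eta M m (lowH w)).
    have := lower_bound lam0 v0 PPP K_left D_K mD mtau eta0 low.
    rewrite box_integral_fin// bad_fin -!EFinM -!EFinD lee_fin -/b -/(B m).
    by rewrite -[X in X <= _ -> _]mulrA.
  have : (fun M => kappa%:E * box_integral M)%E @ \oo --> (kappa%:E * handover_integral)%E.
    by apply: cvgeZl => //; exact: cvg_box_integral.
  move=> cv; have <- := cvg_lim _ cv => //.
  apply: lime_le; first by apply/cvg_ex; eexists; exact: cv.
  by apply: nearW => M; exact: bound.
(* If the integral is infinite the upper bound is trivial, since [kappa > 0]. *)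
case EJ: handover_integral J0 => [x| |]// J0; last by rewrite gt0_muley ?lte_fin ?leey.
have [A mA [A0 Asep]] := separated_ae lam0 v0 PPP.
(* Tolerance tied to the box, so that [eta_ M] times its volume is at most [1 / (M + 1)] and
   vanishes in the limit. *)
pose eta_ (M : nat) : R := (M.+1%:R * (vol2 R M + 1))^-1.
have eta0 M : 0 < eta_ M by rewrite invr_gt0 mulr_gt0// ?ltr0n// ltr_wpDl.
pose up := upper_count lam v S i j K D tau.
have mup eta M m : measurable_fun setT (up eta M m) by exact: (measurable_upper_count lam0 v0 PPP i j K D tau eta M m).
pose G M w := limn_einf (fun m => up (eta_ M) M m w).
have mG M : measurable_fun setT (G M) by apply: measurable_fun_limn_einf.
have up0 eta M m w : (0 <= up eta M m w)%E by exact: (upper_count_ge0 lam v S i j K D tau).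
have G0 M w : (0 <= G M w)%E by apply: (@limn_einf_ge _ _ _ 0%N).
(* The measurable majorant: for every finite list of handover times, the upper counts eventually
   reach its length, first along [m] and then along [M]. Fatou is applied once to each lower
   limit. *)
pose F w := limn_einf (fun M => G M w).
have F0 w : (0 <= F w)%E by apply: (@limn_einf_ge _ _ _ 0%N).
have mF : measurable_fun setT F by apply: measurable_fun_limn_einf.
apply: (@le_trans _ _ (\int[P]_w F w)%E).
  apply: (lower_integral_le (A := A)) => // w Aw.
  apply: esum1_le => s us sH.
  have sep := Asep w Aw.
  have [M0 M0P] : exists M0, forall M, (M0 <= M)%N -> exists m0, forall m eta, (m0 <= m)%N ->
    (((size s)%:R)%:E <= up eta M m w)%E.
    apply: (upper_point lam v0 K_uniq D_K sep us) => t /sH.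
    by apply: upH => *; exact: (separated_head sep).
  apply: (@limn_einf_ge _ _ _ M0) => M /M0P[m0 m0P].
  by apply: (@limn_einf_ge _ _ _ m0) => m mm0; exact: m0P.
apply: (le_trans (fatou _ measurableT mG (fun M w _ => G0 M w))).
apply: (@limn_einf_le _ _ (fun M => (kappa * (x + M.+1%:R^-1))%:E)); last first.
  apply: cvg_EFin; first by near=> M.
  rewrite -[X in _ --> kappa * X]addr0; apply: cvgM; first exact: cvg_cst.
  by apply: cvgD; [exact: cvg_cst|exact: cvg_harmonic].
move=> M; apply: (le_trans (fatou _ measurableT (mup (eta_ M) M) (fun m w _ => up0 _ M m w))).
apply: (@le_trans _ _ (kappa%:E * (box_integral M + (eta_ M * vol2 R M)%:E + 0))%E).
  apply: (@limn_einf_le _ _ (fun m => (kappa%:E * (box_integral M + (eta_ M * vol2 R M)%:E + leb4 (bad_set (eta_ M) M m)))%E)).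
    by move=> m; exact: (integral_upper_count lam0 v0 PPP i j K mD mtau M m (eta0 M)).
  apply: cvgeZl => //; apply: cvgeD.
  - by rewrite box_integral_fin.
  - exact: cvg_cst.
  - exact: (cvg_bad lam v0 j D_open D_cont D_ext mZ Z0 M (eta0 M)).
have bx : (box_integral M <= x%:E)%E by rewrite -EJ; exact: (box_integral_le lam v j mD mtau M).
rewrite [leRHS]EFinM lee_pmul2l ?lte_fin// adde0 EFinD leeD// lee_fin.
rewrite /eta_ invfM -mulrA ler_piMr ?invr_ge0 ?ler0n// mulrC ler_pdivrMr ?ltr_wpDl//.
by rewrite mul1r lerDl.
Unshelve. all: by end_near. Qed.

End MeckeTheorem.

(** * Null sets with finite sections *)

Section NullSections.
Variable R : realType.
Local Notation leb := (@lebesgue_measure R).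
Local Notation leb4 := (@leb4 R).
Local Notation Q := ((R * R) * (R * R))%type.

Lemma leb_seq0 (s : seq R) (A : set R) : (forall x, A x -> x \in s) -> measurable A ->
  leb A = 0%E.
Proof.
move=> As mA; apply/eqP; rewrite -measure_le0.
have fs : finite_set [set` s] by exact: finite_seq.
have cs : countable [set` s] by exact: finite_set_countable.
rewrite -(countable_lebesgue_measure0 cs).
apply: le_measure; rewrite ?inE//.
by apply: countable_measurable.
Qed.

(** Tonelli with the time of the first head integrated innermost: a finite section has length 0,
    which kills all the outer integrals. *)
Lemma leb4_null_sections (Z : set Q) : measurable Z ->
  (forall h z, exists s : seq R, forall T, Z ((T, h), z) -> T \in s) -> leb4 Z = 0%E.
Proof.
move=> mZ sZ; rewrite -integral_indicT//.
have m1 : measurable_fun setT (fun q : Q => (\1_Z q)%:E : \bar R).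
  by apply/measurable_EFinP; exact: measurable_indic.
rewrite leb4_tonelli2//.
apply: integral0_eq => z _.
have mz : measurable_fun setT (fun x : R * R => (\1_Z (x, z))%:E : \bar R).
  by apply: (measurableT_comp m1); exact: measurable_fun_pair.
rewrite leb2_tonelli2//.
apply: integral0_eq => h _.
have [s sP] := sZ h z.
have mT : measurable [set T : R | Z ((T, h), z)].
  rewrite -[X in measurable X]setTI.
  have mm : measurable_fun setT (fun T : R => ((T, h), z) : Q).
    by apply: measurable_fun_pair => //; exact: measurable_fun_pair.
  exact: mm.
by rewrite -(leb_seq0 sP mT) -integral_indicT.
Qed.

Lemma quadratic_seq (a b c : R) : 0 < a ->
  exists s : seq R, forall T, a * (T - b) ^+ 2 = c -> T \in s.
Proof.
move=> a0; exists [:: b - Num.sqrt (c / a); b + Num.sqrt (c / a)] => T <-.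
rewrite mulrC mulKf ?gt_eqF// sqrtr_sqr !inE.
by case: (ger0P (T - b)) => _; apply/orP; [right|left]; apply/eqP; ring.
Qed.

End NullSections.

(** * Finite cardinalities under translation *)

Section HasCard.

Lemma has_card_map (T U : eqType) (f : T -> U) (A : set T) c : injective f ->
  has_card A c -> has_card (f @` A) c.
Proof.
move=> fi [l [ul [lA sl]]]; exists (map f l); rewrite map_inj_uniq// size_map.
split => //; split => //; apply/seteqP; split => x /=.
  by move=> /mapP[y yl ->]; exists y => //; rewrite -lA.
by move=> [y Ay <-]; apply: map_f; move: Ay; rewrite -lA.
Qed.

Lemma has_card_shift (R : realType) (p : R -> Prop) (b : R) c :
  has_card [set u | p (u - b)] c <-> has_card [set u | p u] c.
Proof.
split => h.
  have -> : [set u | p u] = (fun u => u - b) @` [set u | p (u - b)].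
    apply/seteqP; split => u /=; last by move=> [x px <-].
    by move=> pu; exists (u + b); rewrite ?addrK.
  by apply: has_card_map => // x y /addIr.
have -> : [set u | p (u - b)] = (fun u => u + b) @` [set u | p u].
  apply/seteqP; split => u /=; last by move=> [x px <-]; rewrite addrK.
  by move=> pu; exists (u - b); rewrite ?subrK.
by apply: has_card_map => // x y /addIr.
Qed.

End HasCard.

Section NearContinuous.
Variables (R : realType) (T : topologicalType).

Lemma near_continuous_gt (f : T -> R) q a : {for q, continuous f} -> a < f q ->
  \forall q' \near q, a < f q'.
Proof. by move=> cf af; exact: (cf [set x | a < x] (lt_nbhsr af)). Qed.

Lemma near_continuous_lt (f : T -> R) q a : {for q, continuous f} -> f q < a ->
  \forall q' \near q, f q' < a.
Proof. by move=> cf af; exact: (cf [set x | x < a] (lt_nbhsl af)). Qed.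

End NearContinuous.

(** * Intersections of two birds *)

Section Intersections.
(** Setting common to equal and different speeds: for a positive lag between the heads, [del > 0]
    means that the [k]-th meeting exists, at time [U] after the right head, and [del < 0] that the
    birds do not meet. *)
Variables (R : realType) (w1 w2 : R) (k : nat) (del U : (R * R) * R -> R).
Local Notation leb4 := (@leb4 R).
Local Notation Q := ((R * R) * (R * R))%type.
Local Notation R3 := ((R * R) * R)%type.
Hypothesis w1_gt0 : 0 < w1.
Hypothesis mdel : measurable_fun setT del.
Hypothesis cdel : continuous del.
Hypothesis mU : measurable_fun setT U.
Hypothesis cU : forall p, 0 < p.1.1 -> 0 < del p -> {for p, continuous U}.

(* Birds with heads (-t, h) and (0, h'), i.e. in the time frame of the right head. *)
Definition meet (p : R3) (s : R) : Prop := bird w1 (- p.1.1, p.1.2) s = bird w2 (0, p.2) s.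

Definition kth_meet (p : R3) (s : R) : Prop :=
  meet p s /\ has_card [set u | u < s /\ meet p u] k.-1.

Hypothesis U_meet : forall p, 0 < p.1.1 -> 0 < del p -> forall s, kth_meet p s <-> s = U p.
Hypothesis no_meet : forall p, 0 < p.1.1 -> del p < 0 -> forall s, ~ meet p s.
Hypothesis del_null : forall h h', exists s : seq R, forall t, del ((t, h), h') = 0 -> t \in s.

Definition rel_coord (q : Q) : R3 := ((q.2.1 - q.1.1, q.1.2), q.2.2).

Definition kth_time (q : Q) (t : R) : Prop :=
  [/\ q.1.1 < q.2.1, 0 <= t < 1, bird w1 q.1 t = bird w2 q.2 t &
   has_card [set u | u < t /\ bird w1 q.1 u = bird w2 q.2 u] k.-1].

Definition meet_time (q : Q) : R := q.2.1 + U (rel_coord q).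

Definition proper_meet : set Q :=
  [set q | [/\ q.1.1 < q.2.1, 0 < del (rel_coord q), 0 < meet_time q & meet_time q < 1]].

(** The equality cases of the strict inequalities in [proper_meet]: simultaneous heads, [del = 0],
    and a meeting at an end of the window. The ends 0 and 1 are expressed through birds, which gives
    polynomial equations in the head time. *)
Definition degenerate_meet : set Q :=
  [set q | [\/ q.1.1 = q.2.1, del (rel_coord q) = 0,
     bird w1 q.1 0 = bird w2 q.2 0 | bird w1 q.1 1 = bird w2 q.2 1]].

Lemma meet_rel q t : bird w1 q.1 t = bird w2 q.2 t <-> meet (rel_coord q) (t - q.2.1).
Proof.
rewrite /meet !bird_eq /=.
have -> : t - q.2.1 - - (q.2.1 - q.1.1) = t - q.1.1 by ring.
by rewrite subr0.
Qed.

Lemma kth_time_rel q t : kth_time q t <->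
  [/\ q.1.1 < q.2.1, 0 <= t < 1 & kth_meet (rel_coord q) (t - q.2.1)].
Proof.
have E : [set u | u < t /\ bird w1 q.1 u = bird w2 q.2 u] =
  [set u | (fun x => x < t - q.2.1 /\ meet (rel_coord q) x) (u - q.2.1)].
  by apply/seteqP; split => u /=; rewrite ltrD2r => -[? /meet_rel].
split.
  move=> [h1 h2 h3 h4]; split => //; split; first exact/meet_rel.
  by move: h4; rewrite E => /(@has_card_shift _ (fun x => x < t - q.2.1 /\ meet (rel_coord q) x)).
move=> [h1 h2 [h3 h4]]; split => //; first exact/meet_rel.
by rewrite E; apply/(@has_card_shift _ (fun x => x < t - q.2.1 /\ meet (rel_coord q) x)).
Qed.

Lemma rel_gt0 q : q.1.1 < q.2.1 -> 0 < (rel_coord q).1.1.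
Proof. by rewrite subr_gt0. Qed.

Lemma kth_timeE q t : 0 < del (rel_coord q) -> kth_time q t <->
  [/\ q.1.1 < q.2.1, 0 <= t < 1 & t = meet_time q].
Proof.
move=> d0; rewrite kth_time_rel; split => -[h1 h2 h3]; split => //.
  by move/(U_meet (rel_gt0 h1) d0): h3; rewrite /meet_time => <-; ring.
by apply/(U_meet (rel_gt0 h1) d0); rewrite h3 /meet_time; ring.
Qed.

Lemma continuous_rel_coord : continuous rel_coord.
Proof.
move=> q.
have c1 : (fun q' : Q => q'.2.1 - q'.1.1) x @[x --> q] --> q.2.1 - q.1.1.
  by apply: cvgB; [exact: continuous_coord21|exact: continuous_coord11].
have c2 : (fun q' : Q => q'.1.2) x @[x --> q] --> q.1.2 by exact: continuous_coord12.
have c3 : (fun q' : Q => q'.2.2) x @[x --> q] --> q.2.2 by exact: continuous_coord22.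
exact: (cvg_pair (cvg_pair c1 c2) c3).
Qed.

Lemma measurable_rel_coord : measurable_fun setT rel_coord.
Proof.
have m21 : measurable_fun setT (fun q : Q => q.2.1) by exact: measurableT_comp.
have m11 : measurable_fun setT (fun q : Q => q.1.1) by exact: measurableT_comp.
have m12 : measurable_fun setT (fun q : Q => q.1.2) by exact: measurableT_comp.
have m22 : measurable_fun setT (fun q : Q => q.2.2) by exact: measurableT_comp.
apply: measurable_fun_pair => //; apply: measurable_fun_pair => //.
exact: measurable_funB.
Qed.

Lemma measurable_meet_time : measurable_fun setT meet_time.
Proof.
apply: measurable_funD; first exact: measurableT_comp.
exact: measurableT_comp measurable_rel_coord.
Qed.

Lemma continuous_meet_time q : q.1.1 < q.2.1 -> 0 < del (rel_coord q) ->
  {for q, continuous meet_time}.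
Proof.
move=> h d0; apply: cvgD; first exact: continuous_coord21.
apply: (@continuous_comp _ _ _ rel_coord U); first exact: continuous_rel_coord.
by apply: cU => //; exact: rel_gt0.
Qed.

Lemma near_left (q : Q) : q.1.1 < q.2.1 -> \forall q' \near q, q'.1.1 < q'.2.1.
Proof.
move=> h.
have c : {for q, continuous (fun q : Q => q.2.1 - q.1.1)}.
  by apply: cvgB; [exact: continuous_coord21|exact: continuous_coord11].
have h0 : 0 < q.2.1 - q.1.1 by rewrite subr_gt0.
have h2 : \forall q' \near q, 0 < q'.2.1 - q'.1.1 by exact: (near_continuous_gt c).
by near=> q'; rewrite -subr_gt0; near: q'.
Unshelve. all: by end_near. Qed.

Lemma near_right (q : Q) : q.2.1 < q.1.1 -> \forall q' \near q, q'.2.1 < q'.1.1.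
Proof.
move=> h.
have c : {for q, continuous (fun q : Q => q.1.1 - q.2.1)}.
  by apply: cvgB; [exact: continuous_coord11|exact: continuous_coord21].
have h0 : 0 < q.1.1 - q.2.1 by rewrite subr_gt0.
have h2 : \forall q' \near q, 0 < q'.1.1 - q'.2.1 by exact: (near_continuous_gt c).
by near=> q'; rewrite -subr_gt0; near: q'.
Unshelve. all: by end_near. Qed.

Let cdr (q : Q) : {for q, continuous (fun q : Q => del (rel_coord q))}.
Proof. by apply: continuous_comp; [exact: continuous_rel_coord|exact: cdel]. Qed.

Lemma near_del_gt0 q : 0 < del (rel_coord q) -> \forall q' \near q, 0 < del (rel_coord q').
Proof. exact: near_continuous_gt. Qed.

Lemma near_del_lt0 q : del (rel_coord q) < 0 -> \forall q' \near q, del (rel_coord q') < 0.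
Proof. exact: near_continuous_lt. Qed.

Lemma near_time_gt (q : Q) a : q.1.1 < q.2.1 -> 0 < del (rel_coord q) -> a < meet_time q ->
  \forall q' \near q, a < meet_time q'.
Proof. by move=> h d0 m; exact: near_continuous_gt (continuous_meet_time h d0) m. Qed.

Lemma near_time_lt (q : Q) a : q.1.1 < q.2.1 -> 0 < del (rel_coord q) -> meet_time q < a ->
  \forall q' \near q, meet_time q' < a.
Proof. by move=> h d0 m; exact: near_continuous_lt (continuous_meet_time h d0) m. Qed.

Lemma proper_open q : proper_meet q -> \forall q' \near q, proper_meet q'.
Proof.
move=> [h d0 t0 t1].
near=> q'; split.
- by near: q'; exact: near_left.
- by near: q'; exact: near_del_gt0.
- by near: q'; exact: near_time_gt.
- by near: q'; exact: near_time_lt.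
Unshelve. all: by end_near. Qed.

(** Away from the equality cases, one of four open conditions holds: reversed heads, negative [del],
    meeting time below 0, or meeting time above 1. Each persists nearby and rules out a meeting in
    the window. *)
Lemma proper_ext q : ~ proper_meet q -> ~ degenerate_meet q ->
  \forall q' \near q, forall t, ~ kth_time q' t.
Proof.
move=> np nd; case: (ltgtP q.1.1 q.2.1) => h; last by exfalso; apply: nd; constructor 1.
- case: (ltgtP (del (rel_coord q)) 0) => d0; last by exfalso; apply: nd; constructor 2.
    near=> q'; move=> t /kth_time_rel[h' _ [m _]].
    apply: (no_meet (rel_gt0 h') _ m).
    by near: q'; exact: near_del_lt0.
  have [_ out] : kth_meet (rel_coord q) (U (rel_coord q)) /\ (meet_time q < 0 \/ 1 < meet_time q).
    have km : kth_meet (rel_coord q) (U (rel_coord q)) by apply/(U_meet (rel_gt0 h) d0).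
    split => //.
    have mt : bird w1 q.1 (meet_time q) = bird w2 q.2 (meet_time q).
      by apply/meet_rel; rewrite /meet_time addrC addKr; case: km.
    case: (ltgtP (meet_time q) 0) => t0; first by left.
      case: (ltgtP (meet_time q) 1) => t1; first by exfalso; apply: np.
        by right.
      by exfalso; apply: nd; constructor 4; rewrite -t1.
    by exfalso; apply: nd; constructor 3; rewrite -t0.
  have out' : \forall q' \near q, meet_time q' < 0 \/ 1 < meet_time q'.
    case: out => [t0|t1].
      by near=> q'; left; near: q'; exact: near_time_lt.
    by near=> q'; right; near: q'; exact: near_time_gt.
  near=> q'; move=> t /kth_timeE[|_ t01 tE]; first by near: q'; exact: near_del_gt0.
  have : meet_time q' < 0 \/ 1 < meet_time q' by near: q'.
  by rewrite -tE; move: t01; lra.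
- near=> q'; move=> t [h' _ _ _].
  have : q'.2.1 < q'.1.1 by near: q'; exact: near_right.
  by move=> h2; have := lt_trans h' h2; rewrite ltxx.
Unshelve. all: by end_near. Qed.

Lemma measurable_proper : measurable proper_meet.
Proof.
have -> : proper_meet = [set q | q.1.1 < q.2.1] `&` [set q | 0 < del (rel_coord q)] `&`
   [set q | 0 < meet_time q] `&` [set q | meet_time q < 1].
  apply/seteqP; split => q; first by move=> [].
  by move=> [[[]]].
have m21 : measurable_fun setT (fun q : Q => q.2.1) by exact: measurableT_comp.
have m11 : measurable_fun setT (fun q : Q => q.1.1) by exact: measurableT_comp.
have mdr : measurable_fun setT (fun q => del (rel_coord q)).
  exact: measurableT_comp measurable_rel_coord.
have mt := measurable_meet_time.
by do 3 (apply: measurableI; last exact: measurable_set_lt); exact: measurable_set_lt.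
Qed.

Lemma measurable_set_eq d (T : measurableType d) (f g : T -> R) :
  measurable_fun setT f -> measurable_fun setT g -> measurable [set x | f x = g x].
Proof.
move=> mf mg; have -> : [set x | f x = g x] = [set x | f x <= g x] `&` [set x | g x <= f x].
  by apply/seteqP; split => x /= => [->//|[h1 h2]]; apply/le_anti/andP.
by apply: measurableI; exact: measurable_set_le.
Qed.

Lemma measurable_degenerate : measurable degenerate_meet.
Proof.
have -> : degenerate_meet = [set q | q.1.1 = q.2.1] `|` [set q | del (rel_coord q) = 0] `|`
   [set q | bird w1 q.1 0 = bird w2 q.2 0] `|` [set q | bird w1 q.1 1 = bird w2 q.2 1].
  apply/seteqP; split => q.
    by case=> h; [left; left; left|left; left; right|left; right|right].
  by case=> [[[h|h]|h]|h]; [constructor 1|constructor 2|constructor 3|constructor 4].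
have m21 : measurable_fun setT (fun q : Q => q.2.1) by exact: measurableT_comp.
have m11 : measurable_fun setT (fun q : Q => q.1.1) by exact: measurableT_comp.
have mdr : measurable_fun setT (fun q => del (rel_coord q)).
  exact: measurableT_comp measurable_rel_coord.
have mb1 t : measurable_fun setT (fun q : Q => bird w1 q.1 t).
  by apply: (measurableT_comp (measurable_bird w1 t)).
have mb2 t : measurable_fun setT (fun q : Q => bird w2 q.2 t).
  by apply: (measurableT_comp (measurable_bird w2 t)).
by do 3 (apply: measurableU; last exact: measurable_set_eq); exact: measurable_set_eq.
Qed.

(** With all other coordinates fixed, each of the four equalities leaves finitely many times for the
    left head; the two at the window ends are quadratic with leading coefficient [w1^2]. *)
Lemma degenerate_null : leb4 degenerate_meet = 0%E.
Proof.
apply: leb4_null_sections; first exact: measurable_degenerate.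
move=> h [T' h']; have [s0 s0P] := del_null h h'.
have w2p : 0 < w1 ^+ 2 by rewrite exprn_gt0.
have [s1 s1P] := @quadratic_seq R (w1 ^+ 2) 0 (w2 ^+ 2 * (0 - T') ^+ 2 + h' ^+ 2 - h ^+ 2) w2p.
have [s2 s2P] := @quadratic_seq R (w1 ^+ 2) 1 (w2 ^+ 2 * (1 - T') ^+ 2 + h' ^+ 2 - h ^+ 2) w2p.
exists (T' :: [seq T' - t | t <- s0] ++ s1 ++ s2) => T.
rewrite inE !mem_cat /degenerate_meet /= => -[->|d0|/bird_eq /= e|/bird_eq /= e].
- by rewrite eqxx.
- apply/orP; right; apply/orP; left; apply/mapP; exists (T' - T); first exact: s0P.
  by ring.
- do 2 (apply/orP; right); apply/orP; left; apply: s1P.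
  by rewrite -e; ring.
- do 3 (apply/orP; right); apply: s2P.
  by rewrite -e; ring.
Qed.

Lemma proper_kth q : proper_meet q -> kth_time q (meet_time q).
Proof.
move=> [h d0 t0 t1]; apply/(kth_timeE _ d0); split => //.
by rewrite (ltW t0).
Qed.

End Intersections.

(** * Reduction to a triple integral *)

Section IteratedIntegral.
Variables (R : realType) (del U : (R * R) * R -> R) (w Lam : R).
Local Notation leb := (@lebesgue_measure R).
Local Notation leb2 := (@leb2 R).
Local Notation leb4 := (@leb4 R).
Local Notation Q := ((R * R) * (R * R))%type.
Local Notation R3 := ((R * R) * R)%type.
Hypothesis mdel : measurable_fun setT del.
Hypothesis mU : measurable_fun setT U.

(** [U] is measured from the right head, so [w^2 U^2 + p.2^2] is the squared height of the meeting
    point on the right bird. *)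
Definition rel_density (p : R3) : R := expR (- (Lam * (w ^+ 2 * U p ^+ 2 + p.2 ^+ 2))).

Definition rel_domain : set R3 := [set p | [/\ 0 <= p.1.2, 0 <= p.2, 0 < p.1.1 & 0 < del p]].

Definition rel_patch : R3 -> \bar R := (EFin \o rel_density) \_ rel_domain.
Local Notation G := rel_patch.

Lemma measurable_rel_domain : measurable rel_domain.
Proof.
have -> : rel_domain = [set p : R3 | 0 <= p.1.2] `&` [set p | 0 <= p.2] `&`
   [set p | 0 < p.1.1] `&` [set p | 0 < del p].
  apply/seteqP; split => q; first by move=> [].
  by move=> [[[]]].
have m12 : measurable_fun setT (fun p : R3 => p.1.2) by exact: measurableT_comp.
have m11 : measurable_fun setT (fun p : R3 => p.1.1) by exact: measurableT_comp.
apply: measurableI; last exact: measurable_set_lt.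
apply: measurableI; last exact: measurable_set_lt.
by apply: measurableI; exact: measurable_set_le.
Qed.

Lemma measurable_rel_density : measurable_fun setT rel_density.
Proof.
apply: (measurableT_comp (@measurable_expR R)); apply: measurable_funN.
apply: measurable_funM => //; apply: measurable_funD; last exact: measurable_funX.
by apply: measurable_funM => //; exact: measurable_funX.
Qed.

Lemma measurable_rel_patch : measurable_fun setT G.
Proof.
apply/(measurable_restrictT _ _).1; first exact: measurable_rel_domain.
apply/measurable_EFinP; apply: measurable_funTS; exact: measurable_rel_density.
Qed.

Lemma rel_patch_ge0 p : (0 <= G p)%E.
Proof. by rewrite /rel_patch /patch; case: ifP => //= _; rewrite lee_fin expR_ge0. Qed.

Let unit_ind (s : R) : \bar R := (\1_(`]0%R, 1%R[%classic) s)%:E.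

Let mui : measurable_fun setT unit_ind.
Proof. by apply/measurable_EFinP; exact: measurable_indic. Qed.

Let ui0 s : (0 <= unit_ind s)%E.
Proof. by rewrite lee_fin. Qed.

Let mG := measurable_rel_patch.
Let G0 := rel_patch_ge0.

Lemma ge0_integral_reflect (b : R) (f : R * R -> \bar R) : measurable_fun setT f ->
  (forall x, 0 <= f x)%E -> (\int[leb2]_z f ((b - z.1)%R, z.2) = \int[leb2]_z f z)%E.
Proof.
move=> mf f0.
have mfb : measurable_fun setT (fun z : R * R => f (b - z.1, z.2)).
  by apply: (measurableT_comp mf); apply: measurable_fun_pair => //; exact: measurable_funB.
rewrite leb2_tonelli2// [RHS]leb2_tonelli2//; apply: eq_integral => h _.
have mfh : measurable_fun setT (fun x : R => f (x, h)).
  by apply: (measurableT_comp mf); exact: measurable_fun_pair.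
have n1 : -1 != 0 :> R by rewrite oppr_eq0 oner_eq0.
have := ge0_integral_affine b n1 mfh (fun x => f0 _).
rewrite normrN1 invr1 mul1e => <-; apply: eq_integral => x _.
by rewrite mulN1r addrC.
Qed.

(** Everything but the window depends only on the lag and the two heights. Once the left head time
    is replaced by the lag, the right head time enters through the window alone and runs over an
    interval of length 1. *)
Lemma relative_integral :
  (\int[leb4]_q (G (rel_coord q) * unit_ind (q.2.1 + U (rel_coord q))%R) =
   \int[leb]_h' \int[leb]_h \int[leb]_t G ((t, h), h'))%E.
Proof.
have mrc := @measurable_rel_coord R.
have m21 : measurable_fun setT (fun q : Q => q.2.1) by exact: measurableT_comp.
have m22 : measurable_fun setT (fun q : Q => q.2.2) by exact: measurableT_comp.
pose kk (z z' : R * R) : \bar R := (G (z, z'.2) * unit_ind (z'.1 + U (z, z'.2))%R)%E.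
have kk0 z z' : (0 <= kk z z')%E by rewrite mule_ge0.
have mz2 : measurable_fun setT (fun q : Q => (q.1, q.2.2) : R3).
  by apply: measurable_fun_pair.
have mkk : measurable_fun setT (fun q : Q => kk q.1 q.2).
  apply: emeasurable_funM; first exact: (measurableT_comp mG).
  apply: (measurableT_comp mui); apply: measurable_funD => //.
  exact: (measurableT_comp mU).
have mf : measurable_fun setT (fun q : Q => G (rel_coord q) * unit_ind (q.2.1 + U (rel_coord q))%R)%E.
  apply: emeasurable_funM; first exact: (measurableT_comp mG).
  apply: (measurableT_comp mui); apply: measurable_funD => //.
  exact: (measurableT_comp mU).
have mkz' z' : measurable_fun setT (fun z => kk z z').
  have mp : measurable_fun setT (fun z : R * R => (z, z') : Q) by exact: measurable_fun_pair.
  exact: (measurableT_comp mkk mp).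
have mkz z : measurable_fun setT (fun z' => kk z z').
  have mp : measurable_fun setT (fun z' : R * R => (z, z') : Q) by exact: measurable_fun_pair.
  exact: (measurableT_comp mkk mp).
rewrite leb4_tonelli2//; last by move=> q; rewrite mule_ge0.
(* Reflecting the left head time about the right one turns it into the lag. *)
transitivity (\int[leb2]_z' \int[leb2]_z kk z z')%E.
  apply: eq_integral => z' _.
  by rewrite -(ge0_integral_reflect z'.1 (mkz' z') (fun z => kk0 _ _)).
rewrite -(leb4_tonelli2 mkk)// (leb4_tonelli1 mkk)//=.
transitivity (\int[leb2]_z \int[leb]_h' G (z, h'))%E.
  apply: eq_integral => z _; rewrite leb2_tonelli2//; apply: eq_integral => h' _.
  rewrite /kk/= ge0_integralZl//; last first.
    by apply: (measurableT_comp mui); exact: measurable_funD.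
  rewrite -[RHS]mule1; congr (_ * _)%E.
  have n1 : 1 != 0 :> R by rewrite oner_eq0.
  have := ge0_integral_affine (U (z, h')) n1 mui ui0.
  rewrite normr1 invr1 mul1e => h1.
  transitivity (\int[leb]_x unit_ind (1 * x + U (z, h'))%R)%E.
    by apply: eq_integral => x _; rewrite mul1r.
  rewrite h1; have -> : (\int[leb]_x unit_ind x = leb `]0%R, 1%R[%classic)%E.
    by apply: integral_indicT; exact: measurable_itv.
  rewrite lebesgue_measure_itv/= lte_fin ltr01.
  by rewrite sube0.
have swap : (\int[leb2]_z \int[leb]_h' G (z, h') = \int[leb]_h' \int[leb2]_z G (z, h'))%E.
  exact: (@fubini_tonelli _ _ _ _ R leb2 leb G mG G0).
rewrite swap; apply: eq_integral => h' _.
have mGh : measurable_fun setT (fun z => G (z, h')).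
  by apply: (measurableT_comp mG); exact: measurable_fun_pair.
by rewrite leb2_tonelli2.
Qed.

Lemma rel_patch_integral :
  (\int[leb]_h' \int[leb]_h \int[leb]_t G ((t, h), h') =
   \int[leb]_(h' in `[0%R, +oo[) \int[leb]_(h in `[0%R, +oo[)
     \int[leb]_(t in [set t | 0 < t /\ 0 < del ((t, h), h')]%R) (rel_density ((t, h), h'))%:E)%E.
Proof.
rewrite [RHS]integral_mkcond; apply: eq_integral => h' _.
rewrite [RHS]/patch; case: ifPn; rewrite ?notin_setE ?inE/= in_itv/= andbT => h'0; last first.
  apply: integral0_eq => h _; apply: integral0_eq => t _.
  by rewrite /rel_patch /patch memNset// => -[/=].
rewrite [RHS]integral_mkcond; apply: eq_integral => h _.
rewrite [RHS]/patch; case: ifPn; rewrite ?notin_setE ?inE/= in_itv/= andbT => h0; last first.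
  apply: integral0_eq => t _.
  by rewrite /rel_patch /patch memNset// => -[/=].
rewrite [RHS]integral_mkcond; apply: eq_integral => t _.
rewrite /rel_patch /patch/=; congr (if _ then _ else _).
by apply/idP/idP; rewrite !inE; [case|case; split].
Qed.

End IteratedIntegral.

(** * Intensity of the k-th intersections *)

Section IntersectionIntensity.
Variables (R : realType) (n : nat) (lam v : 'I_n -> R).
Variables (d : measure_display) (Omega : measurableType d) (P : probability Omega R).
Variable S : Omega -> set (station R n).
Hypothesis lam0 : forall i, 0 < lam i.
Hypothesis v0 : forall i, 0 < v i.
Hypothesis PPP : marked_PPP P lam S.
Variables (i j : 'I_n) (k : nat) (del U : (R * R) * R -> R).
Local Notation leb := (@lebesgue_measure R).
Hypothesis mdel : measurable_fun setT del.
Hypothesis cdel : continuous del.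
Hypothesis mU : measurable_fun setT U.
Hypothesis cU : forall p, 0 < p.1.1 -> 0 < del p -> {for p, continuous U}.
Hypothesis U_meet : forall p, 0 < p.1.1 -> 0 < del p ->
  forall s, kth_meet (v i) (v j) k p s <-> s = U p.
Hypothesis no_meet : forall p, 0 < p.1.1 -> del p < 0 -> forall s, ~ meet (v i) (v j) p s.
Hypothesis del_null : forall h h', exists s : seq R, forall t, del ((t, h), h') = 0 -> t \in s.

Local Notation kth_time := (kth_time (v i) (v j) k).

Definition pair_integral : \bar R :=
  (\int[leb]_(h' in `[0%R, +oo[) \int[leb]_(h in `[0%R, +oo[)
     \int[leb]_(t in [set t | 0 < t /\ 0 < del ((t, h), h')]%R)
        (rel_density U (v j) (total_rate lam) ((t, h), h'))%:E)%E.

Theorem intersection_intensity (H : Omega -> set R) :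
  (forall w, handover_times v S i j kth_time w `<=` H w `&` `[0%R, 1%R[%classic) ->
  (forall w, (forall s s', S w s -> S w s' -> s.1 = s'.1 -> shead v s = shead v s' -> s = s') ->
     H w `&` `[0%R, 1%R[%classic `<=` handover_times v S i j kth_time w) ->
  (intensity P H = (mass lam v i * mass lam v j)%:E * pair_integral)%E.
Proof.
move=> lowH upH.
(* If [t < t'] were both [k]-th, the meetings before [t'] would include those before [t] and [t]
   itself, one too many. *)
have K_uniq q t t' : kth_time q t -> kth_time q t' -> t = t'.
  move=> [h1 h2 h3 [l [ul [lA sl]]]] [h1' h2' h3' [l' [ul' [lA' sl']]]].
  wlog: t t' h2 h3 l ul lA sl h2' h3' l' ul' lA' sl' / t < t' => [W|tt'].
    case: (ltgtP t t') => // tt'; first exact: (W t t' h2 h3 l ul lA sl h2' h3' l').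
    exact/esym/(W t' t h2' h3' l' ul' lA' sl' h2 h3 l).
  have tl' : t \in l' by have : [set x | x \in l'] t by rewrite lA'.
  have tl : t \notin l.
    by apply/negP => tl; have : [set x | x \in l] t by []; rewrite lA /= ltxx => -[].
  have ll' : {subset t :: l <= l'}.
    move=> x; rewrite inE => /orP[/eqP ->//|xl].
    have : [set x | x \in l] x by [].
    rewrite lA /= => -[xt xe]; have : [set x | x \in l'] x; last by [].
    by rewrite lA'; split => //; exact: lt_trans tt'.
  have := uniq_leq_size (_ : uniq (t :: l)) ll'.
  by rewrite /= tl ul => /(_ isT); rewrite sl sl' ltnn.
have Dext := proper_ext (w1 := v i) (w2 := v j) cdel cU U_meet no_meet.
rewrite (mecke lam0 v0 PPP K_uniq _ _ (D := proper_meet del U) (tau := meet_time U)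
  (Z := degenerate_meet (v i) (v j) del) _ _ _ Dext _ _ _ _ lowH upH).
- congr (_ * _)%E.
  rewrite /pair_integral -rel_patch_integral -relative_integral// /handover_integral integral_mkcond.
  apply: eq_integral => q _.
  rewrite /rel_patch /patch; case: ifPn; rewrite ?notin_setE ?inE /=.
    move=> [[h d0 t0 t1] [h1 h2]].
    rewrite mem_set; last by split => //=; rewrite subr_gt0.
    rewrite [X in (_ * X)%E](_ : _ = 1%E); last first.
      by rewrite indicE mem_set//= in_itv/= t0.
    rewrite mule1 /handover_density /void_prob /handover_radius /rel_density/= bird_sq.
    by rewrite /meet_time [q.2.1 + _]addrC addrK.
  move=> np; case: ifPn => [|_]; last by rewrite mul0e.
  rewrite inE => -[/= h1 h2 h3 h4].
  rewrite [X in (_ * X)%E](_ : _ = 0%E) ?mule0//.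
  rewrite indicE memNset//= in_itv/= => /andP[t0 t1]; apply: np.
  by split => //; split => //; rewrite -subr_gt0.
- by move=> q t [].
- by move=> q t [].
- by move=> q; apply: proper_kth.
- by move=> q; apply: proper_open.
- by move=> q [h d0 _ _]; exact: (continuous_meet_time cU h d0).
- exact: measurable_proper.
- by apply: measurable_funTS; exact: measurable_meet_time.
- exact: measurable_degenerate.
- exact: degenerate_null.
Qed.

End IntersectionIntensity.

(** * Continuity and measurability of coordinates *)

Section Coordinates.
Variable R : realType.
Local Notation R3 := ((R * R) * R)%type.

Lemma continuous_r3_1 : continuous (fun p : R3 => p.1.1).
Proof.
by move=> q; apply: (@cvg_comp _ _ _ fst fst (nbhs q) (nbhs q.1) (nbhs q.1.1)); exact: cvg_fst.
Qed.

Lemma continuous_r3_2 : continuous (fun p : R3 => p.1.2).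
Proof.
by move=> q; apply: (@cvg_comp _ _ _ fst snd (nbhs q) (nbhs q.1) (nbhs q.1.2)); [exact: cvg_fst|exact: cvg_snd].
Qed.

Lemma continuous_r3_3 : continuous (fun p : R3 => p.2).
Proof. by move=> q; exact: cvg_snd. Qed.

Lemma continuous_sq (T : topologicalType) (f : T -> R) p :
  f x @[x --> p] --> f p -> f x ^+ 2 @[x --> p] --> f p ^+ 2.
Proof.
by move=> cf; apply: (@continuous_comp _ _ _ f (fun y => y ^+ 2)) => //; exact: exprn_continuous.
Qed.

Lemma measurable_r3_1 : measurable_fun setT (fun p : R3 => p.1.1).
Proof. exact: measurableT_comp. Qed.

Lemma measurable_r3_2 : measurable_fun setT (fun p : R3 => p.1.2).
Proof. exact: measurableT_comp. Qed.

Lemma measurable_r3_3 : measurable_fun setT (fun p : R3 => p.2).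
Proof. exact: measurable_snd. Qed.

Lemma measurable_inv : measurable_fun setT (fun x : R => x^-1).
Proof.
have -> : [set: R] = [set 0] `|` ~` [set 0] by rewrite setUv.
apply/measurable_funU => //; first exact: measurableC.
split; first exact: measurable_fun_set1.
apply: open_continuous_measurable_fun.
  by apply: closed_openC; exact: closed_eq.
by move=> x; rewrite inE /= => /eqP x0; exact: inv_continuous.
Qed.

End Coordinates.

(** * Solving for the meeting time *)

Section Roots.
Variables (R : realType) (w1 w2 : R).
Hypothesis w1_gt0 : 0 < w1.
Hypothesis w2_gt0 : 0 < w2.
Local Notation R3 := ((R * R) * R)%type.

Lemma meetE (p : R3) s : meet w1 w2 p s <->
  w1 ^+ 2 * (s + p.1.1) ^+ 2 + p.1.2 ^+ 2 = w2 ^+ 2 * s ^+ 2 + p.2 ^+ 2.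
Proof. by rewrite /meet bird_eq /= opprK subr0. Qed.

Section DifferentSpeeds.
Hypothesis w12 : w1 != w2.
Let A := w2 ^+ 2 - w1 ^+ 2.

Definition discriminant (p : R3) : R := Delta w1 w2 p.1.1 p.2 p.1.2.

(** Division by a negative [A] would exchange the two roots; the factor [Num.sg A] makes [k = 1] the
    earlier one for either sign. For [A > 0] it is the fraction squared in [hhat2]. *)
Definition root_time (k : nat) (p : R3) : R :=
  (w1 ^+ 2 * p.1.1 + (-1) ^+ k * (Num.sg A * Num.sqrt (discriminant p))) / A.

Lemma speed_diff_neq0 : A != 0.
Proof. by rewrite subr_eq0 eqrXn2 ?ltW// eq_sym. Qed.

(** The meeting equation multiplied by [A], with the square completed; [A != 0] makes this
    reversible. *)
Lemma meet_discriminant p s : meet w1 w2 p s <-> (A * s - w1 ^+ 2 * p.1.1) ^+ 2 = discriminant p.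
Proof.
rewrite meetE /discriminant /Delta -/A.
have E : (A * s - w1 ^+ 2 * p.1.1) ^+ 2 - (w2 ^+ 2 * w1 ^+ 2 * p.1.1 ^+ 2 - (p.2 ^+ 2 - p.1.2 ^+ 2) * A) =
  A * (w2 ^+ 2 * s ^+ 2 + p.2 ^+ 2 - (w1 ^+ 2 * (s + p.1.1) ^+ 2 + p.1.2 ^+ 2)).
  by rewrite /A; ring.
split=> [h|/eqP].
  by apply/eqP; rewrite -subr_eq0 E -h subrr mulr0.
rewrite -subr_eq0 E mulf_eq0 (negbTE speed_diff_neq0)/= subr_eq0 => /eqP ->.
by [].
Qed.

Lemma no_meet_discriminant p : discriminant p < 0 -> forall s, ~ meet w1 w2 p s.
Proof. by move=> d0 s /meet_discriminant h; move: d0; rewrite -h ltNge sqr_ge0. Qed.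

Let r p := Num.sqrt (discriminant p).


Lemma sg_div x : Num.sg A * x / A = x / `|A|.
Proof.
have A0 := speed_diff_neq0.
have [a|a|/eqP] := ltgtP A 0; last by rewrite (negbTE A0).
  by rewrite ltr0_sg// ltr0_norm//; field.
by rewrite gtr0_sg// gtr0_norm//; field.
Qed.

Lemma root_timeE k p : root_time k p = w1 ^+ 2 * p.1.1 / A + (-1) ^+ k * (r p / `|A|).
Proof. by rewrite /root_time mulrDl -[in RHS]sg_div !mulrA. Qed.

Lemma meet_roots p s : 0 < discriminant p ->
  meet w1 w2 p s <-> s = root_time 1 p \/ s = root_time 2 p.
Proof.
move=> d0; rewrite meet_discriminant !root_timeE expr1 sqrrN expr1n mulN1r mul1r.
have A0 := speed_diff_neq0; have nA : `|A| != 0 by rewrite normr_eq0.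
have r2 : r p ^+ 2 = discriminant p by rewrite sqr_sqrtr// ltW.
set c := w1 ^+ 2 * p.1.1.
have q2 : (r p / `|A|) ^+ 2 = discriminant p / A ^+ 2.
  by rewrite expr_div_n r2 real_normK ?num_real.
have E : (A * s - c) ^+ 2 = A ^+ 2 * (s - c / A) ^+ 2 by field.
have H : (A * s - c) ^+ 2 = discriminant p <-> (s - c / A) ^+ 2 = (r p / `|A|) ^+ 2.
  rewrite E q2; split => [<-|->]; first by rewrite [RHS]mulrC mulKf// expf_neq0.
  by rewrite [LHS]mulrC divfK// expf_neq0.
rewrite H; split.
  move/eqP; rewrite eqf_sqr => /orP[/eqP h|/eqP h]; [right|left].
    by rewrite -h; ring.
  by rewrite -h; ring.
by case=> ->; rewrite addrC addKr ?sqrrN.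
Qed.

Lemma root_lt p : 0 < discriminant p -> root_time 1 p < root_time 2 p.
Proof.
move=> d0; rewrite !root_timeE expr1 sqrrN expr1n mulN1r mul1r ltrD2l.
by rewrite gtrN// divr_gt0 ?sqrtr_gt0// normr_gt0 speed_diff_neq0.
Qed.

Lemma root_time_meet k p : (k = 1 \/ k = 2)%N -> 0 < discriminant p ->
  forall s, kth_meet w1 w2 k p s <-> s = root_time k p.
Proof.
move=> k12 d0 s; have lt12 := root_lt d0.
have M u := meet_roots u d0.
case: k12 => ->; rewrite /kth_meet M /=; split.
- move=> [[->//|->] [l [_ [lA /size0nil l0]]]].
  have : [set x | x \in l] (root_time 1 p) by rewrite lA /=; split => //; apply/M; left.
  by rewrite l0.
- move=> ->; split; first by left.
  exists [::]; split => //; split => //; apply/seteqP; split => u //= [us /M[] uE].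
    by rewrite uE ltxx in us.
  by rewrite uE in us; have := lt_trans us lt12; rewrite ltxx.
- move=> [[->|->//] [l [_ [lA sl]]]].
  case: l sl lA => // a [|//] _ lA.
  have : [set x | x \in [:: a]] a by rewrite /= inE.
  rewrite lA /= => -[us /M[] uE].
    by rewrite uE ltxx in us.
  by rewrite uE in us; have := lt_trans us lt12; rewrite ltxx.
- move=> ->; split; first by right.
  exists [:: root_time 1 p]; split => //; split => //.
  apply/seteqP; split => u /=; rewrite inE.
    by move/eqP => ->; split => //; apply/M; left.
  by move=> [us /M[->//|uE]]; rewrite uE ltxx in us.
Qed.

Lemma discriminant_null h h' : exists s : seq R, forall t,
  discriminant ((t, h), h') = 0 -> t \in s.
Proof.
have a0 : 0 < w2 ^+ 2 * w1 ^+ 2 by rewrite mulr_gt0// exprn_gt0.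
have [s sP] := @quadratic_seq R _ 0 ((h' ^+ 2 - h ^+ 2) * A) a0.
exists s => t /eqP; rewrite /discriminant /Delta /= subr_eq0 => /eqP e.
by apply: sP; rewrite subr0.
Qed.

Lemma continuous_discriminant : continuous discriminant.
Proof.
move=> p; apply: cvgB.
  apply: cvgM; first exact: cvg_cst.
  by apply: (continuous_sq (f := fun p : R3 => p.1.1)); exact: continuous_r3_1.
apply: cvgM; last exact: cvg_cst.
apply: cvgB; first by apply: (continuous_sq (f := fun p : R3 => p.2)); exact: continuous_r3_3.
by apply: (continuous_sq (f := fun p : R3 => p.1.2)); exact: continuous_r3_2.
Qed.

Lemma measurable_discriminant : measurable_fun setT discriminant.
Proof.
apply: measurable_funB.
  by apply: measurable_funM => //; apply: measurable_funX; exact: measurable_r3_1.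
apply: measurable_funM => //; apply: measurable_funB; apply: measurable_funX.
  exact: measurable_r3_3.
exact: measurable_r3_2.
Qed.

Lemma continuous_root_time k p : {for p, continuous (root_time k)}.
Proof.
apply: cvgM; last exact: cvg_cst.
apply: cvgD.
  by apply: cvgM; [exact: cvg_cst|exact: continuous_r3_1].
apply: cvgM; first exact: cvg_cst.
apply: cvgM; first exact: cvg_cst.
apply: continuous_comp; last exact: sqrt_continuous.
exact: continuous_discriminant.
Qed.

Lemma measurable_root_time k : measurable_fun setT (root_time k).
Proof.
apply: measurable_funM => //; apply: measurable_funD.
  by apply: measurable_funM => //; exact: measurable_r3_1.
apply: measurable_funM => //; apply: measurable_funM => //.
apply: (measurableT_comp (@measurable_sqrt R)).
exact: measurable_discriminant.
Qed.

End DifferentSpeeds.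

Section EqualSpeeds.
Hypothesis w12 : w1 = w2.

Definition crossing_time (p : R3) : R :=
  (p.2 ^+ 2 - p.1.2 ^+ 2 - w1 ^+ 2 * p.1.1 ^+ 2) * (2 * w1 ^+ 2 * p.1.1)^-1.

Lemma meet_crossing p s : 0 < p.1.1 -> meet w1 w2 p s <-> s = crossing_time p.
Proof.
move=> t0; rewrite meetE -w12 /crossing_time.
have d0 : 2 * w1 ^+ 2 * p.1.1 != 0 by rewrite gt_eqF// !mulr_gt0// exprn_gt0.
have n1 : w1 != 0 by rewrite gt_eqF.
have n2 : p.1.1 != 0 by rewrite gt_eqF.
split => [h|->]; last by field; rewrite n1 n2.
apply: (mulIf d0); rewrite divfK//.
have -> : p.2 ^+ 2 = w1 ^+ 2 * (s + p.1.1) ^+ 2 + p.1.2 ^+ 2 - w1 ^+ 2 * s ^+ 2.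
  by rewrite h; ring.
by ring.
Qed.

Lemma crossing_time_meet p : 0 < p.1.1 -> forall s, kth_meet w1 w2 1 p s <-> s = crossing_time p.
Proof.
move=> t0 s; have M u := meet_crossing u t0.
rewrite /kth_meet M; split => [[]//|->]; split => //.
exists [::]; split => //; split => //; apply/seteqP; split => u //= [us /M uE].
by rewrite uE ltxx in us.
Qed.

Lemma continuous_crossing_time p : 0 < p.1.1 -> {for p, continuous crossing_time}.
Proof.
move=> t0; apply: cvgM.
  apply: cvgB.
    apply: cvgB.
      by apply: (continuous_sq (f := fun p : R3 => p.2)); exact: continuous_r3_3.
    by apply: (continuous_sq (f := fun p : R3 => p.1.2)); exact: continuous_r3_2.
  by apply: cvgM; [exact: cvg_cst|apply: (continuous_sq (f := fun p : R3 => p.1.1)); exact: continuous_r3_1].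
apply: cvgV; first by rewrite gt_eqF// !mulr_gt0// exprn_gt0.
by apply: cvgM; [exact: cvg_cst|exact: continuous_r3_1].
Qed.

Lemma measurable_crossing_time : measurable_fun setT crossing_time.
Proof.
apply: measurable_funM.
  apply: measurable_funB.
    by apply: measurable_funB; apply: measurable_funX; [exact: measurable_r3_3|exact: measurable_r3_2].
  by apply: measurable_funM => //; apply: measurable_funX; exact: measurable_r3_1.
apply: (measurableT_comp (@measurable_inv R)).
by apply: measurable_funM => //; exact: measurable_r3_1.
Qed.

End EqualSpeeds.
End Roots.

(** * Gaussian integrals *)

Section GaussianIntegrals.
Variable R : realType.
Local Notation leb := (@lebesgue_measure R).
Implicit Types a b x y : R.

Lemma measurable_gauss a : measurable_fun setT (fun x => expR (- (a * x ^+ 2))).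
Proof.
apply: (measurableT_comp (@measurable_expR R)); apply: measurable_funN.
by apply: measurable_funM => //; exact: measurable_funX.
Qed.

Lemma integral_gauss_scaled a : 0 < a ->
  (\int[leb]_x (expR (- (a * x ^+ 2)))%:E = (Num.sqrt (pi / a))%:E)%E.
Proof.
move=> a0.
have s0 : 0 < Num.sqrt a by rewrite sqrtr_gt0.
pose f x : \bar R := (gauss_fun x)%:E.
have mf : measurable_fun setT f by apply/measurable_EFinP; exact: measurable_gauss_fun.
have f0 x : (0 <= f x)%E by rewrite lee_fin gauss_fun_ge0.
transitivity (\int[leb]_x f (Num.sqrt a * x + 0)%R)%E.
  apply: eq_integral => x _; rewrite /f /gauss_fun addr0 exprMn sqr_sqrtr//; exact: ltW.
rewrite (ge0_integral_affine 0 _ mf f0) ?gt_eqF// integralT_gauss -EFinM.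
by rewrite gtr0_norm// sqrtrM ?pi_ge0// sqrtrV ?(ltW a0)// mulrC.
Qed.

Section CauchySchlomilch.
Variables a b : R.
Hypothesis a0 : 0 < a.
Hypothesis b0 : 0 < b.
Let s x : R := Num.sqrt (x ^+ 2 + b ^+ 2).
Let F x : R := x + s x.
Let G y : R := expR (- (a * ((b ^+ 2 - y ^+ 2) / (2 * y)) ^+ 2)).

Let xb0 x : 0 < x ^+ 2 + b ^+ 2.
Proof. by rewrite ltr_wpDl ?sqr_ge0// exprn_gt0. Qed.

Let s2 x : s x ^+ 2 = x ^+ 2 + b ^+ 2.
Proof. by rewrite sqr_sqrtr// ltW. Qed.

Let s0 x : 0 < s x. Proof. by rewrite sqrtr_gt0. Qed.

Let norm_lt_s x : `|x| < s x.
Proof. by rewrite lt_sqrtr// real_normK ?num_real// ltrDl exprn_gt0. Qed.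

Let F0 x : 0 < F x.
Proof. have := norm_lt_s x; rewrite ltr_norml /F => /andP[h _]; lra. Qed.

Let F_conj x : F x * (s x - x) = b ^+ 2.
Proof. by rewrite /F; have := s2 x; move: (s x) => r; nra. Qed.

(** [F x] and [s x - x] are positive with constant product [b^2] and difference [2 x]. If [F] did
    not increase from [x] to [y], the other factor would not decrease, and the differences would
    give [y <= x]. *)
Let F_incr : {homo F : x y / x < y}.
Proof.
move=> x y xy; rewrite ltNge; apply/negP => h.
have hx := F_conj x; have hy := F_conj y; have Fx := F0 x; have Fy := F0 y.
have B : 0 < b ^+ 2 by rewrite exprn_gt0.
have h1 : s x - x <= s y - y.
  rewrite leNgt; apply/negP => h2.
  suff : b ^+ 2 < b ^+ 2 by rewrite ltxx.
  rewrite -{1}hy -hx; apply: (lt_le_trans (y := F y * (s x - x))); first by rewrite ltr_pM2l.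
  by rewrite ler_wpM2r// -(pmulr_rge0 _ Fx) hx ltW.
by move: h h1; rewrite /F; lra.
Qed.

Let F_le : {homo F : x y / x <= y}.
Proof. by move=> x y; rewrite le_eqVlt => /predU1P[->//|/F_incr/ltW]. Qed.

Let F_inv x : (b ^+ 2 - F x ^+ 2) / (2 * F x) = - x.
Proof.
have Fx := F0 x; apply: (@mulIf _ (2 * F x)); first by rewrite gt_eqF// mulr_gt0.
rewrite divfK ?gt_eqF ?mulr_gt0// -(F_conj x); rewrite /F; ring.
Qed.

(** Explicit inverse of [F] on the positive half-line: there [x^2 + b^2] is the square of
    [(y^2 + b^2) / (2 y)]. *)
Let F_surj y : 0 < y -> F ((y ^+ 2 - b ^+ 2) / (2 * y)) = y.
Proof.
move=> y0; have yn : y != 0 by rewrite gt_eqF.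
have -> : F ((y ^+ 2 - b ^+ 2) / (2 * y)) = (y ^+ 2 - b ^+ 2) / (2 * y) + (y ^+ 2 + b ^+ 2) / (2 * y).
  rewrite /F /s [X in Num.sqrt X](_ : _ = ((y ^+ 2 + b ^+ 2) / (2 * y)) ^+ 2); last by field.
  by rewrite sqrtr_sqr ger0_norm// divr_ge0// ?addr_ge0 ?sqr_ge0// mulr_ge0// ltW.
by field.
Qed.

Let F' x : R := 1 + x / s x.

Let dF x : is_derive x 1 F (F' x).
Proof.
rewrite /F /F'.
have ds : is_derive x 1 s (x / s x).
  have d1 : is_derive x 1 (fun x => x ^+ 2 + b ^+ 2) (2 * x).
    apply: is_derive_eq; rewrite /GRing.scale/=; ring.
  have d2 := @is_derive1_sqrt R _ (xb0 x).
  apply: (@is_derive_eq _ _ _ _ _ _ _ ((2 * s x)^-1 * (2 * x))).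
  by field; rewrite gt_eqF.
by apply: is_deriveD.
Qed.

Let cs : continuous s.
Proof.
move=> x; apply: continuous_comp; last exact: sqrt_continuous.
by apply: cvgD; [apply: continuous_sq|exact: cvg_cst].
Qed.

Let cF' : continuous F'.
Proof.
move=> x; apply: cvgD; first exact: cvg_cst.
by apply: cvgM => //; apply: cvgV; [rewrite gt_eqF|exact: cs].
Qed.

Let cG y : 0 < y -> {for y, continuous G}.
Proof.
move=> y0; apply: (continuous_comp (g := @expR R)); last exact: continuous_expR.
apply: cvgN; apply: cvgM; first exact: cvg_cst.
apply: continuous_sq; apply: cvgM.
  by apply: cvgB; [exact: cvg_cst|apply: continuous_sq].
apply: cvgV; first by rewrite gt_eqF// mulr_gt0.
by apply: cvgM; [exact: cvg_cst|].
Qed.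

Let mG : measurable_fun setT G.
Proof.
apply: (measurableT_comp (@measurable_expR R)); apply: measurable_funN.
apply: measurable_funM => //; apply: measurable_funX; apply: measurable_funM.
  by apply: measurable_funB => //; exact: measurable_funX.
by apply: (measurableT_comp (@measurable_inv R)); exact: measurable_funM.
Qed.

Let g x : R := expR (- (a * x ^+ 2)) * F' x.

Let mF' : measurable_fun setT F'.
Proof. exact: continuous_measurable_fun. Qed.

Let mg : measurable_fun setT g.
Proof. by apply: measurable_funM => //; exact: measurable_gauss. Qed.

Let F'_ge0 x : 0 <= F' x.
Proof.
have -> : F' x = F x / s x.
  by rewrite /F' /F mulrDl divff ?gt_eqF// addrC.
by rewrite divr_ge0// ltW.
Qed.

Let g0 x : 0 <= g x.
Proof. by rewrite mulr_ge0// expR_ge0. Qed.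

Let subst_itv (n : nat) : (\int[leb]_(y in `[F (- n%:R)%R, F n%:R%R]) (G y)%:E =
  \int[leb]_(x in `[(- n%:R)%R, n%:R%R]) (g x)%:E)%E.
Proof.
have dE := is_derive_derive1 dF.
rewrite integration_by_substitution_increasing//.
- apply: eq_integral => x _ /=; rewrite dE /g/=; congr (_%:E).
  change (G (F x) * F' x = expR (- (a * x ^+ 2)) * F' x).
  by rewrite /G F_inv sqrrN.
- by rewrite (@le_trans _ _ 0)// oppr_le0.
- by move=> ? ? _ _; exact: F_incr.
- by rewrite dE => x _; exact: cF'.
- by rewrite dE; apply: (cvgP (F' (- n%:R))); apply: cvg_at_right_filter; exact: cF'.
- by rewrite dE; apply: (cvgP (F' n%:R)); apply: cvg_at_left_filter; exact: cF'.
- exact: is_derive_LRcontinuous dF.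
- apply: continuous_in_subspaceT => y; rewrite inE/= in_itv/= => /andP[h _].
  by apply: cG; exact: lt_le_trans h.
Qed.

(** The substitution holds on compact intervals; [[-k, k]] exhausts the line, its images under [F]
    exhaust the positive half-line, and both integrals are the same monotone limit. *)
Let subst_lim : (\int[leb]_(y in `]0%R, +oo[) (G y)%:E = \int[leb]_x (g x)%:E)%E.
Proof.
have mono m p : (m <= p)%N -> (m%:R <= p%:R :> R) by rewrite ler_nat.
have arch (x : R) : exists k : nat, `|x| <= k%:R.
  by exists (Num.Def.truncn `|x|).+1; apply: ltW; rewrite truncnS_gt.
pose u (k : nat) := (\int[leb]_(y in `[F (- k%:R)%R, F k%:R%R]) (G y)%:E)%E.
have L : u @ \oo --> (\int[leb]_(y in `]0%R, +oo[) (G y)%:E)%E.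
  have <- : \bigcup_(k in [set: nat]) `[F (- k%:R), F k%:R]%classic = `]0, +oo[%classic.
    apply/seteqP; split => y /=.
      by move=> [k _] /=; rewrite !in_itv/= andbT => /andP[h _]; exact: lt_le_trans h.
    rewrite in_itv/= andbT => y0; have [k] := arch ((y ^+ 2 - b ^+ 2) / (2 * y)).
    rewrite ler_norml => /andP[h1 h2]; exists k => //=.
    by rewrite in_itv/= -{1}(F_surj y0) (F_le h1) -{1}(F_surj y0) (F_le h2).
  apply: ge0_nondecreasing_set_cvg_integral => //.
  - move=> m p mp; apply/subsetPset => y /=; rewrite !in_itv/= => /andP[h1 h2].
    apply/andP; split; first by apply: le_trans h1; apply: F_le; rewrite lerN2 mono.
    by apply: (le_trans h2); apply: F_le; rewrite mono.
  - by move=> k; apply: measurable_funTS; exact/measurable_EFinP.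
  - by move=> k y _; rewrite lee_fin expR_ge0.
have L' : u @ \oo --> (\int[leb]_x (g x)%:E)%E.
  rewrite (_ : u = fun k : nat => \int[leb]_(x in `[(- k%:R)%R, k%:R%R]) (g x)%:E)%E; last first.
    by apply/funext => k; exact: subst_itv.
  have <- : \bigcup_(k in [set: nat]) `[- k%:R, k%:R]%classic = [set: R].
    apply/seteqP; split => y //= _; have [k] := arch y.
    by rewrite ler_norml => h; exists k.
  apply: ge0_nondecreasing_set_cvg_integral => //.
  - move=> m p mp; apply/subsetPset => y /=; rewrite !in_itv/= => /andP[h1 h2].
    by have := mono _ _ mp => h3; apply/andP; split; lra.
  - by move=> k; apply: measurable_funTS; exact/measurable_EFinP.
  - by move=> k y _; rewrite lee_fin.
exact: (cvg_unique _ L L').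
Qed.

Let gauss_half : (\int[leb]_x (g x)%:E = (Num.sqrt (pi / a))%:E)%E.
Proof.
pose f x : \bar R := (g x)%:E.
have mf : measurable_fun setT f by apply/measurable_EFinP.
have f0 x : (0 <= f x)%E by rewrite lee_fin.
have refl : (\int[leb]_x f (-1 * x + 0)%R = \int[leb]_x f x)%E.
  by rewrite (ge0_integral_affine 0 _ mf f0)// normrN normr1 invr1 mul1e.
have : (\int[leb]_x f x + \int[leb]_x f x = (2 * Num.sqrt (pi / a))%:E)%E.
  rewrite -{2}refl -ge0_integralD//; last first.
    by apply: (measurableT_comp mf); exact: measurable_affine.
  rewrite EFinM -(integral_gauss_scaled a0) -ge0_integralZl//; first last.
  - by apply/measurable_EFinP; exact: measurable_gauss.
  apply: eq_integral => x _; rewrite /f -EFinD -EFinM; congr (_%:E).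
  rewrite /g /F' mulN1r addr0 sqrrN -mulrDr mulrC; congr (_ * _).
  rewrite /s sqrrN mulNr; ring.
have : (0 <= \int[leb]_x f x)%E by exact: integral_ge0.
rewrite /f; case: (\int[leb]_x _)%E => [r| |]//=.
by rewrite -EFinD => _ -[h]; congr (_%:E); lra.
Qed.

(* The substitution y = x + sqrt (x^2 + b^2) turns (b^2 - y^2) / (2 y) into - x, and reflection
   cancels the odd part of its Jacobian. *)
Lemma cauchy_schlomilch :
  (\int[leb]_(y in `]0%R, +oo[) (expR (- (a * ((b ^+ 2 - y ^+ 2) / (2 * y)) ^+ 2)))%:E =
   (Num.sqrt (pi / a))%:E)%E.
Proof. by rewrite subst_lim gauss_half. Qed.

End CauchySchlomilch.
End GaussianIntegrals.

(** * The integral for equal speeds *)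

Section EqualSpeedIntegral.
Variable R : realType.
Local Notation leb := (@lebesgue_measure R).
Local Notation leb2 := (@leb2 R).
Implicit Types a b w x y : R.

Lemma integral_half_gauss a : 0 < a ->
  (\int[leb]_(y in `]0%R, +oo[) (expR (- (a * y ^+ 2)))%:E = (Num.sqrt (pi / a) / 2)%:E)%E.
Proof.
move=> a0.
have s0 : 0 < Num.sqrt a by rewrite sqrtr_gt0.
rewrite integral_itv_obnd_cbnd; last first.
  by apply: measurable_funTS; apply/measurable_EFinP; exact: measurable_gauss.
pose f : R -> \bar R := (fun x => (gauss_fun x)%:E) \_ `[0, +oo[%classic.
have mf : measurable_fun setT f.
  apply/(measurable_restrictT _ _).1 => //; apply: measurable_funTS.
  by apply/measurable_EFinP; exact: measurable_gauss_fun.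
have f0 x : (0 <= f x)%E by rewrite /f/patch; case: ifP => // _; rewrite lee_fin gauss_fun_ge0.
transitivity (\int[leb]_x f (Num.sqrt a * x + 0)%R)%E.
  rewrite integral_mkcond; apply: eq_integral => x _; rewrite /f /patch /gauss_fun addr0.
  have -> : (Num.sqrt a * x \in `[0, +oo[%classic) = (x \in `[0, +oo[%classic).
    by apply/idP/idP; rewrite !inE/= !in_itv/= !andbT pmulr_rge0.
  by case: ifP => // _; rewrite exprMn sqr_sqrtr//; exact: ltW.
rewrite (ge0_integral_affine 0 _ mf f0) ?gt_eqF// /f -integral_mkcond integral0y_gauss -EFinM.
congr (_%:E); rewrite gtr0_norm// sqrtrM ?pi_ge0// sqrtrV ?(ltW a0)//.
by rewrite mulrA [_^-1 * _]mulrC.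
Qed.

(** Equal heights give [b = 0], where the integrand degenerates to a Gaussian of parameter [a / 4];
    half of its integral is again [sqrt (pi / a)]. *)
Lemma cauchy_schlomilch_ge0 a b : 0 < a -> 0 <= b ->
  (\int[leb]_(y in `]0%R, +oo[) (expR (- (a * ((b ^+ 2 - y ^+ 2) / (2 * y)) ^+ 2)))%:E =
   (Num.sqrt (pi / a))%:E)%E.
Proof.
move=> a0; rewrite le_eqVlt => /predU1P[<-|]; last exact: cauchy_schlomilch.
have a4 : 0 < a / 4 by rewrite divr_gt0.
transitivity (\int[leb]_(y in `]0%R, +oo[) (expR (- (a / 4 * y ^+ 2)))%:E)%E.
  apply: eq_integral => y; rewrite inE/= in_itv/= andbT => y0; congr (expR (- _))%:E.
  by field; rewrite gt_eqF.
rewrite integral_half_gauss//; congr (_%:E).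
have -> : pi / (a / 4) = pi / a * 2 ^+ 2.
  by move: (pi : R) => p; field; rewrite gt_eqF.
rewrite sqrtrM ?divr_ge0 ?pi_ge0 ?(ltW a0)// sqrtr_sqr ger0_norm//.
by rewrite mulfK.
Qed.

Lemma crossing_integral L w b m : 0 < L -> 0 < w -> 0 <= b ->
  (\int[leb]_(t in `]0%R, +oo[)
     (expR (- (L * (((b ^+ 2 - (w * t) ^+ 2) / (2 * (w * t))) ^+ 2 + m ^+ 2))))%:E =
   (Num.sqrt (pi / L) / w * expR (- (L * m ^+ 2)))%:E)%E.
Proof.
move=> L0 w0 b0.
pose g y := expR (- (L * ((b ^+ 2 - y ^+ 2) / (2 * y)) ^+ 2)).
have mg : measurable_fun setT g.
  apply: (measurableT_comp (@measurable_expR R)); apply: measurable_funN.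
  apply: measurable_funM => //; apply: measurable_funX; apply: measurable_funM.
    by apply: measurable_funB => //; exact: measurable_funX.
  by apply: (measurableT_comp (@measurable_inv R)); exact: measurable_funM.
pose f : R -> \bar R := (fun x => (g x)%:E) \_ `]0, +oo[%classic.
have mf : measurable_fun setT f.
  by apply/(measurable_restrictT _ _).1 => //; apply: measurable_funTS; exact/measurable_EFinP.
have f0 x : (0 <= f x)%E by rewrite /f/patch; case: ifP => // _; rewrite lee_fin expR_ge0.
have mf' : measurable_fun setT (fun t => f (w * t + 0)).
  by apply: (measurableT_comp mf); exact: measurable_affine.
transitivity (\int[leb]_t ((expR (- (L * m ^+ 2)))%:E * f (w * t + 0)%R))%E.
  rewrite integral_mkcond; apply: eq_integral => t _; rewrite /f /patch addr0.
  have -> : (w * t \in `]0, +oo[%classic) = (t \in `]0, +oo[%classic).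
    by apply/idP/idP; rewrite !inE/= !in_itv/= !andbT pmulr_rgt0.
  case: ifP => // _; last by rewrite mule0.
  rewrite -EFinM /g -expRD; congr (expR _)%:E; ring.
rewrite ge0_integralZl_EFin ?expR_ge0//.
rewrite (ge0_integral_affine 0 _ mf f0) ?gt_eqF// /f -integral_mkcond /g.
rewrite cauchy_schlomilch_ge0// -!EFinM; congr (_%:E).
by rewrite gtr0_norm// mulrC; congr (_ * _); rewrite mulrC.
Qed.

(** Let [b^2 = |h'^2 - h^2|] and [m] be the larger height. The squared height of the crossing is
    [((b^2 - (w t)^2) / (2 w t))^2 + m^2] in both orders: when [h > h'] the sign inside the square
    changes, and the difference [b^2] turns [h'^2] into [h^2]. *)
Lemma crossing_density L w h h' : 0 < L -> 0 < w -> 0 <= h -> 0 <= h' ->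
  (\int[leb]_(t in `]0%R, +oo[)
     (rel_density (crossing_time w) w L ((t, h), h'))%:E =
   (Num.sqrt (pi / L) / w * expR (- (L * Num.max h h' ^+ 2)))%:E)%E.
Proof.
move=> L0 w0 h0 h'0.
pose b := Num.sqrt `|h' ^+ 2 - h ^+ 2|.
have b2 : b ^+ 2 = `|h' ^+ 2 - h ^+ 2| by rewrite sqr_sqrtr.
rewrite -(crossing_integral (b := b) _ L0 w0) ?sqrtr_ge0//.
apply: eq_integral => t; rewrite inE/= in_itv/= andbT => t0.
rewrite /rel_density /crossing_time/= b2; congr (expR (- (L * _)))%:E.
have [tn wn] : t != 0 /\ w != 0 by rewrite !gt_eqF.
have [hh|hh] := leP h h'.
  rewrite ger0_norm ?subr_ge0 ?ler_sqr//.
  by field; rewrite tn wn.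
rewrite ltr0_norm ?subr_lt0 ?ltr_sqr//.
by field; rewrite tn wn.
Qed.

Lemma integral_x_gauss L : 0 < L ->
  (\int[leb]_(x in `[0%R, +oo[) (x * expR (- (L * x ^+ 2)))%:E = (1 / (2 * L))%:E)%E.
Proof.
move=> L0.
pose F x : R := - (2 * L)^-1 * expR (- (L * x ^+ 2)).
have dF x : is_derive x 1 F (x * expR (- (L * x ^+ 2))).
  have d1 : is_derive x 1 (fun x => - (L * x ^+ 2)) (- (L * (2 * x))).
    by apply: is_derive_eq; rewrite /GRing.scale/=; ring.
  have d2 := @is_derive1_comp R (@expR R) _ x _ _ (is_derive_expR _) d1.
  rewrite /F; apply: is_derive_eq; rewrite /GRing.scale/=.
  by field; rewrite gt_eqF.
have cF := is_derive_continuous dF.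
have cf : continuous (fun x => x * expR (- (L * x ^+ 2))).
  move=> x; apply: cvgM => //.
  apply: (continuous_comp (f := fun x => - (L * x ^+ 2)) (g := @expR R)); last exact: continuous_expR.
  by apply: cvgN; apply: cvgM; [exact: cvg_cst|apply: continuous_sq].
rewrite (@ge0_continuous_FTC2y R _ F 0 0).
- rewrite /F expr0n/= mulr0 oppr0 expR0 mulr1 -EFinB; congr (_%:E).
  by rewrite sub0r opprK div1r.
- by move=> x x0; rewrite mulr_ge0// expR_ge0.
- exact: continuous_subspaceT.
- rewrite /F -[X in _ --> X](mulr0 (- (2 * L)^-1)); apply: cvgM; first exact: cvg_cst.
  have h : (fun x => L * x ^+ 2) x @[x --> +oo] --> +oo.
    apply: gt0_cvgMry => //; exact: cvgr_expr2.
  exact: (cvg_comp _ _ h (@cvgr_expR R)).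
- by move=> x _; have := dF x.
- by apply: cvg_at_right_filter; exact: cF.
- by move=> x _; rewrite (is_derive_derive1 dF).
Qed.

(** Split along the diagonal. On each half the smaller variable contributes the length [x], leaving
    the integral of [x expR (- L x^2)], which is [1 / (2 L)]. *)
Lemma integral_max_gauss L : 0 < L ->
  (\int[leb]_(x in `[0%R, +oo[) \int[leb]_(y in `[0%R, +oo[) (expR (- (L * Num.max x y ^+ 2)))%:E =
   (1 / L)%:E)%E.
Proof.
move=> L0.
pose A1 := [set p : R * R | 0 <= p.2] `&` [set p | p.2 < p.1].
pose A2 := [set p : R * R | 0 <= p.1] `&` [set p | p.1 <= p.2].
have mA1 : measurable A1.
  by apply: measurableI; [exact: measurable_set_le|exact: measurable_set_lt].
have mA2 : measurable A2 by apply: measurableI; exact: measurable_set_le.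
pose f1 (p : R * R) : \bar R := ((expR (- (L * p.1 ^+ 2)))%:E * (\1_A1 p)%:E)%E.
pose f2 (p : R * R) : \bar R := ((expR (- (L * p.2 ^+ 2)))%:E * (\1_A2 p)%:E)%E.
have mg := measurable_gauss L.
have m1 : measurable_fun setT f1.
  apply: emeasurable_funM; apply/measurable_EFinP; last exact: measurable_indic.
  exact: (measurableT_comp mg).
have m2 : measurable_fun setT f2.
  apply: emeasurable_funM; apply/measurable_EFinP; last exact: measurable_indic.
  exact: (measurableT_comp mg).
have f10 p : (0 <= f1 p)%E by rewrite mule_ge0// lee_fin ?expR_ge0.
have f20 p : (0 <= f2 p)%E by rewrite mule_ge0// lee_fin ?expR_ge0.
transitivity (\int[leb]_x \int[leb]_y (f1 (x, y) + f2 (x, y)))%E.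
  rewrite integral_mkcond; apply: eq_integral => x _; rewrite [LHS]/patch.
  case: ifPn; rewrite ?notin_setE ?inE/= in_itv/= andbT => x0; last first.
    apply/esym/integral0_eq => y _; rewrite /f1 /f2 /A1 /A2 !indicE !memNset ?mule0 ?adde0//=.
      by move=> [].
    by move=> [/= y0 yx]; apply: x0; apply: ltW; exact: le_lt_trans yx.
  rewrite integral_mkcond; apply: eq_integral => y _; rewrite [LHS]/patch.
  case: ifPn; rewrite ?notin_setE ?inE/= in_itv/= andbT => y0; last first.
    rewrite /f1 /f2 /A1 /A2 !indicE !memNset ?mule0 ?adde0//=; first 1 last.
      by move=> [].
    by move=> [/= ? xy]; apply: y0; exact: le_trans xy.
  rewrite /f1 /f2 /A1 /A2 !indicE/=; have [xy|yx] := leP x y.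
    by rewrite memNset ?mem_set ?mule0 ?add0e ?mule1//= => -[/= _]; rewrite ltNge xy.
  by rewrite mem_set// memNset ?mule0 ?adde0 ?mule1//= => -[/= _]; rewrite leNgt yx.
have -> : (\int[leb]_x \int[leb]_y (f1 (x, y) + f2 (x, y)) =
    \int[leb2]_p (f1 p + f2 p))%E.
  apply/esym; apply: (leb2_tonelli1 (f := fun p => f1 p + f2 p)%E).
    exact: emeasurable_funD.
  by move=> p; rewrite adde_ge0.
rewrite ge0_integralD// leb2_tonelli1// leb2_tonelli2//.
have -> : 1 / L = 1 / (2 * L) + 1 / (2 * L) by field; rewrite gt_eqF.
rewrite EFinD -integral_x_gauss//; congr (_ + _)%E; rewrite [RHS]integral_mkcond;
  apply: eq_integral => x _; rewrite [RHS]/patch.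
- transitivity (\int[leb]_y ((expR (- (L * x ^+ 2)))%:E * (\1_(`[0%R, x[%classic) y)%:E : \bar R))%E.
    apply: eq_integral => y _; rewrite /f1/= !indicE; congr (_ * ((_ : bool)%:R)%:E)%E.
    by apply/idP/idP; rewrite !inE/= in_itv/= /A1/=; [case=> -> ->|case/andP].
  rewrite ge0_integralZl_EFin ?expR_ge0//; last by apply/measurable_EFinP; exact: measurable_indic.
  transitivity ((expR (- (L * x ^+ 2)))%:E * leb `[0%R, x[%classic)%E.
    by congr (_ * _)%E; exact: integral_indicT.
  rewrite lebesgue_measure_itv/= lte_fin.
  case: ifPn => x0'; case: ifPn; rewrite ?notin_setE ?inE/= in_itv/= andbT => x0; first 1 last.
  - by case: x0; rewrite ltW.
  - by rewrite (_ : x = 0) ?mule0 ?mul0r//; apply/eqP; rewrite eq_le x0 leNgt x0'.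
  - by rewrite mule0.
  by rewrite sube0 -EFinM mulrC.
- transitivity (\int[leb]_y ((expR (- (L * x ^+ 2)))%:E * (\1_(`[0%R, x]%classic) y)%:E : \bar R))%E.
    apply: eq_integral => y _; rewrite /f2/= !indicE; congr (_ * ((_ : bool)%:R)%:E)%E.
    by apply/idP/idP; rewrite !inE/= in_itv/= /A2/=; [case=> -> ->|case/andP].
  rewrite ge0_integralZl_EFin ?expR_ge0//; last by apply/measurable_EFinP; exact: measurable_indic.
  transitivity ((expR (- (L * x ^+ 2)))%:E * leb `[0%R, x]%classic)%E.
    by congr (_ * _)%E; exact: integral_indicT.
  rewrite lebesgue_measure_itv/= lte_fin.
  case: ifPn => x0'; case: ifPn; rewrite ?notin_setE ?inE/= in_itv/= andbT => x0; first 1 last.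
  - by case: x0; rewrite ltW.
  - by rewrite (_ : x = 0) ?mule0 ?mul0r//; apply/eqP; rewrite eq_le x0 leNgt x0'.
  - by rewrite mule0.
  by rewrite sube0 -EFinM mulrC.
Qed.

End EqualSpeedIntegral.

Section InnerIntegral.
Variable R : realType.
Local Notation leb := (@lebesgue_measure R).

Lemma measurable_inner_integral (d : measure_display) (T : measurableType d) (D : set R)
    (f : T * R -> \bar R) : measurable D ->
  measurable_fun setT f -> (forall p, 0 <= f p)%E ->
  measurable_fun setT (fun x => \int[leb]_(y in D) f (x, y))%E.
Proof.
move=> mD mf f0.
have -> : (fun x => \int[leb]_(y in D) f (x, y))%E =
    (fun x => \int[leb]_y ((f \_ (setT `*` D)) (x, y)))%E.
  apply/funext => x; rewrite integral_mkcond; apply: eq_integral => y _.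
  by rewrite /patch in_setX in_setT.
apply: (@measurable_fun_fubini_tonelli_F _ _ _ _ _ leb (f \_ (setT `*` D))).
  by apply/(measurable_restrictT _ _).1; [exact: measurableX|exact: measurable_funTS].
by move=> p; rewrite /patch; case: ifP.
Qed.

Lemma measurable_max_gauss (L : R) :
  measurable_fun setT (fun p : R * R => expR (- (L * Num.max p.1 p.2 ^+ 2))).
Proof.
apply: (measurableT_comp (measurable_gauss L)).
exact: (measurable_maxr (f := fst) (g := snd)).
Qed.

End InnerIntegral.

(** * Handover intensities *)

Section Intensities.
Variables (R : realType) (n : nat) (lam v : 'I_n -> R).
Variables (d : measure_display) (Omega : measurableType d) (P : probability Omega R).
Variable S : Omega -> set (station R n).
Hypothesis lam0 : forall i, 0 < lam i.
Hypothesis v0 : forall i, 0 < v i.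
Hypothesis PPP : marked_PPP P lam S.
Local Notation leb := (@lebesgue_measure R).

Lemma total_rate_gt0 (i : 'I_n) : 0 < total_rate lam.
Proof.
rewrite mulr_gt0 ?pi_gt0// (bigD1 i)//= ltr_wpDr// sumr_ge0// => l _; exact: ltW.
Qed.

Lemma kth_intersectionE s s' k t : kth_intersection v s s' k t <->
  bird (v s.1) (shead v s) t = bird (v s'.1) (shead v s') t /\
  has_card [set u | u < t /\ bird (v s.1) (shead v s) u = bird (v s'.1) (shead v s') u] k.-1.
Proof.
rewrite /kth_intersection !(dist_bird v0).
suff -> : [set u | u < t /\ dist v s u = dist v s' u] =
  [set u | u < t /\ bird (v s.1) (shead v s) u = bird (v s'.1) (shead v s') u] by [].
by apply/seteqP; split => u /=; rewrite !(dist_bird v0).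
Qed.

Theorem mixed_intensity (i j : 'I_n) k : v i != v j -> (k = 1 \/ k = 2)%N ->
  (Lambda_mixed P S v k i j = (mass lam v i * mass lam v j)%:E *
    pair_integral lam v j (discriminant (v i) (v j)) (root_time (v i) (v j) k))%E.
Proof.
move=> vij k12; have [vi vj] := (v0 i, v0 j).
apply: (intersection_intensity lam0 v0 PPP (k := k)).
- exact: measurable_discriminant.
- exact: continuous_discriminant.
- exact: measurable_root_time.
- by move=> p _ _; exact: continuous_root_time.
- by move=> p _ h; exact: root_time_meet.
- by move=> p _; exact: no_meet_discriminant.
- exact: discriminant_null.
- move=> w t [s [s' [si s'j [h1 h2 h3 h4] hs]]]; split; last by rewrite /= in_itv.
  exists s, s'; do 2!split => //; split; first exact/(head_leftP v0).
  by split => //; apply/kth_intersectionE; rewrite si s'j.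
- move=> w _ t [[s [s' [si [s'j [/(head_leftP v0) h [/kth_intersectionE [h1 h2] hs]]]]]]].
  rewrite /= in_itv/= => t01; exists s, s'; split => //; split => //; first by rewrite -si -s'j.
  by rewrite -si -s'j.
Qed.

(** [Lambda_same] does not order the pair, while [kth_time] puts the earlier head first, so the
    stations are exchanged if necessary. Equal head times at a meeting force equal heights, hence
    one and the same station when heads determine stations. *)
Theorem same_intensity (i : 'I_n) :
  (Lambda_same P S v i = (mass lam v i * mass lam v i)%:E *
    pair_integral lam v i (fun=> 1%R) (crossing_time (v i)))%E.
Proof.
have vi := v0 i.
apply: (intersection_intensity lam0 v0 PPP (k := 1%N)).
- exact: measurable_cst.
- by move=> p; exact: cvg_cst.
- exact: measurable_crossing_time.
- by move=> p p0 _; exact: continuous_crossing_time.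
- by move=> p p0 _; exact: crossing_time_meet.
- by move=> p _; rewrite ltr10.
- by move=> h h'; exists [::] => t /eqP; rewrite oner_eq0.
- move=> w t [s [s' [si s'i [h1 h2 h3 h4] hs]]]; split; last by rewrite /= in_itv.
  by exists s, s'.
- move=> w inj t [[s [s' [si [s'i hs]]]]]; rewrite /= in_itv/= => t01.
  have E : bird (v i) (shead v s) t = bird (v i) (shead v s') t.
    move: hs => [_ [[sS h1] [s'S h2]]].
    by rewrite -{1}si -s'i -!(dist_bird v0); apply/eqP; rewrite eq_le h1// h2.
  have hs' : handover v (S w) s' s t by case: hs => ss' [h1 h2]; split => // /esym.
  have K q : q.1.1 < q.2.1 -> bird (v i) q.1 t = bird (v i) q.2 t ->
      kth_time (v i) (v i) 1 q t.
    move=> qlt qE; split => //; have r0 : 0 < (rel_coord q).1.1 by rewrite subr_gt0.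
    exists [::]; split => //; split => //; apply/seteqP; split => u //= [ut uE].
    have h1 := (meet_rel (v i) (v i) q t).1 qE.
    have h2 := (meet_rel (v i) (v i) q u).1 uE.
    have := (meet_crossing vi erefl (t - q.2.1) r0).1 h1.
    rewrite -((meet_crossing vi erefl (u - q.2.1) r0).1 h2) => /addIr tu.
    by rewrite tu ltxx in ut.
  case: (ltgtP (shead v s).1 (shead v s').1) => hT.
  + by exists s, s'; split => //; exact: K.
  + by exists s', s; split => //; exact: K.
  exfalso; case: hs => ss' [[sS _] [s'S _]]; apply: ss'; apply: inj => //.
    by rewrite si s'i.
  move/bird_eq: E; rewrite hT => /addrI/eqP; rewrite eqf_sqr.
  have := @head_ge0 R (v s.1) s.2; have := @head_ge0 R (v s'.1) s'.2.
  rewrite -/(shead v s) -/(shead v s'); case: (shead v s) hT => [T H]; case: (shead v s') => [T' H'] /= <-.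
  move=> h1 h2 /orP[/eqP ->//|/eqP h]; congr pair; lra.
Qed.

(** Integrating out the lag leaves a function of the larger height alone, and the quarter-plane
    integral of that function is [1 / total_rate]. *)
Lemma same_pair_integral (i : 'I_n) :
  pair_integral lam v i (fun=> 1) (crossing_time (v i)) =
  (Num.sqrt (pi / total_rate lam) / v i / total_rate lam)%:E.
Proof.
have L0 := total_rate_gt0 i; have vi := v0 i; set L := total_rate lam in L0 *.
have mg := (measurable_EFinP _ _).2 (measurable_max_gauss L).
have c0 : 0 <= Num.sqrt (pi / L) / v i by rewrite divr_ge0 ?sqrtr_ge0 ?ltW.
transitivity (\int[leb]_(h' in `[0%R, +oo[) ((Num.sqrt (pi / L) / v i)%:E *
    \int[leb]_(h in `[0%R, +oo[) (expR (- (L * Num.max h' h ^+ 2)))%:E))%E.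
  apply: eq_integral => h'; rewrite inE/= in_itv/= andbT => h'0.
  rewrite -ge0_integralZl_EFin//; last first.
    apply: measurable_funTS; exact: (measurableT_comp mg (pair1_measurable h')).
  apply: eq_integral => h; rewrite inE/= in_itv/= andbT => h0.
  rewrite -EFinM maxC -(crossing_density L0 vi h0 h'0).
  congr integral; apply/seteqP; split => t /=; rewrite in_itv/= andbT; first by case.
  by move=> ->; rewrite ltr01.
rewrite ge0_integralZl_EFin//; last 2 first.
- by move=> x _; apply: integral_ge0.
- apply: measurable_funTS.
  by apply: (measurable_inner_integral _ mg) => // p; rewrite lee_fin expR_ge0.
by rewrite integral_max_gauss// -EFinM mul1r.
Qed.

End Intensities.

Lemma integral_halfline_split (R : realType) (c : R) (J : R -> \bar R) : 0 <= c ->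
  measurable_fun setT J -> (forall x, 0 <= J x)%E ->
  (\int[@lebesgue_measure R]_(x in `[0%R, +oo[) J x =
   \int[@lebesgue_measure R]_(x in `[0%R, c]) J x + \int[@lebesgue_measure R]_(x in `]c, +oo[) J x)%E.
Proof.
move=> c0 mJ J0.
have -> : `[0, +oo[%classic = `[0, c]%classic `|` `]c, +oo[%classic :> set R.
  apply/seteqP; split => x /=; rewrite !in_itv/= !andbT.
    by move=> ->/=; have [|] := leP x c; [left|right].
  by move=> [/andP[]//|/ltW]; exact: le_trans.
rewrite ge0_integral_setU//; first exact: measurable_funTS.
apply/disj_setPS => x [/=]; rewrite !in_itv/= andbT => /andP[_ h1] h2.
by have := lt_le_trans h2 h1; rewrite ltxx.
Qed.

(** * Symmetry and explicit integrals for different speeds *)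

Section MixedIntegrals.
Variables (R : realType) (n : nat) (lam v : 'I_n -> R).
Hypothesis v0 : forall i, 0 < v i.
Local Notation leb := (@lebesgue_measure R).
Local Notation R3 := ((R * R) * R)%type.

Let patch_of i j k : R3 -> \bar R :=
  rel_patch (discriminant (v i) (v j)) (root_time (v i) (v j) k) (v j) (total_rate lam).

Let m_patch i j k : measurable_fun setT (patch_of i j k).
Proof. by apply: measurable_rel_patch; [exact: measurable_discriminant|exact: measurable_root_time]. Qed.

Lemma pair_integral_patch i j k :
  pair_integral lam v j (discriminant (v i) (v j)) (root_time (v i) (v j) k) =
  (\int[leb]_h' \int[leb]_h \int[leb]_t patch_of i j k ((t, h), h'))%E.
Proof. by rewrite /patch_of rel_patch_integral. Qed.

Lemma discriminant_swap w1 w2 (t h h' : R) :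
  discriminant w2 w1 ((t, h'), h) = discriminant w1 w2 ((t, h), h').
Proof. rewrite /discriminant /Delta/=; ring. Qed.

(* Swapping the roles of the two birds reverses time, hence exchanges the two intersections. *)
Lemma root_time_swap w1 w2 k k' (t h h' : R) : 0 < w1 -> 0 < w2 -> w1 != w2 ->
  (-1) ^+ k' = - (-1) ^+ k :> R ->
  root_time w2 w1 k' ((t, h'), h) = - (root_time w1 w2 k ((t, h), h') + t).
Proof.
move=> w10 w20 w12 kk'; rewrite /root_time discriminant_swap kk'/=.
have := speed_diff_neq0 w10 w20 w12; set A := w2 ^+ 2 - w1 ^+ 2 => A0.
have -> : w1 ^+ 2 - w2 ^+ 2 = - A by rewrite opprB.
rewrite sgrN; move: (Num.sg A) (Num.sqrt _) ((-1) ^+ k) => a r e.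
have -> : w2 ^+ 2 = A + w1 ^+ 2 by rewrite /A; ring.
by field.
Qed.

(** The discriminant is symmetric in the two birds, so the domain is preserved, and the density is
    the void probability at a meeting point that both birds share. What remains is to exchange the
    integrals over the two heights. *)
Lemma pair_integral_swap i j k k' : v i != v j -> (k = 1 \/ k = 2)%N -> (k + k' = 3)%N ->
  pair_integral lam v j (discriminant (v i) (v j)) (root_time (v i) (v j) k) =
  pair_integral lam v i (discriminant (v j) (v i)) (root_time (v j) (v i) k').
Proof.
move=> vij k12 kk'; have [vi vj] := (v0 i, v0 j).
have sgn : (-1) ^+ k' = - (-1) ^+ k :> R.
  have -> : k' = (3 - k)%N by rewrite -kk' addKn.
  by case: k12 => ->; rewrite /= ?expr1 ?sqrrN ?expr1n ?opprK//.
have sw t h h' : patch_of j i k' ((t, h'), h) = patch_of i j k ((t, h), h').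
  rewrite /patch_of /rel_patch /patch.
  have -> : (((t, h'), h) \in rel_domain (discriminant (v j) (v i))) =
            (((t, h), h') \in rel_domain (discriminant (v i) (v j))).
    by apply/idP/idP; rewrite !inE /rel_domain/= discriminant_swap => -[].
  case: ifPn => //; rewrite inE => -[/= h0 h'0 t0 d0]; congr (expR (- (_ * _)))%:E.
  rewrite (root_time_swap _ _ _ vi vj vij sgn) sqrrN.
  (* The meeting equation identifies the squared height computed on the left bird with that on the
     right one. *)
  by have /(root_time_meet vi vj vij k12 d0) [/meetE/= -> _] : root_time (v i) (v j) k (t, h, h') =
    root_time (v i) (v j) k (t, h, h') by [].
rewrite !pair_integral_patch.
have mg : measurable_fun setT (fun p : (R * R) * R => patch_of i j k ((p.2, p.1.2), p.1.1)).
  apply: (measurableT_comp (m_patch i j k)).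
  apply: measurable_fun_pair; last exact: measurable_r3_1.
  by apply: measurable_fun_pair; [exact: measurable_r3_3|exact: measurable_r3_2].
have g0 p : (0 <= patch_of i j k p)%E by exact: rel_patch_ge0.
have mG := measurable_inner_integral measurableT mg (fun p => g0 _).
pose g (p : R * R) : \bar R := (\int[leb]_t patch_of i j k ((t, p.2), p.1))%E.
have gs0 p : (0 <= g p)%E by exact: integral_ge0.
transitivity (\int[leb]_y \int[leb]_x g (x, y))%E; first exact: (leb_swap mG gs0).
apply: eq_integral => h _; apply: eq_integral => h' _; apply: eq_integral => t _.
by rewrite sw.
Qed.

(** For [h <= h'] the discriminant equals [(vj vi)^2 (t^2 - tstar^2)], so its sign compares two
    nonnegative numbers. *)
Lemma tstar_ltE (vi vj t h h' : R) : 0 < vi -> vi < vj -> 0 <= h <= h' ->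
  (0 < t /\ 0 < discriminant vi vj ((t, h), h')) <-> tstar vi vj h' h < t.
Proof.
move=> vi0 vij /andP[h0 hh']; have vj0 := lt_trans vi0 vij.
have A0 : 0 <= vj ^+ 2 - vi ^+ 2 by rewrite subr_ge0 ler_sqr ?nnegrE ?ltW.
have B0 : 0 <= h' ^+ 2 - h ^+ 2 by rewrite subr_ge0 ler_sqr// nnegrE (le_trans h0).
have vv : 0 < vj * vi by rewrite mulr_gt0.
have ts0 : 0 <= tstar vi vj h' h by rewrite /tstar !mulr_ge0 ?sqrtr_ge0// invr_ge0 ltW.
have ts2 : (vj * vi) ^+ 2 * tstar vi vj h' h ^+ 2 = (h' ^+ 2 - h ^+ 2) * (vj ^+ 2 - vi ^+ 2).
  rewrite /tstar !exprMn !sqr_sqrtr// exprVn.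
  by field; rewrite !gt_eqF.
have dE : discriminant vi vj ((t, h), h') = (vj * vi) ^+ 2 * (t ^+ 2 - tstar vi vj h' h ^+ 2).
  by rewrite mulrBr ts2 /discriminant /Delta/= exprMn; ring.
rewrite dE pmulr_rgt0 ?exprn_gt0// subr_gt0; split => [[t0]|ht].
  by rewrite ltr_sqr ?nnegrE// ltW.
have t0 := le_lt_trans ts0 ht.
by rewrite ltr_sqr// nnegrE ltW.
Qed.

Lemma rel_density_hhat2 i j k (t h h' : R) : v i < v j ->
  rel_density (root_time (v i) (v j) k) (v j) (total_rate lam) ((t, h), h') =
  expR (- ((\sum_(l < n) lam l) * pi * hhat2 k (v i) (v j) t h' h)).
Proof.
move=> vij; rewrite /rel_density /root_time /hhat2 /discriminant/=.
by rewrite gtr0_sg ?mul1r// subr_gt0 ltr_sqr ?nnegrE ?ltW.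
Qed.

(** The right head has type [j], so [h'] plays the role of [hj] and [h] that of [hi]. For [h <= h']
    a positive discriminant means a lag above [tstar]; for [h > h'] it is automatic for a positive
    lag. Closing the intervals changes null sets only. *)
Lemma Lambda_formulaE i j k : v i < v j ->
  ((mass lam v i * mass lam v j)%:E *
    pair_integral lam v j (discriminant (v i) (v j)) (root_time (v i) (v j) k) =
   Lambda_formula (\sum_(l < n) lam l) (lam i) (lam j) (v i) (v j) k)%E.
Proof.
move=> vij; have [vi vj] := (v0 i, v0 j).
have mE : mass lam v i * mass lam v j = 4 * lam i * lam j * v i * v j by rewrite /mass; ring.
rewrite /Lambda_formula mE; congr (_ * _)%E.
apply: eq_integral => h'; rewrite inE/= in_itv/= andbT => h'0.
pose e (p : R * R) : \bar R := (rel_density (root_time (v i) (v j) k) (v j) (total_rate lam) ((p.2, p.1), h'))%:E.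
have mslice : measurable_fun setT (fun p : R * R => (((p.2, p.1), h') : R3)).
  by apply: measurable_fun_pair => //; exact: measurable_fun_pair.
have me : measurable_fun setT e.
  apply/measurable_EFinP; apply: (measurableT_comp _ mslice).
  by apply: measurable_rel_density; exact: measurable_root_time.
have e0 p : (0 <= e p)%E by rewrite lee_fin expR_ge0.
pose J h : \bar R := (\int[leb]_t patch_of i j k ((t, h), h'))%E.
have mJ : measurable_fun setT J.
  exact: (measurable_inner_integral measurableT
    (measurableT_comp (m_patch i j k) mslice) (fun p => rel_patch_ge0 _ _ _ _ _)).
have Jge0 h : (0 <= J h)%E by apply: integral_ge0 => t _; exact: rel_patch_ge0.
have JE h : 0 <= h -> J h = (\int[leb]_(t in [set t | (0 < t /\ 0 < discriminant (v i) (v j) ((t, h), h'))%R]) e (h, t))%E.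
  move=> h0; rewrite [RHS]integral_mkcond; apply: eq_integral => t _.
  rewrite /patch_of /rel_patch /patch; congr (if _ then _ else _).
  by apply/idP/idP; rewrite !inE; [case|case; split].
clearbody J.
transitivity (\int[leb]_(h in `[0%R, +oo[) J h)%E.
  by apply: eq_integral => h; rewrite inE/= in_itv/= andbT => h0; rewrite JE.
rewrite (integral_halfline_split h'0 mJ Jge0).
have eE h t : e (h, t) = (expR (- ((\sum_(l < n) lam l) * pi * hhat2 k (v i) (v j) t h' h)))%:E.
  by rewrite /e rel_density_hhat2.
congr (_ + _)%E.
- apply: eq_integral => h; rewrite inE/= in_itv/= => /[dup] hh /andP[h0 hh'].
  rewrite (JE _ h0).
  have -> : [set t | 0 < t /\ 0 < discriminant (v i) (v j) ((t, h), h')] =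
      `]tstar (v i) (v j) h' h, +oo[%classic.
    apply/seteqP; split => t /=; rewrite in_itv/= andbT.
      by move/(tstar_ltE _ vi vij hh).
    by move/(tstar_ltE _ vi vij hh).
  rewrite integral_itv_obnd_cbnd; last first.
    apply: measurable_funTS; exact: (measurableT_comp me (pair1_measurable h)).
  by apply: eq_integral => t _; exact: eE.
- transitivity (\int[leb]_(h in `]h', +oo[) \int[leb]_(t in `[0%R, +oo[) e (h, t))%E.
    apply: eq_integral => h; rewrite inE/= in_itv/= andbT => hh.
    have h0 := le_trans h'0 (ltW hh).
    rewrite (JE _ h0).
    have -> : [set t | 0 < t /\ 0 < discriminant (v i) (v j) ((t, h), h')] = `]0, +oo[%classic.
      apply/seteqP; split => t /=; rewrite in_itv/= andbT; first by case.
      move=> t0; split => //; rewrite /discriminant /Delta/= ltr_wpDr//.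
        rewrite -mulNr opprB mulr_ge0// subr_ge0 ler_sqr ?nnegrE// ltW//.
      by rewrite !mulr_gt0 ?exprn_gt0.
    rewrite integral_itv_obnd_cbnd//.
    apply: measurable_funTS; exact: (measurableT_comp me (pair1_measurable h)).
  rewrite integral_itv_obnd_cbnd; last first.
    by apply: measurable_funTS; exact: measurable_inner_integral.
  by apply: eq_integral => h _; apply: eq_integral => t _; exact: eE.
Qed.

End MixedIntegrals.

Theorem theorem7p29 (R : realType) (n : nat)
  (lam : 'I_n -> R) (v : 'I_n -> R)
  (d : measure_display) (Omega : measurableType d) (P : probability Omega R)
  (S : Omega -> set (station R n)) :
  (forall i, 0 < lam i) ->
  (forall i, 0 < v i) ->
  (forall i j : 'I_n, (i < j)%N -> v j < v i) ->
  marked_PPP P lam S ->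
  let lamT := \sum_(i < n) lam i in
  (forall i : 'I_n,
     Lambda_same P S v i =
     ((4 * v i * Num.sqrt lamT / pi) * (lam i / lamT) ^+ 2)%:E) /\
  (forall i j : 'I_n, i != j ->
     Lambda_mixed P S v 1 i j = Lambda_mixed P S v 2 j i /\
     Lambda_mixed P S v 2 i j = Lambda_mixed P S v 1 j i) /\
  (forall (i j : 'I_n) (k : nat), (j < i)%N -> (k = 1 \/ k = 2)%N ->
     Lambda_mixed P S v k i j =
     Lambda_formula lamT (lam i) (lam j) (v i) (v j) k).
Proof.
move=> lam0 v0 vdecr PPP lamT.
have vinj i j : i != j -> v i != v j.
  move=> ij; have /orP[h|h] : (i < j)%N || (j < i)%N by rewrite -neq_ltn.
    by rewrite gt_eqF// vdecr.
  by rewrite lt_eqF// vdecr.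
split; last split.
- move=> i; rewrite (same_intensity lam0 v0 PPP) same_pair_integral// -EFinM; congr (_%:E).
  have lamT0 : 0 < lamT.
    by rewrite /lamT (bigD1 i)//= ltr_wpDr// sumr_ge0// => l _; exact: ltW.
  have s0 : 0 < Num.sqrt lamT by rewrite sqrtr_gt0.
  have vi := v0 i; have p0 := pi_gt0 R.
  rewrite /mass /total_rate -/lamT.
  (* The [pi] of the Gaussian cancels the one in the total rate, so the square root contributes only
     a power of [lamT]. *)
  have -> : pi / (lamT * pi) = lamT^-1 by move: (pi : R) p0 => p p0; field; rewrite !gt_eqF.
  rewrite sqrtrV ?(ltW lamT0)//.
  have := sqr_sqrtr (ltW lamT0); move: (Num.sqrt lamT) s0 => s s0 <-.
  by move: (pi : R) p0 => p p0; field; rewrite !gt_eqF.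
- have swap i j k k' : i != j -> (k = 1 \/ k = 2)%N -> (k' = 1 \/ k' = 2)%N -> (k + k' = 3)%N ->
      Lambda_mixed P S v k i j = Lambda_mixed P S v k' j i.
    move=> ij k12 k'12 kk'; have vij := vinj _ _ ij; have vji := vinj j i; rewrite eq_sym in vji.
    rewrite (mixed_intensity lam0 v0 PPP vij k12) (mixed_intensity lam0 v0 PPP (vji ij) k'12).
    by rewrite (pair_integral_swap lam v0 vij k12 kk') [(mass lam v i * _)%R]mulrC.
  move=> i j ij; split; apply: swap => //; first [by left|by right].
(* Speeds decrease with the index, so [j < i] gives [v i < v j]: the sign factor in [root_time] is 1
   and the roots are those of the stated formula. *)
- move=> i j k ji k12; have vij : v i < v j by exact: vdecr.
  by rewrite (mixed_intensity lam0 v0 PPP) ?(lt_eqF vij)//; exact: Lambda_formulaE.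
Qed.
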